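(* Let $r\in\{2,3\}$, let $A\in Mat_n(\mathcal A_r)$ be symmetrizable with a prescribed decomposition $A=DB$, $D=\mathrm{diag}(d_1,\dots,d_n)$, $d_j\neq0$, $B=B^T$, and let $\mathfrak g(A)$ be the corresponding (symmetrizable) Lie algebra over $\mathcal A_r$. Fix an $\mathcal A_r$-vector subspace $\mathfrak h_2$ of $\mathfrak h$ complementary to $\mathfrak h_1=\mathrm{span}_{\mathcal A_r}\{\gamma_1,\dots,\gamma_n\}$. Then there exists a non-degenerate symmetric $\mathcal A_r$-valued form $( *|* )$ on $\mathfrak g(A)$ such that: (i) it is left $\mathcal A_r$-linear in the left argument and right $\mathcal A_r$-linear in the right argument; (ii) $(\gamma_j|h)=d_j\langle\beta_j,h\rangle$ for each $h\in\mathfrak h$ and each $j$; (iii) $(h'|h'')=0$ for all $h',h''\in\mathfrak h_2$; (iv) $({}_0x|{}_0y)\in\mathbf R$ for all ${}_0x,{}_0y\in{}_0\mathfrak g(A)$; and moreover: (1) the form is invariant on ${}_0\mathfrak g(A)$, that is $([x,y]|z)=(x|[y,z])$ for all $x,y,z\in{}_0\mathfrak g(A)$; (2) $(\mathfrak g_\beta|\mathfrak g_\delta)=0$ if $\beta+\delta\neq0$; (3) the restriction of $( *|* )$ to $\mathfrak g_\beta+\mathfrak g_{-\beta}$ is non-degenerate for $\beta\neq0$; (4) $[x,y]=(x|y)\nu^{-1}(\beta)$ for each $x\in\mathfrak g_\beta$, $y\in\mathfrak g_{-\beta}$, $\beta\in\Delta$, where $\nu:\mathfrak h\to\mathfrak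 h_l^*$ is the isomorphism with $\langle\nu(h),p\rangle=(h|p)$ for $h,p\in\mathfrak h$.
   Context: $\mathcal A_r$ is the Cayley–Dickson algebra over $\mathbf R$ with standard generators $i_0=1,i_1,\dots,i_{2^r-1}$, $i_j^2=-1$, $i_ji_k=-i_ki_j$ for $1\le j\neq k$ ($\mathcal A_2=\mathbf H$, $\mathcal A_3=\mathbf O$). A vector space over $\mathcal A_r$ is $V={}_0Vi_0\oplus\dots\oplus{}_{2^r-1}Vi_{2^r-1}$ with pairwise isomorphic real vector spaces ${}_jV$; elements ${}_jx\,i_j$ are pure states. An $\mathbf R$-linear map $B$ is left $\mathcal A_r$-linear if $B(z\,{}_0x)=zB({}_0x)$ for ${}_0x\in{}_0V$, $z\in\mathcal A_r$ (right linearity analogously); $\mathfrak h^*_l$ denotes all left $\mathcal A_r$-linear functionals $\mathfrak h\to\mathcal A_r$. A Lie (super-)algebra over $\mathcal A_r$ is $\mathfrak g=\bigoplus_k{}_k\mathfrak g\,i_k$ with pairwise isomorphic real Lie algebras ${}_k\mathfrak g$ and an $\mathbf R$-bilinear bracket such that on pure states $[xi_k,yi_j]=(-1)^{\chi(k,j)+1}[yi_j,xi_k]$ and $[xi_k,[yi_j,zi_s]]+(-1)^{\xi(k,j,s)}[yi_j,[zi_s,xi_k]]+(-1)^{\xi(k,j,s)+\xi(j,s,k)}[zi_s,[xi_k,yi_j]]=0$, where $\chi(k,j)=0$ if $k=0$ or $j=0$ or $k=j$ and $\chi(k,j)=1$ otherwise, and $i_k(i_ji_s)=(-1)^{\xi(k,j,s)}i_j(i_si_k)$,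 $\xi\in\{0,1\}$. Vectors $v_1,\dots,v_m$ are vector independent if for all nonzero $a_j,b_j\in\mathcal A_r$ and all bracketings, $a_1v_1b_1+\dots+a_mv_mb_m\neq0$. A realization of $A=(a_{k,j})\in Mat_n(\mathcal A_r)$ is a triple $(\mathfrak h,\Upsilon,\Upsilon^\vee)$, $\mathfrak h$ an $\mathcal A_r$-vector space, $\Upsilon=\{\beta_1,\dots,\beta_n\}\subset\mathfrak h_l^*$, $\Upsilon^\vee=\{\gamma_1,\dots,\gamma_n\}\subset\mathfrak h$, both vector independent, $\langle\gamma_k,\beta_j\rangle=a_{k,j}$, $n-l=\dim_{\mathcal A_r}\mathfrak h-n$ with $l$ the rank of $A$; here $\langle a,b\rangle:=b(a)$, $\langle{}_0y,\beta_j\rangle\in\mathbf R$ for ${}_0y\in{}_0\mathfrak h$, and $\langle{}_sy\,i_s,{}_k\beta\,i_k\rangle=(-1)^{\chi(s,k)}\langle{}_k\beta\,i_k,{}_sy\,i_s\rangle$. The algebra $\eta(A)$ over $\mathcal A_r$ has generators $e_j,f_j\in{}_0\eta(A)$ ($1\le j\le n$), $h\in\mathfrak h$ and relations $[e_k,f_j]=\delta_{k,j}\gamma_j$; $[h,h']=0$; $[h,e_j]=\langle\beta_j,h\rangle e_j$; $[h,f_j]=-\langle\beta_j,h\rangle f_j$; $[au,bv]=(ab)[u,v]=[u,v](ab)$ for $a,b\in\mathcal A_r$, $u,v\in{}_0\eta(A)$. Let $\tau$ be the maximal ideal of $\eta(A)$ among those having trivial intersection with $\mathfrak h$; $\mathfrak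 g(A)=\eta(A)/\tau$. Put $\mathfrak g_\beta=\{x\in\mathfrak g(A):[h,x]=\beta(h)x\ \forall h\in\mathfrak h\}$ for $\beta\in Q=\sum_j\mathbf Z\beta_j$; $\Delta$ is the set of roots, i.e. $\beta\in Q$, $\beta\ne0$, $\mathfrak g_\beta\neq0$.
   Formalization: It is assumed that h embeds in η(A) (equivalently every γ_j lies in ₀h, so A is real) and that the d_j are real; ''symmetric'' means (x i_k|y i_j) = (-1)^χ(k,j) (y i_j|x i_k). Otherwise (ii), (iv), the isomorphism ν, or (i) with non-degeneracy fails. *)

(* Defs.v *)
From HB Require Import structures.
From mathcomp Require Import all_boot all_order all_algebra ring.
From mathcomp Require Import mathcomp_extra boolp classical_sets reals.

Set Implicit Arguments.
Unset Strict Implicit.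
Unset Printing Implicit Defensive.

Import Order.TTheory GRing.Theory Num.Theory.
Local Open Scope ring_scope.

Fixpoint cddim (r : nat) : nat :=
  if r is r'.+1 then (cddim r' + cddim r')%N else 1%N.

Lemma cddimE r : cddim r = (2 ^ r)%N.
Proof. by elim: r => //= r ->; rewrite expnS mul2n addnn. Qed.

Notation cd R r := 'rV[R]_(cddim r).

Section CayleyDickson.
Variable R : realType.

Fixpoint cdconj r : cd R r -> cd R r :=
  match r with
  | 0 => fun x => x
  | r'.+1 => fun x : 'rV_(cddim r' + cddim r') =>
      row_mx (cdconj (lsubmx x)) (- rsubmx x)
  end.

(* Doubling: (a, b) (c, d) = (a c - d^* b, d a + b c^* ). *)
Fixpoint cdmul r : cd R r -> cd R r -> cd R r :=
  match r with
  | 0 => fun x y => x 0 0 *: y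
  | r'.+1 => fun x y : 'rV_(cddim r' + cddim r') =>
      let a := lsubmx x in let b := rsubmx x in
      let c := lsubmx y in let d := rsubmx y in
      row_mx (cdmul a c - cdmul (cdconj d) b) (cdmul d a + cdmul b (cdconj c))
  end.

Fixpoint cdi0 r : 'I_(cddim r) :=
  match r with
  | 0 => ord0
  | r'.+1 => lshift (cddim r') (cdi0 r')
  end.

Definition cdgen r (j : 'I_(cddim r)) : cd R r := delta_mx 0 j.

Definition cdreal r (a : cd R r) : Prop := exists c : R, a = c *: cdgen (cdi0 r).

Definition chi r (k j : 'I_(cddim r)) : bool :=
  [&& k != cdi0 r, j != cdi0 r & k != j].

Definition xi r (k j s : 'I_(cddim r)) : bool :=
  cdmul (cdgen k) (cdmul (cdgen j) (cdgen s))
    != cdmul (cdgen j) (cdmul (cdgen s) (cdgen k)).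

Lemma val_cdi0 r : cdi0 r = 0%N :> nat.
Proof. by elim: r. Qed.

Lemma row_mx0E m n : row_mx 0 0 = 0 :> 'rV[R]_(m + n).
Proof. exact: row_mx0. Qed.

Lemma cdconjD r (x y : cd R r) : cdconj (x + y) = cdconj x + cdconj y.
Proof.
elim: r x y => [|r IH] x y //=.
by rewrite !linearD /= IH add_row_mx.
Qed.

Lemma cdconjZ r c (x : cd R r) : cdconj (c *: x) = c *: cdconj x.
Proof.
elim: r x => [|r IH] x //=.
by rewrite !linearZ /= IH scale_row_mx scalerN.
Qed.

Lemma cdmulD r (x y z : cd R r) :
  cdmul (x + y) z = cdmul x z + cdmul y z /\
  cdmul z (x + y) = cdmul z x + cdmul z y.
Proof.
elim: r x y z => [|r IH] x y z.
  by rewrite /= mxE scalerDl scalerDr.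
have IHl x' y' z' := (IH x' y' z').1; have IHr x' y' z' := (IH x' y' z').2.
split; rewrite /= !linearD /= ?cdconjD !IHl !IHr add_row_mx opprD.
  by rewrite addrACA [X in row_mx _ X]addrACA.
by rewrite addrACA [X in row_mx _ X]addrACA.
Qed.

Lemma cdmulDl r (x y z : cd R r) : cdmul (x + y) z = cdmul x z + cdmul y z.
Proof. by case: (cdmulD x y z). Qed.

Lemma cdmulDr r (x y z : cd R r) : cdmul z (x + y) = cdmul z x + cdmul z y.
Proof. by case: (cdmulD x y z). Qed.

Lemma cdmulZ r c (x y : cd R r) :
  cdmul (c *: x) y = c *: cdmul x y /\ cdmul x (c *: y) = c *: cdmul x y.
Proof.
elim: r x y => [|r IH] x y /=.
  by rewrite mxE !scalerA; split; rewrite 1?[c * _]mulrC.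
have IHl x' y' := (IH x' y').1; have IHr x' y' := (IH x' y').2.
by split; rewrite !linearZ /= ?cdconjZ !IHl !IHr scale_row_mx scalerDr scalerN
   ?IHl ?IHr ?scalerDr.
Qed.

Lemma cdmulZl r c (x y : cd R r) : cdmul (c *: x) y = c *: cdmul x y.
Proof. by case: (cdmulZ c x y). Qed.

Lemma cdmulZr r c (x y : cd R r) : cdmul x (c *: y) = c *: cdmul x y.
Proof. by case: (cdmulZ c x y). Qed.

Lemma cdmul0l r (x : cd R r) : cdmul 0 x = 0.
Proof. by have := cdmulZl 0 0 x; rewrite !scale0r. Qed.

Lemma cdmul0r r (x : cd R r) : cdmul x 0 = 0.
Proof. by have := cdmulZr 0 x 0; rewrite !scale0r. Qed.

Lemma cdconj0 r : cdconj (0 : cd R r) = 0.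
Proof. by have := cdconjZ 0 (0 : cd R r); rewrite !scale0r. Qed.

Lemma cdconjN r (x : cd R r) : cdconj (- x) = - cdconj x.
Proof. by rewrite -scaleN1r cdconjZ scaleN1r. Qed.

Lemma cdmulNl r (x y : cd R r) : cdmul (- x) y = - cdmul x y.
Proof. by rewrite -scaleN1r cdmulZl scaleN1r. Qed.

Lemma cdmulNr r (x y : cd R r) : cdmul x (- y) = - cdmul x y.
Proof. by rewrite -scaleN1r cdmulZr scaleN1r. Qed.

Lemma delta_lshift m n (j : 'I_m) :
  delta_mx 0 (lshift n j) = row_mx (delta_mx 0 j) 0 :> 'rV[R]_(m + n).
Proof.
apply/rowP=> k; rewrite !mxE eqxx /=; case: split_ordP => k' ->; rewrite mxE.
  by rewrite eqxx eq_lshift.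
by rewrite eq_sym eq_lrshift.
Qed.

Lemma delta_rshift m n (j : 'I_n) :
  delta_mx 0 (rshift m j) = row_mx 0 (delta_mx 0 j) :> 'rV[R]_(m + n).
Proof.
apply/rowP=> k; rewrite !mxE eqxx /=; case: split_ordP => k' ->; rewrite mxE.
  by rewrite eq_lrshift.
by rewrite eqxx eq_rshift.
Qed.

Lemma cdgen_lshift r (j : 'I_(cddim r)) :
  cdgen (lshift (cddim r) j : 'I_(cddim r.+1)) = row_mx (cdgen j) 0.
Proof. exact: delta_lshift. Qed.

Lemma cdgen_rshift r (j : 'I_(cddim r)) :
  cdgen (rshift (cddim r) j : 'I_(cddim r.+1)) = row_mx 0 (cdgen j).
Proof. exact: delta_rshift. Qed.

Lemma cdconj_gen r (j : 'I_(cddim r)) :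
  cdconj (cdgen j) = (-1) ^+ (j != cdi0 r) *: cdgen j.
Proof.
elim: r j => [|r IH] j.
  by rewrite (ord1 j) (ord1 (cdi0 0)) eqxx scale1r.
move: j; rewrite [cddim r.+1]/= => j; case: (split_ordP j) => k ->.
  rewrite cdgen_lshift /= row_mxKl row_mxKr IH oppr0 scale_row_mx scaler0.
  by rewrite eq_lshift.
rewrite cdgen_rshift /= row_mxKl row_mxKr cdconj0 scale_row_mx scaler0.
by rewrite eq_sym eq_lrshift /= expr1 scaleN1r.
Qed.

Lemma cdmul1 r (x : cd R r) :
  cdmul (cdgen (cdi0 r)) x = x /\ cdmul x (cdgen (cdi0 r)) = x.
Proof.
elim: r x => [|r IH] x.
  rewrite /cdgen /= !mxE eqxx scale1r; split=> //.
  by apply/rowP=> j; rewrite !mxE (ord1 j) eqxx mulr1.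
have IHl y := (IH y).1; have IHr y := (IH y).2.
have conj1 : cdconj (cdgen (cdi0 r)) = cdgen (cdi0 r).
  by rewrite cdconj_gen eqxx scale1r.
rewrite [cdi0 _]/= cdgen_lshift /= !row_mxKl !row_mxKr conj1 cdconj0.
by rewrite !IHl !IHr !cdmul0r !cdmul0l addr0 subr0 add0r hsubmxK.
Qed.

Lemma cdmul1l r (x : cd R r) : cdmul (cdgen (cdi0 r)) x = x.
Proof. by case: (cdmul1 x). Qed.

Lemma cdmul1r r (x : cd R r) : cdmul x (cdgen (cdi0 r)) = x.
Proof. by case: (cdmul1 x). Qed.

Lemma sgnT (V : lmodType R) (x : V) : (-1) ^+ true *: x = - x.
Proof. exact: scaleN1r. Qed.

Lemma sgnF (V : lmodType R) (x : V) : (-1) ^+ false *: x = x.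
Proof. exact: scale1r. Qed.

(* The index of the generator that [i_j i_k] is proportional to. *)
Fixpoint cdidx r : 'I_(cddim r) -> 'I_(cddim r) -> 'I_(cddim r) :=
  match r with
  | 0 => fun j _ => j
  | r'.+1 => fun j k : 'I_(cddim r' + cddim r') =>
      match split j, split k with
      | inl j', inl k' | inr j', inr k' => lshift _ (cdidx j' k')
      | inl j', inr k' | inr j', inl k' => rshift _ (cdidx j' k')
      end
  end.

Lemma cdidxC r (j k : 'I_(cddim r)) : cdidx j k = cdidx k j.
Proof.
elim: r j k => [|r IH] j k; first by rewrite (ord1 j) (ord1 k).
by rewrite /=; case: (split j); case: (split k) => a b; rewrite IH.
Qed.

Lemma split_lshift m n (j : 'I_m) : split (lshift n j) = inl j.
Proof. by rewrite -[lshift n j]/(unsplit (inl j)) unsplitK. Qed.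

Lemma split_rshift m n (j : 'I_n) : split (rshift m j) = inr j.
Proof. by rewrite -[rshift m j]/(unsplit (inr j)) unsplitK. Qed.

Lemma cdidxA r (j k l : 'I_(cddim r)) :
  cdidx j (cdidx k l) = cdidx (cdidx j k) l.
Proof.
elim: r j k l => [|r IH] j k l //=.
by case: (split j); case: (split k); case: (split l) => a b c;
  rewrite ?split_lshift ?split_rshift IH.
Qed.

Lemma cdmul_gen r (j k : 'I_(cddim r)) :
  exists b : bool, cdmul (cdgen j) (cdgen k) = (-1) ^+ b *: cdgen (cdidx j k).
Proof.
elim: r j k => [|r IH] j k.
  exists false; rewrite expr0 scale1r (ord1 j) (ord1 k) /cdgen /= mxE eqxx.
  by rewrite scale1r.
move: j k; rewrite [cddim r.+1]/= => j k.
case: (split_ordP j) => j' ->; case: (split_ordP k) => k' -> /=;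
  rewrite ?split_lshift ?split_rshift ?(cdgen_lshift, cdgen_rshift);
  rewrite !(row_mxKl, row_mxKr) ?cdconj0 ?cdconj_gen !(cdmul0l, cdmul0r);
  rewrite ?(addr0, add0r, sub0r, subr0, oppr0).
- by case: (IH j' k') => b ->; exists b; rewrite scale_row_mx scaler0.
- by case: (IH k' j') => b ->; exists b; rewrite cdidxC scale_row_mx scaler0.
- case: (IH j' k') => b; rewrite cdmulZr => ->.
  exists ((k' != cdi0 r) (+) b).
  by rewrite scale_row_mx scaler0 scalerA signr_addb.
- case: (IH k' j') => b; rewrite cdmulZl => ->.
  exists (~~ ((k' != cdi0 r) (+) b)).
  by rewrite cdidxC scale_row_mx scaler0 scalerA -signr_addb -scaleNr signrN.
Qed.

Lemma cdmul_genC r (j k : 'I_(cddim r)) :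
  cdmul (cdgen j) (cdgen k) = (-1) ^+ chi j k *: cdmul (cdgen k) (cdgen j).
Proof.
elim: r j k => [|r IH] j k; first by rewrite (ord1 j) (ord1 k) sgnF.
have [->|j0] := eqVneq j (cdi0 r.+1).
  by rewrite /chi eqxx sgnF cdmul1l cdmul1r.
have [->|k0] := eqVneq k (cdi0 r.+1).
  by rewrite /chi eqxx andbF sgnF cdmul1l cdmul1r.
have [->|jk] := eqVneq j k; first by rewrite /chi eqxx !andbF sgnF.
rewrite /chi j0 k0 jk sgnT.
move: j k j0 k0 jk; rewrite [cddim r.+1]/= => j k.
case: (split_ordP j) => j' ->; case: (split_ordP k) => k' -> /=;
  rewrite ?(eq_lshift, eq_rshift) => j0 k0 jk;
  rewrite ?(cdgen_lshift, cdgen_rshift);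
  rewrite !(row_mxKl, row_mxKr) ?cdconj0 ?cdconj_gen !(cdmul0l, cdmul0r);
  rewrite ?(addr0, add0r, sub0r, subr0, oppr0) opp_row_mx oppr0;
  congr row_mx.
- by rewrite IH /chi j0 k0 jk sgnT.
- by rewrite j0 sgnT cdmulNr opprK.
- by rewrite k0 sgnT cdmulNr.
- rewrite !cdmulZl IH /chi.
  have [k'0|k'0] := eqVneq k' (cdi0 r); have [j'0|j'0] := eqVneq j' (cdi0 r);
    rewrite /= ?andbF ?(sgnT, sgnF, opprK) //.
    by rewrite k'0 j'0 eqxx in jk.
  by rewrite eq_sym jk sgnT.
Qed.

Lemma cdgen_neq0 r (j : 'I_(cddim r)) : cdgen j != 0.
Proof.
apply/eqP=> /rowP/(_ j); rewrite !mxE !eqxx => /eqP.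
by rewrite oner_eq0.
Qed.

Lemma xiP r (k j s : 'I_(cddim r)) :
  cdmul (cdgen k) (cdmul (cdgen j) (cdgen s)) =
  (-1) ^+ xi k j s *: cdmul (cdgen j) (cdmul (cdgen s) (cdgen k)).
Proof.
rewrite /xi; case: eqP => [->|]; first by rewrite sgnF.
have [b1 ->] := cdmul_gen j s; rewrite !cdmulZr.
have [b2 ->] := cdmul_gen k (cdidx j s).
have [b3 ->] := cdmul_gen s k; rewrite !cdmulZr.
have [b4 ->] := cdmul_gen j (cdidx s k).
have -> : cdidx k (cdidx j s) = cdidx j (cdidx s k) by rewrite cdidxC cdidxA.
rewrite !scalerA; case: b1; case: b2; case: b3; case: b4;
  rewrite /= ?(expr0, expr1, mulrNN, mulr1, mul1r, mulrN1, opprK) //.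
Qed.

End CayleyDickson.

(* [V = V_0 i_0 (+) ... (+) V_0 i_(2^r-1)]: the [s]-th coordinate of [x] is the
   element [_s x] of the real space [_0 V], to which every [_s V] is
   identified. *)
Notation cdV V r := {ffun 'I_(cddim r) -> V}.

Section CDSpace.
Variables (R : realType) (r : nat).
Implicit Types (V : lmodType R) (a b : cd R r).

Definition pure V (s : 'I_(cddim r)) (x : V) : cdV V r :=
  [ffun k => if k == s then x else 0].

Definition pure0 V (x : V) : cdV V r := pure (cdi0 r) x.

(* [a (x i_s) = x (a i_s)] and [(x i_s) a = x (i_s a)] for [x] in [_0 V]. *)
Definition lact V a (v : cdV V r) : cdV V r :=
  [ffun m => \sum_s cdmul a (cdgen R s) 0 m *: v s].

Definition ract V (v : cdV V r) a : cdV V r :=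
  [ffun m => \sum_s cdmul (cdgen R s) a 0 m *: v s].

Definition cdsubspace V (W : set (cdV V r)) : Prop :=
  [/\ W 0, (forall x y, W x -> W y -> W (x + y)),
      (forall a x, W x -> W (lact a x)) & (forall a x, W x -> W (ract x a))].

Definition cdspan V (S : set (cdV V r)) : set (cdV V r) :=
  [set x | forall W : set (cdV V r), cdsubspace W -> (S `<=` W)%classic -> W x].

Definition left_linear V (W : lmodType R) (lW : cd R r -> W -> W)
    (f : cdV V r -> W) : Prop :=
  linear f /\ forall z (x : V), f (lact z (pure0 x)) = lW z (f (pure0 x)).

Definition right_linear V (W : lmodType R) (rW : W -> cd R r -> W)
    (f : cdV V r -> W) : Prop :=
  linear f /\ forall z (x : V), f (ract (pure0 x) z) = rW (f (pure0 x)) z.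

Definition cd_linear V V' (f : cdV V r -> cdV V' r) : Prop :=
  left_linear (@lact V') f /\ right_linear (@ract V') f.

(* [p j] selects the bracketing of [a_j v_j b_j]. *)
Definition triple V (p : bool) a (v : cdV V r) b : cdV V r :=
  if p then ract (lact a v) b else lact a (ract v b).

(* The coefficients are required to be not all zero; if [a_j v_j b_j] is absent
   from the combination one of [a_j], [b_j] is zero. *)
Definition vector_independent V (I : finType) (J : {set I}) (v : I -> cdV V r) :
    Prop :=
  forall (a b : I -> cd R r) (p : I -> bool),
    (exists2 j, j \in J & (a j != 0) && (b j != 0)) ->
    \sum_(j in J) triple (p j) (a j) (v j) (b j) != 0.

(* The [j]-th row of [A] as an element of [A_r^n]. *)
Definition cdrow n (A : 'M[cd R r]_n) (j : 'I_n) : cdV 'rV[R]_n r :=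
  [ffun s => \row_k A j k 0 s].

Definition cdrank n (A : 'M[cd R r]_n) : nat :=
  \max_(J : {set 'I_n} | `[< vector_independent J (cdrow A) >]) #|J|.

End CDSpace.

(* A left linear functional is [sum_k (_k beta) i_k] with real functionals
   [_k beta] on [_0 h]; see [left_functionalP]. *)

Notation cddual R h r := (cdV 'Hom(h, R^o) r).

Section Dual.
Variables (R : realType) (r : nat) (h : vectType R).
Implicit Types (beta : cddual R h r) (x : cdV h r).

(* [beta (x)], also written [<x, beta>]. *)
Definition ev beta x : cd R r :=
  \sum_s cdmul (cdgen R s) (\row_k beta k (x s)).

(* [<beta, x>], from
   [<_s x i_s, _k beta i_k> = (-1)^chi(s,k) <_k beta i_k, _s x i_s>]. *)
Definition pairing beta x : cd R r :=
  \sum_s \sum_k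
    (-1) ^+ chi s k *: ev (pure k (beta k)) (pure s (x s)).

End Dual.

Section CDSpaceTheory.
Variables (R : realType) (r : nat).
Implicit Types (V : lmodType R) (a b : cd R r).

Lemma cd_sum_gen a : a = \sum_s a 0 s *: cdgen R s.
Proof. exact: row_sum_delta. Qed.

Lemma cdmul_suml (I : finType) (F : I -> cd R r) b :
  cdmul (\sum_i F i) b = \sum_i cdmul (F i) b.
Proof.
elim/big_rec2: _ => [|i y1 y2 _ <-]; first exact: cdmul0l.
exact: cdmulDl.
Qed.

Lemma cdmul_sumr (I : finType) (F : I -> cd R r) b :
  cdmul b (\sum_i F i) = \sum_i cdmul b (F i).
Proof.
elim/big_rec2: _ => [|i y1 y2 _ <-]; first exact: cdmul0r.
exact: cdmulDr.
Qed.

Lemma cdmul_sum_genl a b : cdmul a b = \sum_s a 0 s *: cdmul (cdgen R s) b.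
Proof.
rewrite [in LHS](cd_sum_gen a) cdmul_suml.
by apply: eq_bigr => s _; rewrite cdmulZl.
Qed.

Lemma cdmul_sum_genr a b : cdmul a b = \sum_s b 0 s *: cdmul a (cdgen R s).
Proof.
rewrite [in LHS](cd_sum_gen b) cdmul_sumr.
by apply: eq_bigr => s _; rewrite cdmulZr.
Qed.

Lemma pure_sum V (x : cdV V r) : x = \sum_s pure s (x s).
Proof.
apply/ffunP=> m; rewrite sum_ffunE (bigD1 m) //= ffunE eqxx big1 ?addr0 //.
by move=> s sm; rewrite ffunE eq_sym (negPf sm).
Qed.

Lemma lact_pure0E V a (x : V) : lact a (pure0 r x) = [ffun m => a 0 m *: x].
Proof.
apply/ffunP=> m; rewrite !ffunE (bigD1 (cdi0 r)) //= ffunE eqxx cdmul1r.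
rewrite big1 ?addr0 // => s s0; by rewrite ffunE (negPf s0) scaler0.
Qed.

Lemma ract_pure0 V a (x : V) : ract (pure0 r x) a = lact a (pure0 r x).
Proof.
apply/ffunP=> m; rewrite lact_pure0E !ffunE (bigD1 (cdi0 r)) //= ffunE eqxx.
rewrite cdmul1l big1 ?addr0 // => s s0; by rewrite ffunE (negPf s0) scaler0.
Qed.

Lemma pureE V s (x : V) : pure s x = lact (cdgen R s) (pure0 r x).
Proof.
apply/ffunP=> m; rewrite lact_pure0E !ffunE mxE eqxx /=.
by case: eqP => _; rewrite ?scale1r ?scale0r.
Qed.

Lemma pure0E V (x : V) : pure0 r x = lact (cdgen R (cdi0 r)) (pure0 r x).
Proof. by rewrite -pureE. Qed.

Lemma lactD V a (x y : cdV V r) : lact a (x + y) = lact a x + lact a y.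
Proof.
apply/ffunP=> m; rewrite !ffunE -big_split /=.
by apply: eq_bigr => s _; rewrite ffunE scalerDr.
Qed.

Lemma ractD V a (x y : cdV V r) : ract (x + y) a = ract x a + ract y a.
Proof.
apply/ffunP=> m; rewrite !ffunE -big_split /=.
by apply: eq_bigr => s _; rewrite ffunE scalerDr.
Qed.

Lemma lact0 V a : lact a (0 : cdV V r) = 0.
Proof. by apply/ffunP=> m; rewrite !ffunE big1 // => s _; rewrite ffunE scaler0. Qed.

Lemma ract0 V a : ract (0 : cdV V r) a = 0.
Proof. by apply/ffunP=> m; rewrite !ffunE big1 // => s _; rewrite ffunE scaler0. Qed.

Lemma lactA_pure0 V a b (x : V) :
  lact a (lact b (pure0 r x)) = lact (cdmul a b) (pure0 r x).
Proof.
rewrite (lact_pure0E (cdmul a b)) lact_pure0E; apply/ffunP=> m; rewrite !ffunE.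
rewrite cdmul_sum_genr summxE scaler_suml; apply: eq_bigr => s _.
by rewrite ffunE mxE scalerA mulrC.
Qed.

Lemma ractA_pure0 V a b (x : V) :
  ract (lact a (pure0 r x)) b = lact (cdmul a b) (pure0 r x).
Proof.
rewrite (lact_pure0E (cdmul a b)) lact_pure0E; apply/ffunP=> m; rewrite !ffunE.
rewrite cdmul_sum_genl summxE scaler_suml; apply: eq_bigr => s _.
by rewrite ffunE mxE scalerA mulrC.
Qed.

Lemma lactDl V a b (x : cdV V r) : lact (a + b) x = lact a x + lact b x.
Proof.
apply/ffunP=> m; rewrite !ffunE -big_split /=.
by apply: eq_bigr => s _; rewrite cdmulDl mxE scalerDl.
Qed.

Lemma lactZl V c a (x : cdV V r) : lact (c *: a) x = c *: lact a x.
Proof.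
apply/ffunP=> m; rewrite !ffunE scaler_sumr.
by apply: eq_bigr => s _; rewrite cdmulZl mxE scalerA.
Qed.

Lemma pure_is_linear V s : linear (@pure R r V s).
Proof.
move=> c x y; apply/ffunP=> m; rewrite !ffunE.
by case: eqP; rewrite ?scaler0 ?addr0.
Qed.

Lemma pure0_is_linear V : linear (@pure0 R r V).
Proof. exact: pure_is_linear. Qed.

Lemma linear_sum_of V (W : lmodType R) (f : V -> W) (I : finType) (F : I -> V) :
  linear f -> f (\sum_i F i) = \sum_i f (F i).
Proof.
move=> lf; have f0 : f 0 = 0.
  by have := lf (-1) 0 0; rewrite !scaleN1r !addNr.
elim/big_rec2: _ => [//|i y1 y2 _ <-].
by have := lf 1 (F i) y2; rewrite !scale1r.
Qed.

End CDSpaceTheory.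

Section DualTheory.
Variables (R : realType) (r : nat) (h : vectType R).

Lemma ev_is_linear (beta : cddual R h r) : linear (ev beta).
Proof.
move=> c x y; rewrite /ev scaler_sumr -big_split /=; apply: eq_bigr => s _.
rewrite -cdmulZr -cdmulDr; congr cdmul; apply/rowP=> k; rewrite !mxE !ffunE.
by rewrite linearP.
Qed.

Lemma ev_lact (beta : cddual R h r) z (x : h) :
  ev beta (lact z (pure0 r x)) = cdmul z (\row_k beta k x).
Proof.
rewrite /ev [RHS]cdmul_sum_genl; apply: eq_bigr => s _.
rewrite -cdmulZr; congr cdmul; apply/rowP=> k; rewrite !mxE lact_pure0E ffunE.
by rewrite linearZ.
Qed.

Lemma ev_pure0 (beta : cddual R h r) (x : h) :
  ev beta (pure0 r x) = \row_k beta k x.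
Proof. by rewrite pure0E ev_lact cdmul1l. Qed.

Lemma left_functionalP (f : cdV h r -> cd R r) :
  left_linear (@cdmul R r) f <-> exists! beta : cddual R h r, f = ev beta.
Proof.
split=> [[lf fl]|[beta [-> _]]]; last first.
  by split=> [|z x]; [exact: ev_is_linear|rewrite ev_lact ev_pure0].
pose phi k (x : h) : R^o := f (pure0 r x) 0 k.
have lphi k : linear (phi k).
  by move=> c x y; rewrite /phi /pure0 pure_is_linear lf !mxE.
pose phiL k := HB.pack_for {linear h -> R^o} (phi k)
  (GRing.isLinear.Build _ _ _ _ (phi k) (lphi k)).
exists [ffun k => linfun (phiL k)]; split=> [|beta fE].
  apply/funext => x; rewrite [in LHS](pure_sum x) (linear_sum_of _ lf).
  apply: eq_bigr => s _; rewrite pureE fl; congr cdmul.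
  by apply/rowP=> k; rewrite mxE ffunE lfunE.
apply/ffunP=> k; apply/lfunP=> x; rewrite ffunE lfunE /= /phi fE ev_pure0.
by rewrite mxE.
Qed.

(* For [beta] in [_0 (h_l^* )] the two pairings agree. *)
Lemma pairing_real (beta : cddual R h r) x :
  (forall y : h, cdreal (ev beta (pure0 r y))) -> pairing beta x = ev beta x.
Proof.
move=> breal; have bk k : k != cdi0 r -> beta k = 0.
  move=> k0; apply/lfunP=> y; have [c] := breal y; rewrite ev_pure0.
  move=> /rowP/(_ k); rewrite !mxE (negPf k0) andbF mulr0 => ->.
  by rewrite lfunE.
rewrite [in RHS](pure_sum x) (linear_sum_of _ (@ev_is_linear beta)).
apply: eq_bigr => s _; rewrite (bigD1 (cdi0 r)) //= /chi eqxx andbF scale1r.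
rewrite big1 ?addr0 => [|k k0].
  rewrite /ev; apply: eq_bigr => t _; congr cdmul; apply/rowP=> k.
  rewrite !mxE ffunE; case: eqP => [-> //|/eqP k0].
  by rewrite bk.
rewrite bk // /ev big1 ?scaler0 // => t _.
rewrite (_ : \row__ _ = 0) ?cdmul0r //; apply/rowP=> l.
by rewrite !mxE ffunE; case: eqP => _; rewrite lfunE.
Qed.

End DualTheory.

Record lieCD (R : realType) (r : nat) := LieCD {
  lie0 : lmodType R;
  bracket : cdV lie0 r -> cdV lie0 r -> cdV lie0 r;
  bracket_linearl : forall y, linear (bracket^~ y);
  bracket_linearr : forall x, linear (bracket x);
  bracket_pure0 : forall x y : lie0,
    exists z, bracket (pure0 r x) (pure0 r y) = pure0 r z;
  bracketC : forall (k j : 'I_(cddim r)) (x y : lie0),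
    bracket (pure k x) (pure j y) =
    (-1) ^+ (chi k j).+1 *: bracket (pure j y) (pure k x);
  bracket_jacobi : forall (k j s : 'I_(cddim r)) (x y z : lie0),
    bracket (pure k x) (bracket (pure j y) (pure s z))
    + (-1) ^+ xi R k j s *: bracket (pure j y) (bracket (pure s z) (pure k x))
    + (-1) ^+ (xi R k j s + xi R j s k) *:
        bracket (pure s z) (bracket (pure k x) (pure j y)) = 0
}.

Notation lieV L := (cdV (lie0 L) _).

Section LieTheory.
Variables (R : realType) (r : nat).

Definition lie_ideal (L : lieCD R r) (I : set (cdV (lie0 L) r)) : Prop :=
  cdsubspace I /\
  forall x y, I y -> I (bracket x y) /\ I (bracket y x).

Definition lie_morphism (L M : lieCD R r)
    (f : cdV (lie0 L) r -> cdV (lie0 M) r) : Prop :=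
  cd_linear f /\ forall x y, f (bracket x y) = bracket (f x) (f y).

End LieTheory.

Section ExtendReal.
Variables (R : realType) (r : nat) (V : lmodType R) (br : V -> V -> V).
Hypothesis br_linearl : forall y, linear (br^~ y).
Hypothesis br_linearr : forall x, linear (br x).
Hypothesis brC : forall x y, br x y = - br y x.
Hypothesis br_jacobi :
  forall x y z, br x (br y z) + br y (br z x) + br z (br x y) = 0.

(* [[x a, y b] = [x, y] (a b)] for [x], [y] in [V]. *)
Definition extbr (x y : cdV V r) : cdV V r :=
  [ffun m => \sum_s \sum_t
     cdmul (cdgen R s) (cdgen R t) 0 m *: br (x s) (y t)].

Lemma br0l y : br 0 y = 0.
Proof. by have := br_linearl y (-1) 0 0; rewrite /= !scaleN1r !addNr. Qed.

Lemma br0r x : br x 0 = 0.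
Proof. by have := br_linearr x (-1) 0 0; rewrite /= !scaleN1r !addNr. Qed.

Lemma brZl c x y : br (c *: x) y = c *: br x y.
Proof. by have := br_linearl y c x 0; rewrite /= br0l !addr0. Qed.

Lemma brZr c x y : br x (c *: y) = c *: br x y.
Proof. by have := br_linearr x c y 0; rewrite /= br0r !addr0. Qed.

Lemma extbr_lact a b x y :
  extbr (lact a (pure0 r x)) (lact b (pure0 r y)) =
  lact (cdmul a b) (pure0 r (br x y)).
Proof.
rewrite !lact_pure0E; apply/ffunP=> m; rewrite !ffunE.
rewrite cdmul_sum_genl summxE scaler_suml; apply: eq_bigr => s _.
rewrite cdmul_sum_genr mxE summxE mulr_sumr scaler_suml; apply: eq_bigr => t _.
rewrite !ffunE brZl brZr !mxE !scalerA; congr (_ *: _).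
by rewrite mulrC -mulrA; congr (_ * _).
Qed.

Lemma extbr_pure0 x y : extbr (pure0 r x) (pure0 r y) = pure0 r (br x y).
Proof.
by rewrite (pure0E _ x) (pure0E _ y) extbr_lact cdmul1l -pure0E.
Qed.

Lemma extbr_pure k j x y :
  extbr (pure k x) (pure j y) =
  lact (cdmul (cdgen R k) (cdgen R j)) (pure0 r (br x y)).
Proof. by rewrite !pureE extbr_lact. Qed.

Lemma extbr_linearl y : linear (extbr^~ y).
Proof.
move=> c x x'; apply/ffunP=> m; rewrite !ffunE scaler_sumr -big_split /=.
apply: eq_bigr => s _; rewrite scaler_sumr -big_split /=; apply: eq_bigr => t _.
by rewrite !ffunE br_linearl scalerDr !scalerA mulrC.
Qed.

Lemma extbr_linearr x : linear (extbr x).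
Proof.
move=> c y y'; apply/ffunP=> m; rewrite !ffunE scaler_sumr -big_split /=.
apply: eq_bigr => s _; rewrite scaler_sumr -big_split /=; apply: eq_bigr => t _.
by rewrite !ffunE br_linearr scalerDr !scalerA mulrC.
Qed.

Lemma lact_pure0N a (x : V) : lact a (pure0 r (- x)) = - lact a (pure0 r x).
Proof.
by rewrite !lact_pure0E; apply/ffunP=> m; rewrite !ffunE scalerN.
Qed.

Lemma extbrC k j x y :
  extbr (pure k x) (pure j y) =
  (-1) ^+ (chi k j).+1 *: extbr (pure j y) (pure k x).
Proof.
rewrite !extbr_pure cdmul_genC lactZl brC lact_pure0N scalerN.
by rewrite exprS mulN1r scaleNr.
Qed.

Lemma extbr_jacobi k j s x y z :
  extbr (pure k x) (extbr (pure j y) (pure s z))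
  + (-1) ^+ xi R k j s *: extbr (pure j y) (extbr (pure s z) (pure k x))
  + (-1) ^+ (xi R k j s + xi R j s k) *:
      extbr (pure s z) (extbr (pure k x) (pure j y)) = 0.
Proof.
rewrite !extbr_pure !pureE !extbr_lact -!lactZl exprD -scalerA -!xiP.
rewrite !lact_pure0E; apply/ffunP=> m; rewrite !ffunE -!scalerDr br_jacobi.
by rewrite scaler0.
Qed.

Definition extend_real : lieCD R r :=
  @LieCD R r V extbr extbr_linearl extbr_linearr
    (fun x y => ex_intro _ _ (extbr_pure0 x y)) extbrC extbr_jacobi.

End ExtendReal.

Record realization (R : realType) (r n : nat) (A : 'M[cd R r]_n)
    (h : vectType R) (beta : 'I_n -> cddual R h r) (gamma : 'I_n -> cdV h r) :
    Prop := Realization {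
  realization_indep_beta : vector_independent [set: 'I_n] beta;
  realization_indep_gamma : vector_independent [set: 'I_n] gamma;
  realization_entry : forall k j, ev (beta j) (gamma k) = A k j;
  realization_dim :
    (n%:Z - (cdrank A)%:Z = (\dim {:h})%:Z - n%:Z)%R;
  realization_real : forall j (y : h), cdreal (ev (beta j) (pure0 r y))
}.

Inductive eta_term (n : nat) (h : Type) (R : Type) : Type :=
| TE of 'I_n
| TF of 'I_n
| TH of h
| TZero
| TAdd of eta_term n h R & eta_term n h R
| TScale of R & eta_term n h R
| TBr of eta_term n h R & eta_term n h R.

Arguments TE {n h R} _.
Arguments TF {n h R} _.
Arguments TH {n h R} _.
Arguments TZero {n h R}.

HB.instance Definition _ n h R := gen_eqMixin (eta_term n h R).
HB.instance Definition _ n h R := gen_choiceMixin (eta_term n h R).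

Section Eta.
Variables (R : realType) (r n : nat) (h : vectType R).
Variables (beta : 'I_n -> cddual R h r) (gamma : 'I_n -> cdV h r).
Let T := eta_term n h R.

(* The congruence on terms presenting the real Lie algebra [_0 eta]. The
   relations of [eta (A)] are equations between elements of
   [eta (A) = _0 eta i_0 (+) ... (+) _0 eta i_(2^r-1)]; they are imposed
   coordinate by coordinate, [m] being the coordinate. *)
Inductive eta_eq : T -> T -> Prop :=
| eta_refl x : eta_eq x x
| eta_sym x y : eta_eq x y -> eta_eq y x
| eta_trans x y z : eta_eq x y -> eta_eq y z -> eta_eq x z
| eta_congD x x' y y' :
    eta_eq x x' -> eta_eq y y' -> eta_eq (TAdd x y) (TAdd x' y')
| eta_congZ c x x' : eta_eq x x' -> eta_eq (TScale c x) (TScale c x')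
| eta_congB x x' y y' :
    eta_eq x x' -> eta_eq y y' -> eta_eq (TBr x y) (TBr x' y')
| eta_addA x y z : eta_eq (TAdd x (TAdd y z)) (TAdd (TAdd x y) z)
| eta_addC x y : eta_eq (TAdd x y) (TAdd y x)
| eta_add0 x : eta_eq (TAdd TZero x) x
| eta_addN x : eta_eq (TAdd (TScale (-1) x) x) TZero
| eta_scaleA c d x : eta_eq (TScale c (TScale d x)) (TScale (c * d) x)
| eta_scale1 x : eta_eq (TScale 1 x) x
| eta_scaleDr c x y :
    eta_eq (TScale c (TAdd x y)) (TAdd (TScale c x) (TScale c y))
| eta_scaleDl c d x :
    eta_eq (TScale (c + d) x) (TAdd (TScale c x) (TScale d x))
| eta_brl c x y z :
    eta_eq (TBr (TAdd (TScale c x) y) z) (TAdd (TScale c (TBr x z)) (TBr y z))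
| eta_brr c x y z :
    eta_eq (TBr z (TAdd (TScale c x) y)) (TAdd (TScale c (TBr z x)) (TBr z y))
| eta_brC x y : eta_eq (TBr x y) (TScale (-1) (TBr y x))
| eta_jacobi x y z :
    eta_eq (TAdd (TAdd (TBr x (TBr y z)) (TBr y (TBr z x))) (TBr z (TBr x y)))
           TZero
| eta_H c (x y : h) :
    eta_eq (TH (c *: x + y)) (TAdd (TScale c (TH x)) (TH y))
| eta_EF k j (m : 'I_(cddim r)) :
    eta_eq (if m == cdi0 r then TBr (TE k) (TF j) else TZero)
           (if k == j then TH (gamma j m) else TZero)
| eta_HH (x y : h) : eta_eq (TBr (TH x) (TH y)) TZero
| eta_HE (x : cdV h r) j (m : 'I_(cddim r)) :
    eta_eq (TBr (TH (x m)) (TE j)) (TScale (pairing (beta j) x 0 m) (TE j))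
| eta_HF (x : cdV h r) j (m : 'I_(cddim r)) :
    eta_eq (TBr (TH (x m)) (TF j)) (TScale (- pairing (beta j) x 0 m) (TF j)).

Let eta_eqb (x y : T) : bool := `[< eta_eq x y >].

Lemma eta_eqb_refl : reflexive eta_eqb.
Proof. by move=> x; apply/asboolP; exact: eta_refl. Qed.

Lemma eta_eqb_sym : symmetric eta_eqb.
Proof. by move=> x y; apply/asboolP/asboolP; exact: eta_sym. Qed.

Lemma eta_eqb_trans : transitive eta_eqb.
Proof. by move=> y x z /asboolP xy /asboolP/(eta_trans xy)/asboolP. Qed.

Canonical eta_equiv := EquivRel eta_eqb eta_eqb_refl eta_eqb_sym eta_eqb_trans.

Definition eta0 := {eq_quot eta_equiv}%qT.

HB.instance Definition _ := Choice.on eta0.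

Definition cls (x : T) : eta0 := (\pi_({eq_quot eta_equiv}) x)%qT.
Definition rep (x : eta0) : T := generic_quotient.repr (x : {eq_quot eta_equiv}%qT).

Lemma clsP x y : cls x = cls y <-> eta_eq x y.
Proof.
split=> [/eqquotP/asboolP //|xy]; by apply/eqquotP/asboolP.
Qed.

Lemma repK : cancel rep cls.
Proof. exact: generic_quotient.reprK. Qed.

Lemma rep_cls x : eta_eq (rep (cls x)) x.
Proof. by apply/clsP; rewrite repK. Qed.

Lemma cls_ind (P : eta0 -> Prop) : (forall x, P (cls x)) -> forall x, P x.
Proof. by move=> Pc x; rewrite -(repK x). Qed.

Definition eta0_add (x y : eta0) : eta0 := cls (TAdd (rep x) (rep y)).
Definition eta0_opp (x : eta0) : eta0 := cls (TScale (-1) (rep x)).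
Definition eta0_scale c (x : eta0) : eta0 := cls (TScale c (rep x)).
Definition eta0_br (x y : eta0) : eta0 := cls (TBr (rep x) (rep y)).

Lemma cls_add x y : eta0_add (cls x) (cls y) = cls (TAdd x y).
Proof. by apply/clsP; apply: eta_congD; exact: rep_cls. Qed.

Lemma cls_scale c x : eta0_scale c (cls x) = cls (TScale c x).
Proof. by apply/clsP; apply: eta_congZ; exact: rep_cls. Qed.

Lemma cls_br x y : eta0_br (cls x) (cls y) = cls (TBr x y).
Proof. by apply/clsP; apply: eta_congB; exact: rep_cls. Qed.

Lemma eta0_addA : associative eta0_add.
Proof.
elim/cls_ind=> x; elim/cls_ind=> y; elim/cls_ind=> z.
by rewrite !cls_add; apply/clsP; exact: eta_addA.
Qed.

Lemma eta0_addC : commutative eta0_add.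
Proof.
elim/cls_ind=> x; elim/cls_ind=> y.
by rewrite !cls_add; apply/clsP; exact: eta_addC.
Qed.

Lemma eta0_add0 : left_id (cls TZero) eta0_add.
Proof. by elim/cls_ind=> x; rewrite cls_add; apply/clsP; exact: eta_add0. Qed.

Lemma eta0_addN : left_inverse (cls TZero) eta0_opp eta0_add.
Proof.
elim/cls_ind=> x; rewrite -[eta0_opp _]/(eta0_scale _ _) cls_scale cls_add.
by apply/clsP; exact: eta_addN.
Qed.

HB.instance Definition _ :=
  GRing.isZmodule.Build eta0 eta0_addA eta0_addC eta0_add0 eta0_addN.

Lemma eta0_scaleA c d x : eta0_scale c (eta0_scale d x) = eta0_scale (c * d) x.
Proof.
by elim/cls_ind: x => x; rewrite !cls_scale; apply/clsP; exact: eta_scaleA.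
Qed.

Lemma eta0_scale1 : left_id 1 eta0_scale.
Proof. by elim/cls_ind=> x; rewrite cls_scale; apply/clsP; exact: eta_scale1. Qed.

Lemma eta0_scaleDr : right_distributive eta0_scale +%R.
Proof.
move=> c; elim/cls_ind=> x; elim/cls_ind=> y.
rewrite -[_ + _]/(eta0_add _ _) -[X in _ = X]/(eta0_add _ _).
by rewrite !(cls_add, cls_scale); apply/clsP; exact: eta_scaleDr.
Qed.

Lemma eta0_scaleDl x : {morph eta0_scale^~ x : c d / c + d}.
Proof.
move=> c d; elim/cls_ind: x => x; rewrite -[X in _ = X]/(eta0_add _ _).
by rewrite !(cls_scale, cls_add); apply/clsP; exact: eta_scaleDl.
Qed.

HB.instance Definition _ :=
  GRing.Zmodule_isLmodule.Build R eta0
    eta0_scaleA eta0_scale1 eta0_scaleDr eta0_scaleDl.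

Lemma clsD x y : cls (TAdd x y) = cls x + cls y.
Proof. by rewrite -cls_add. Qed.

Lemma clsZ c x : cls (TScale c x) = c *: cls x.
Proof. by rewrite -cls_scale. Qed.

Lemma cls0 : cls TZero = 0.
Proof. by []. Qed.

Lemma eta0_br_linearl y : linear (eta0_br^~ y).
Proof.
move=> c; elim/cls_ind=> x; elim/cls_ind=> x'; elim/cls_ind: y => y.
rewrite -clsZ -clsD !cls_br -clsZ -clsD; apply/clsP; exact: eta_brl.
Qed.

Lemma eta0_br_linearr x : linear (eta0_br x).
Proof.
move=> c; elim/cls_ind=> y; elim/cls_ind=> y'; elim/cls_ind: x => x.
rewrite -clsZ -clsD !cls_br -clsZ -clsD; apply/clsP; exact: eta_brr.
Qed.

Lemma eta0_brC x y : eta0_br x y = - eta0_br y x.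
Proof.
elim/cls_ind: x => x; elim/cls_ind: y => y.
by rewrite !cls_br -scaleN1r -clsZ; apply/clsP; exact: eta_brC.
Qed.

Lemma eta0_jacobi x y z :
  eta0_br x (eta0_br y z) + eta0_br y (eta0_br z x) + eta0_br z (eta0_br x y)
  = 0.
Proof.
elim/cls_ind: x => x; elim/cls_ind: y => y; elim/cls_ind: z => z.
by rewrite !cls_br -!clsD -cls0; apply/clsP; exact: eta_jacobi.
Qed.

Definition eta : lieCD R r :=
  extend_real r eta0_br_linearl eta0_br_linearr eta0_brC eta0_jacobi.

Definition eta_e (j : 'I_n) : lie0 eta := cls (TE j).
Definition eta_f (j : 'I_n) : lie0 eta := cls (TF j).
Definition eta_h (x : cdV h r) : cdV (lie0 eta) r := [ffun m => cls (TH (x m))].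

(* The defining relations of [eta (A)], for arbitrary elements [e_j], [f_j] of
   [_0 L] and an arbitrary map [h -> L]. *)
Record eta_relations (L : lieCD R r) (e f : 'I_n -> lie0 L)
    (i : cdV h r -> cdV (lie0 L) r) : Prop := EtaRelations {
  eta_rel_lin : cd_linear i;
  eta_rel_ef : forall k j, bracket (pure0 r (e k)) (pure0 r (f j)) =
    if k == j then i (gamma j) else 0;
  eta_rel_hh : forall x y, bracket (i x) (i y) = 0;
  eta_rel_he : forall x j, bracket (i x) (pure0 r (e j)) =
    lact (pairing (beta j) x) (pure0 r (e j));
  eta_rel_hf : forall x j, bracket (i x) (pure0 r (f j)) =
    - lact (pairing (beta j) x) (pure0 r (f j));
  eta_rel_cdl : forall a b (u v : lie0 L),
    bracket (lact a (pure0 r u)) (lact b (pure0 r v)) =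
    lact (cdmul a b) (bracket (pure0 r u) (pure0 r v));
  eta_rel_cdr : forall a b (u v : lie0 L),
    bracket (lact a (pure0 r u)) (lact b (pure0 r v)) =
    ract (bracket (pure0 r u) (pure0 r v)) (cdmul a b)
}.

End Eta.

Section EtaTheory.
Variables (R : realType) (r n : nat) (h : vectType R).
Variables (beta : 'I_n -> cddual R h r) (gamma : 'I_n -> cdV h r).

Lemma cls_H c (x y : h) :
  cls beta gamma (TH (c *: x + y)) =
  c *: cls beta gamma (TH x) + cls beta gamma (TH y).
Proof. by rewrite -clsZ -clsD; apply/clsP; exact: eta_H. Qed.

Lemma cls_H0 : cls beta gamma (TH 0) = 0.
Proof. by have := cls_H (-1) 0 0; rewrite !scaleN1r !addNr. Qed.

Lemma cls_HZ c x : cls beta gamma (TH (c *: x)) = c *: cls beta gamma (TH x).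
Proof. by have := cls_H c x 0; rewrite addr0 cls_H0 addr0. Qed.

Lemma eta_h_is_linear : linear (eta_h beta gamma).
Proof. by move=> c x y; apply/ffunP=> m; rewrite !ffunE cls_H. Qed.

Lemma eta_h_lact a (x : h) :
  eta_h beta gamma (lact a (pure0 r x)) = lact a (pure0 r (cls beta gamma (TH x))).
Proof. by rewrite !lact_pure0E; apply/ffunP=> m; rewrite !ffunE cls_HZ. Qed.

Lemma eta_h_pure0 (x : h) :
  eta_h beta gamma (pure0 r x) = pure0 r (cls beta gamma (TH x)).
Proof. by rewrite pure0E eta_h_lact -pure0E. Qed.

Lemma eta_cd_linear : cd_linear (eta_h beta gamma).
Proof.
split; split; try exact: eta_h_is_linear.
  by move=> z x; rewrite eta_h_lact eta_h_pure0.
by move=> z x; rewrite ract_pure0 eta_h_lact eta_h_pure0 ract_pure0.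
Qed.

Lemma eta_bracket_lact a b (u v : lie0 (eta beta gamma)) :
  bracket (lact a (pure0 r u)) (lact b (pure0 r v)) =
  lact (cdmul a b) (pure0 r (eta0_br u v)).
Proof.
exact: (extbr_lact (@eta0_br_linearl _ _ _ _ beta gamma)
                   (@eta0_br_linearr _ _ _ _ beta gamma)).
Qed.

Lemma eta_bracket_pure0 (u v : lie0 (eta beta gamma)) :
  bracket (pure0 r u) (pure0 r v) = pure0 r (eta0_br u v).
Proof. by rewrite (pure0E r u) (pure0E r v) eta_bracket_lact cdmul1l -pure0E. Qed.

Lemma eta_h_sum (x : cdV h r) :
  eta_h beta gamma x =
  \sum_s lact (cdgen R s) (pure0 r (cls beta gamma (TH (x s)))).
Proof.
rewrite [in LHS](pure_sum x) (linear_sum_of _ eta_h_is_linear).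
by apply: eq_bigr => s _; rewrite pureE eta_h_lact.
Qed.

Lemma eta_bracket_h_pure0 x u :
  bracket (eta_h beta gamma x) (pure0 r u : cdV (lie0 (eta beta gamma)) r) =
  [ffun m => eta0_br (cls beta gamma (TH (x m))) u].
Proof.
rewrite eta_h_sum.
rewrite (linear_sum_of _ (@bracket_linearl _ _ (eta beta gamma) (pure0 r u))).
rewrite (eq_bigr (fun s => lact (cdgen R s)
    (pure0 r (eta0_br (cls beta gamma (TH (x s))) u)))) => [|s _]; last first.
  by rewrite /= {1}(pure0E r u) [LHS]eta_bracket_lact cdmul1r.
apply/ffunP=> m; rewrite sum_ffunE ffunE (bigD1 m) //=.
rewrite big1 => [|s sm]; rewrite lact_pure0E ffunE mxE eqxx /=.
  by rewrite eqxx scale1r addr0.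
by rewrite eq_sym (negPf sm) scale0r.
Qed.

Lemma eta_satisfies :
  eta_relations beta gamma (@eta_e _ _ _ _ beta gamma)
    (@eta_f _ _ _ _ beta gamma) (eta_h beta gamma).
Proof.
split.
- exact: eta_cd_linear.
- move=> k j; rewrite eta_bracket_pure0 /eta_e /eta_f cls_br.
  apply/ffunP=> m; rewrite ffunE.
  have /clsP : eta_eq beta gamma
      (if m == cdi0 r then TBr (TE k) (TF j) else TZero)
      (if k == j then TH (gamma j m) else TZero) by exact: eta_EF.
  by case: eqP => _; case: eqP => _ E; rewrite ?ffunE // -?E.
- move=> x y; rewrite (eta_h_sum y).
  rewrite (linear_sum_of _ (@bracket_linearr _ _ (eta beta gamma) _)) big1 // => t _.
  rewrite (eta_h_sum x).
  rewrite (linear_sum_of _ (@bracket_linearl _ _ (eta beta gamma) _)) big1 // => s _.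
  rewrite /= [LHS]eta_bracket_lact cls_br.
  have /clsP -> : eta_eq beta gamma (TBr (TH (x s)) (TH (y t))) TZero.
    exact: eta_HH.
  by rewrite lact_pure0E; apply/ffunP=> m; rewrite !ffunE scaler0.
- move=> x j; rewrite eta_bracket_h_pure0 lact_pure0E.
  apply/ffunP=> m; rewrite !ffunE /eta_e cls_br -clsZ.
  by apply/clsP; exact: eta_HE.
- move=> x j; rewrite eta_bracket_h_pure0 lact_pure0E.
  apply/ffunP=> m; rewrite !ffunE /eta_f cls_br -scaleNr -clsZ.
  by apply/clsP; exact: eta_HF.
- by move=> a b u v; rewrite eta_bracket_lact eta_bracket_pure0.
- by move=> a b u v; rewrite eta_bracket_lact eta_bracket_pure0 ract_pure0.
Qed.

Lemma eta_ind (P : lie0 (eta beta gamma) -> Prop) :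
  (forall j, P (eta_e beta gamma j)) -> (forall j, P (eta_f beta gamma j)) ->
  (forall x : h, P (eta_h beta gamma (pure0 r x) (cdi0 r))) ->
  P 0 -> (forall x y, P x -> P y -> P (x + y)) ->
  (forall c x, P x -> P (c *: x)) ->
  (forall x y, P x -> P y -> P (eta0_br x y)) ->
  forall x, P x.
Proof.
move=> Pe Pf Ph P0 PD PZ PB; elim/cls_ind; elim=> //.
- by move=> x; have := Ph x; rewrite eta_h_pure0 ffunE eqxx.
- by move=> x Px y Py; rewrite clsD; exact: PD.
- by move=> c x Px; rewrite clsZ; exact: PZ.
- by move=> x Px y Py; rewrite -cls_br; exact: PB.
Qed.

End EtaTheory.

Section Center.
Variables (R : realType).

Lemma cdidx0 r (k : 'I_(cddim r)) : cdidx (cdi0 r) k = k.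
Proof.
elim: r k => [|r IH] k; first by rewrite (ord1 k).
move: k; rewrite [cddim r.+1]/= => k; rewrite /= split_lshift.
by case: (split_ordP k) => k' ->; rewrite IH.
Qed.

Lemma cdidxx r (k : 'I_(cddim r)) : cdidx k k = cdi0 r.
Proof.
elim: r k => [|r IH] k; first by rewrite (ord1 k) (ord1 (cdi0 0)).
by rewrite /=; case: (split k) => k'; rewrite IH.
Qed.

Lemma cdidxK r (t : 'I_(cddim r)) : cancel (cdidx t) (cdidx t).
Proof. by move=> s; rewrite cdidxA cdidxx cdidx0. Qed.

Lemma center_pure0 r (V : lmodType R) (v : cdV V r) : (1 < r)%N ->
  (forall a, lact a v = ract v a) -> v = pure0 r (v (cdi0 r)).
Proof.
move=> r1 vC; apply/ffunP=> s; rewrite ffunE.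
have [-> //|s0] := eqVneq s (cdi0 r).
have [t] : exists t, t \notin [set cdi0 r; s].
  apply/existsP; rewrite -[X in is_true X]negbK negb_exists; apply/negP=> /forallP tin0.
  have tin t : t \in [set cdi0 r; s] by have := tin0 t; rewrite negbK.
  have : (cddim r <= 2)%N.
    have : (#|'I_(cddim r)| <= #|[set cdi0 r; s]|)%N.
      by apply: subset_leq_card; apply/fintype.subsetP=> t _; exact: tin.
    rewrite card_ord => /leq_trans; apply; rewrite cards2.
    by case: (_ != _).
  by rewrite cddimE leqNgt -{1}(expn1 2) ltn_exp2l // r1.
rewrite in_set2 negb_or => /andP[t0 ts].
have /ffunP/(_ (cdidx t s)) := vC (cdgen R t).
rewrite !ffunE (bigD1 s) //= [in RHS](bigD1 s) //= !big1.
- rewrite !addr0 (cdmul_genC _ s t) /chi s0 t0 eq_sym ts sgnT.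
  have [b ->] := cdmul_gen R t s.
  rewrite !mxE !eqxx mulr1 scaleNr => /eqP; rewrite -subr_eq0 opprK -mulr2n.
  rewrite -scaler_nat scalerA scaler_eq0 mulf_eq0 pnatr_eq0 signr_eq0 /=.
  by move/eqP.
- move=> s' s's; have [b ->] := cdmul_gen R s' t; rewrite !mxE eqxx /=.
  by rewrite (cdidxC s' t) (inj_eq (can_inj (cdidxK t))) eq_sym (negPf s's) mulr0 scale0r.
- move=> s' s's; have [b ->] := cdmul_gen R t s'; rewrite !mxE eqxx /=.
  by rewrite (inj_eq (can_inj (cdidxK t))) eq_sym (negPf s's) mulr0 scale0r.
Qed.

Lemma cd_linear_pure0 r (V V' : lmodType R) (f : cdV V r -> cdV V' r) x :
  (1 < r)%N -> cd_linear f -> f (pure0 r x) = pure0 r (f (pure0 r x) (cdi0 r)).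
Proof.
move=> r1 [[_ fl] [_ fr]]; apply: center_pure0 => // a.
by rewrite -fl -fr ract_pure0.
Qed.

End Center.

Section Universal.
Variables (R : realType) (r n : nat) (h : vectType R).
Variables (beta : 'I_n -> cddual R h r) (gamma : 'I_n -> cdV h r).
Variables (L : lieCD R r) (e f : 'I_n -> lie0 L).
Variable i : cdV h r -> cdV (lie0 L) r.
Hypothesis r_gt1 : (1 < r)%N.
Hypothesis Lrel : eta_relations beta gamma e f i.

Let br (u v : lie0 L) : lie0 L :=
  bracket (pure0 r u) (pure0 r v : cdV (lie0 L) r) (cdi0 r).

Let brE u v : bracket (pure0 r u) (pure0 r v) = pure0 r (br u v).
Proof. by rewrite /br; have [z ->] := bracket_pure0 u v; rewrite ffunE eqxx. Qed.

Lemma pure0_inj (V : lmodType R) : injective (@pure0 R r V).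
Proof. by move=> x y /ffunP/(_ (cdi0 r)); rewrite !ffunE eqxx. Qed.

Let br_linl y : linear (br^~ y).
Proof.
move=> c x x'; apply: pure0_inj; rewrite -brE !pure0_is_linear.
by rewrite [LHS](@bracket_linearl _ _ L) !brE.
Qed.

Let br_linr x : linear (br x).
Proof.
move=> c y y'; apply: pure0_inj; rewrite -brE !pure0_is_linear.
by rewrite [LHS](@bracket_linearr _ _ L) !brE.
Qed.

Let brC x y : br x y = - br y x.
Proof.
apply: pure0_inj; rewrite -brE /pure0 [LHS]bracketC /chi eqxx /= expr1 scaleN1r.
rewrite brE; apply/ffunP=> m; rewrite !ffunE.
by case: eqP => _; rewrite ?oppr0.
Qed.

Let br_jac x y z : br x (br y z) + br y (br z x) + br z (br x y) = 0.
Proof.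
have := @bracket_jacobi _ _ L (cdi0 r) (cdi0 r) (cdi0 r) x y z.
rewrite /xi eqxx /= !expr0 !scale1r !brE => /ffunP/(_ (cdi0 r)).
by rewrite !ffunE eqxx.
Qed.

Let i0 (x : h) : lie0 L := i (pure0 r x) (cdi0 r).

Let iE x : i (pure0 r x) = pure0 r (i0 x).
Proof. by apply: cd_linear_pure0 => //; case: Lrel. Qed.

Let ilin : linear i. Proof. by case: Lrel => -[[]]. Qed.

Let icomp (x : cdV h r) m : i x m = i0 (x m).
Proof.
rewrite [in LHS](pure_sum x) (linear_sum_of _ ilin) sum_ffunE (bigD1 m) //=.
have il z y : i (lact z (pure0 r y)) = lact z (pure0 r (i0 y)).
  by rewrite -iE; case: Lrel => -[[_ ->]].
rewrite big1 => [|s sm]; rewrite pureE il lact_pure0E ffunE mxE /=.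
  by rewrite !eqxx scale1r addr0.
by rewrite eq_sym (negPf sm) ?andbF scale0r.
Qed.

Let br_ih (x : cdV h r) u m :
  bracket (i x) (pure0 r u : cdV (lie0 L) r) m = br (i0 (x m)) u.
Proof.
rewrite [i x](pure_sum (i x)).
rewrite (linear_sum_of _ (@bracket_linearl _ _ L (pure0 r u))).
rewrite sum_ffunE (bigD1 m) //=.
have E s : bracket (pure s (i x s)) (pure0 r u) =
    lact (cdgen R s) (pure0 r (br (i0 (x s)) u)).
  rewrite icomp pureE [X in bracket _ X]pure0E.
  by case: Lrel => _ _ _ _ _ -> _; rewrite cdmul1r brE.
rewrite big1 => [|s sm]; rewrite E lact_pure0E ffunE mxE /=.
  by rewrite !eqxx scale1r addr0.
by rewrite eq_sym (negPf sm) ?andbF scale0r.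
Qed.

Fixpoint eta_eval (t : eta_term n h R) : lie0 L :=
  match t with
  | TE j => e j
  | TF j => f j
  | TH x => i0 x
  | TZero => 0
  | TAdd t u => eta_eval t + eta_eval u
  | TScale c t => c *: eta_eval t
  | TBr t u => br (eta_eval t) (eta_eval u)
  end.

Lemma eta_eval_eq t u : eta_eq beta gamma t u -> eta_eval t = eta_eval u.
Proof.
elim=> //=.
- by move=> ? ? ? _ -> _ ->.
- by move=> ? ? ? ? _ -> _ ->.
- by move=> ? ? ? _ ->.
- by move=> ? ? ? ? _ -> _ ->.
- by move=> *; rewrite addrA.
- by move=> *; rewrite addrC.
- by move=> *; rewrite add0r.
- by move=> *; rewrite scaleN1r addNr.
- by move=> *; rewrite scalerA.
- by move=> *; rewrite scale1r.
- by move=> *; rewrite scalerDr.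
- by move=> *; rewrite scalerDl.
- by move=> c x y z; rewrite br_linl.
- by move=> c x y z; rewrite br_linr.
- by move=> x y; rewrite scaleN1r -brC.
- move=> c x y; apply: pure0_inj.
  by rewrite pure0_is_linear -!iE pure0_is_linear ilin.
- move=> k j m; have /ffunP/(_ m) := eta_rel_ef Lrel k j.
  rewrite brE ffunE; case: eqP => _; case: eqP => _ /=; rewrite ?icomp ?ffunE //.
- move=> x y; apply: pure0_inj; rewrite -brE -!iE (eta_rel_hh Lrel).
  by apply/ffunP=> m; rewrite !ffunE if_same.
- move=> x j m; rewrite -br_ih (eta_rel_he Lrel).
  by rewrite lact_pure0E ffunE.
- move=> x j m; rewrite -br_ih (eta_rel_hf Lrel).
  by rewrite lact_pure0E !ffunE scaleNr.
Qed.

Let phi0 (u : lie0 (eta beta gamma)) : lie0 L := eta_eval (rep u).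

Let phi0E t : phi0 (cls beta gamma t) = eta_eval t.
Proof. by apply: eta_eval_eq; exact: rep_cls. Qed.

Let phi (x : cdV (lie0 (eta beta gamma)) r) : cdV (lie0 L) r :=
  [ffun m => phi0 (x m)].

Let phi0_lin : linear phi0.
Proof.
move=> c; elim/cls_ind=> x; elim/cls_ind=> y.
by rewrite -clsZ -clsD !phi0E.
Qed.

Let phi0Z c u : phi0 (c *: u) = c *: phi0 u.
Proof. by elim/cls_ind: u => u; rewrite -clsZ !phi0E. Qed.

Let phi_lin : linear phi.
Proof. by move=> c x y; apply/ffunP=> m; rewrite !ffunE phi0_lin. Qed.

Let phi_lact a u : phi (lact a (pure0 r u)) = lact a (pure0 r (phi0 u)).
Proof.
by rewrite !lact_pure0E; apply/ffunP=> m; rewrite !ffunE phi0Z.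
Qed.

Let phi_pure0 u : phi (pure0 r u) = pure0 r (phi0 u).
Proof. by rewrite pure0E phi_lact -pure0E. Qed.

Let phi_cd : cd_linear phi.
Proof.
split; split=> // z x; first by rewrite phi_lact phi_pure0.
by rewrite phi_pure0 !ract_pure0 phi_lact.
Qed.

Let phi0_br u v : phi0 (eta0_br u v) = br (phi0 u) (phi0 v).
Proof. by elim/cls_ind: u => u; elim/cls_ind: v => v; rewrite cls_br !phi0E. Qed.

Let phi_br x y : phi (bracket x y) = bracket (phi x) (phi y).
Proof.
rewrite (pure_sum x) (linear_sum_of _ (@bracket_linearl _ _ (eta beta gamma) y)).
rewrite !(linear_sum_of _ phi_lin).
rewrite (linear_sum_of _ (@bracket_linearl _ _ L (phi y))).
apply: eq_bigr => s _; cbv beta.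
rewrite (pure_sum y) (linear_sum_of _ (@bracket_linearr _ _ (eta beta gamma) _)).
rewrite !(linear_sum_of _ phi_lin).
rewrite (linear_sum_of _ (@bracket_linearr _ _ L _)).
apply: eq_bigr => t _; cbv beta.
rewrite !pureE !phi_lact [X in phi X]eta_bracket_lact phi_lact phi0_br.
by rewrite (eta_rel_cdl Lrel) brE.
Qed.

(* [eta (A)] is the algebra presented by the generators and relations. *)
Lemma eta_universal :
  exists! p : cdV (lie0 (eta beta gamma)) r -> cdV (lie0 L) r,
    [/\ lie_morphism p,
        forall j, p (pure0 r (eta_e beta gamma j)) = pure0 r (e j),
        forall j, p (pure0 r (eta_f beta gamma j)) = pure0 r (f j) &
        forall x, p (eta_h beta gamma x) = i x].
Proof.
exists phi; split.
  split=> [|j|j|x]; first by split; [exact: phi_cd|exact: phi_br].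
  - by rewrite phi_pure0 phi0E.
  - by rewrite phi_pure0 phi0E.
  - by apply/ffunP=> m; rewrite !ffunE phi0E icomp.
move=> p [[pcd pbr] pe pf ph]; have [[plin pl] _] := pcd.
have pp u : p (pure0 r u) = pure0 r (p (pure0 r u) (cdi0 r)).
  exact: cd_linear_pure0.
have p0 : forall u, p (pure0 r u) = pure0 r (phi0 u).
  elim/cls_ind; elim.
  - by move=> j; rewrite pe phi0E.
  - by move=> j; rewrite pf phi0E.
  - by move=> x; rewrite -eta_h_pure0 ph iE phi0E.
  - rewrite phi0E /=; have lp0 (V : lmodType R) : pure0 r (0 : V) = 0.
      by apply/ffunP=> m; rewrite !ffunE if_same.
    rewrite cls0 !lp0.
    by have := plin (-1) 0 0; rewrite !scaleN1r !addNr.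
  - move=> x px y py; rewrite clsD -[cls _ _ x]scale1r phi0_lin.
    by rewrite !pure0_is_linear plin px py.
  - move=> c x px; have lp0 (V : lmodType R) : pure0 r (0 : V) = 0.
      by apply/ffunP=> m; rewrite !ffunE if_same.
    have p00 : p 0 = 0 by have := plin (-1) 0 0; rewrite !scaleN1r !addNr.
    rewrite clsZ phi0Z -[c *: cls _ _ x]addr0 -[c *: phi0 _]addr0.
    by rewrite !pure0_is_linear plin px !lp0 p00.
  - move=> x px y py.
    by rewrite -cls_br -eta_bracket_pure0 pbr px py brE phi0_br.
apply/funext => x; rewrite (pure_sum x) (linear_sum_of _ plin) (linear_sum_of _ phi_lin).
by apply: eq_bigr => s _; rewrite pureE pl p0 phi_lact.
Qed.

End Universal.

Section Embedding.
Variables (R : realType) (r n : nat) (h : vectType R).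
Variables (beta : 'I_n -> cddual R h r) (gamma : 'I_n -> cdV h r).
Hypothesis beta_real : forall j (y : h), cdreal (ev (beta j) (pure0 r y)).

Lemma pairing_coord j (x : cdV h r) m :
  pairing (beta j) x 0 m = beta j (cdi0 r) (x m).
Proof.
rewrite (pairing_real _ (beta_real j)) /ev summxE (bigD1 m) //=.
have rowE y : \row_k beta j k y = beta j (cdi0 r) y *: cdgen R (cdi0 r).
  rewrite -ev_pure0; have [c E] := beta_real j y; rewrite E; congr (_ *: _).
  by move/rowP/(_ (cdi0 r)): E; rewrite ev_pure0 !mxE !eqxx mulr1.
rewrite big1 => [|s sm]; rewrite rowE cdmulZr cdmul1r !mxE !eqxx /= ?mulr1 ?addr0 //.
by rewrite eq_sym (negPf sm) mulr0.
Qed.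

Section Module.
Variable lam : 'Hom(h, R^o).
Hypothesis gamma_real : forall j m, m != cdi0 r -> gamma j m = 0.

Let al j (x : h) : R := beta j (cdi0 r) x.
Let g j : h := gamma j (cdi0 r).

Fixpoint wt (w : seq 'I_n) (x : h) : R :=
  if w is j :: w' then wt w' x - al j x else lam x.

Definition Fop j (G : seq 'I_n -> R) (w : seq 'I_n) : R :=
  if w is k :: w' then (if k == j then G w' else 0) else 0.

Definition Hop x (G : seq 'I_n -> R) (w : seq 'I_n) : R := wt w x * G w.

Fixpoint Eop k (G : seq 'I_n -> R) (w : seq 'I_n) : R :=
  wt w (g k) * G (k :: w) +
  if w is j :: w' then Eop k (fun a => G (j :: a)) w' else 0.

Fixpoint op (t : eta_term n h R) (G : seq 'I_n -> R) (w : seq 'I_n) : R :=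
  match t with
  | TE j => Eop j G w
  | TF j => Fop j G w
  | TH x => Hop x G w
  | TZero => 0
  | TAdd t u => op t G w + op u G w
  | TScale c t => c * op t G w
  | TBr t u => op t (op u G) w - op u (op t G) w
  end.

Lemma wt_linear w : linear (wt w : h -> R^o).
Proof.
elim: w => [|j w IH] c x y /=; first by rewrite linearP.
rewrite IH /al linearP /=.
by rewrite /GRing.scale /=; ring.
Qed.

Lemma Eop_lin k c G G' w :
  Eop k (fun w => c * G w + G' w) w = c * Eop k G w + Eop k G' w.
Proof.
elim: w G G' => [|j w IH] G G' /=; first by ring.
by rewrite IH; ring.
Qed.

Lemma op_lin t c G G' w :
  op t (fun w => c * G w + G' w) w = c * op t G w + op t G' w.
Proof.
elim: t G G' w => /=.
- by move=> k G G' w; exact: Eop_lin.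
- move=> j G G' [|k w] /=; first by ring.
  by case: eqP => _; ring.
- by move=> x G G' w; rewrite /Hop; ring.
- by move=> *; ring.
- by move=> t IHt u IHu G G' w; rewrite IHt IHu; ring.
- by move=> d t IHt G G' w; rewrite IHt; ring.
- move=> t IHt u IHu G G' w.
  rewrite (_ : op u _ = fun w => c * op u G w + op u G' w); last first.
    by apply/funext => v; rewrite IHu.
  rewrite (_ : op t (fun w => c * G w + G' w) = fun w => c * op t G w + op t G' w);
    last by apply/funext => v; rewrite IHt.
  by rewrite IHt IHu; ring.
Qed.

Lemma opB t G G' w : op t (fun w => G w - G' w) w = op t G w - op t G' w.
Proof.
rewrite (_ : (fun w => _) = fun w => (-1) * G' w + G w); first by rewrite op_lin; ring.
by apply/funext => v; ring.
Qed.

Lemma Eop0 k w : Eop k (fun=> 0) w = 0.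
Proof. by elim: w => [|j w IH] /=; rewrite ?IH; ring. Qed.

Lemma Eop_wt k x c G w :
  Eop k (fun u => (wt u x + c) * G u) w = (wt w x + c - al k x) * Eop k G w.
Proof.
elim: w c G => [|j w IH] c G /=; first by ring.
rewrite (_ : (fun a => _) = fun a => (wt a x + (c - al j x)) * G (j :: a)).
  by rewrite IH; ring.
by apply/funext => a; ring.
Qed.

Lemma op_eq t u : eta_eq beta gamma t u -> op t = op u.
Proof.
elim=> /=; try by [].
- by move=> ? ? ? _ -> _ ->.
- by move=> ? ? ? ? _ -> _ ->.
- by move=> ? ? ? _ ->.
- by move=> ? ? ? ? _ -> _ ->.
- by move=> x y z; apply/funext => G; apply/funext => w; ring.
- by move=> x y; apply/funext => G; apply/funext => w; ring.
- by move=> x; apply/funext => G; apply/funext => w; ring.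
- by move=> x; apply/funext => G; apply/funext => w; ring.
- by move=> c d x; apply/funext => G; apply/funext => w; ring.
- by move=> x; apply/funext => G; apply/funext => w; ring.
- by move=> c x y; apply/funext => G; apply/funext => w; ring.
- by move=> c d x; apply/funext => G; apply/funext => w; ring.
- move=> c x y z; apply/funext => G; apply/funext => w.
  by rewrite op_lin; ring.
- move=> c x y z; apply/funext => G; apply/funext => w.
  by rewrite op_lin; ring.
- by move=> x y; apply/funext => G; apply/funext => w; ring.
- by move=> x y z; apply/funext => G; apply/funext => w; rewrite !opB; ring.
- move=> c x y; apply/funext => G; apply/funext => w; rewrite /Hop wt_linear.
  by rewrite /GRing.scale /=; ring.
- move=> k j m; have [->|m0] := eqVneq m (cdi0 r); last first.
    case: eqP => // _ /=; apply/funext => G; apply/funext => w.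
    have := wt_linear w (-1) 0 0; rewrite !scaleN1r !addNr => w0.
    by rewrite /Hop gamma_real // w0 mul0r.
  apply/funext => G; apply/funext => w /=.
  have E0 : (fun a : seq 'I_n => 0 : R) = fun=> 0 by [].
  have -> : op (if k == j then TH (gamma j (cdi0 r)) else TZero) G w =
      if k == j then wt w (g k) * G w else 0.
    by case: (k =P j) => [->|].
  case: w => [|l w] /=.
    by case: eqP => _; ring.
  have -> : Eop k (fun a => if l == j then G a else 0) w =
      if l == j then Eop k G w else 0.
    by case: eqP => // _; rewrite Eop0.
  by case: (k == j); ring.
- by move=> x y; apply/funext => G; apply/funext => w; rewrite /Hop; ring.
- move=> x j m; apply/funext => G; apply/funext => w; rewrite pairing_coord.
  rewrite /Hop (_ : (fun w => _) = fun u => (wt u (x m) + 0) * G u).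
    by rewrite Eop_wt /al; ring.
  by apply/funext => v; rewrite addr0.
- move=> x j m; apply/funext => G; apply/funext => w; rewrite pairing_coord.
  rewrite /Hop; case: w => [|k w] /=; first by ring.
  by case: eqP => [->|_]; rewrite /al; ring.
Qed.

End Module.

(* [h] is a subspace of [eta (A)] exactly when the [gamma_j] lie in [_0 h]:
   [[e_j, f_j]] is in [_0 eta (A)] whenever [e_j] and [f_j] are. *)
Lemma eta_h_injP :
  injective (eta_h beta gamma) <->
  forall j, exists y : h, gamma j = pure0 r y.
Proof.
split=> [inj j|greal].
  exists (gamma j (cdi0 r)); apply/ffunP=> m; rewrite ffunE.
  have [-> //|m0] := eqVneq m (cdi0 r).
  have := eta_EF beta gamma j j m; rewrite (negPf m0) eqxx => /clsP E.
  have : eta_h beta gamma (pure m (gamma j m)) = eta_h beta gamma (pure m 0).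
    apply/ffunP=> s; rewrite !ffunE; case: eqP => // _.
    by rewrite -E cls0 cls_H0.
  by move/inj/ffunP/(_ m); rewrite !ffunE eqxx.
have g0 j m : m != cdi0 r -> gamma j m = 0.
  by have [y ->] := greal j; rewrite ffunE => /negPf ->.
move=> x y /ffunP xy; apply/ffunP=> m; have := xy m.
rewrite !ffunE => /clsP E.
rewrite (coord_vbasis (memvf (x m))) (coord_vbasis (memvf (y m))).
apply: eq_bigr => i _; congr (_ *: _).
have := op_eq (linfun (coord (vbasis fullv) i : h -> R^o)) g0 E.
move/(congr1 (fun F => F (fun=> 1) [::])) => /=.
by rewrite /Hop /= !lfunE !mulr1.
Qed.

End Embedding.

Section Quotient.
Variables (R : realType) (r n : nat) (h : vectType R).
Variables (beta : 'I_n -> cddual R h r) (gamma : 'I_n -> cdV h r).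

Definition meets_h_trivially (I : set (cdV (lie0 (eta beta gamma)) r)) : Prop :=
  forall x : cdV h r, I (eta_h beta gamma x) -> eta_h beta gamma x = 0.

Definition maximal_trivial_ideal (tau : set (cdV (lie0 (eta beta gamma)) r)) :
    Prop :=
  [/\ lie_ideal tau, meets_h_trivially tau &
      forall I : set (cdV (lie0 (eta beta gamma)) r),
        lie_ideal I -> meets_h_trivially I -> (tau `<=` I)%classic -> I = tau].

End Quotient.

(* [M] is the quotient [L / I] with canonical projection [p]. *)
Definition lie_quotient (R : realType) (r : nat) (L M : lieCD R r)
    (I : set (cdV (lie0 L) r)) (p : cdV (lie0 L) r -> cdV (lie0 M) r) : Prop :=
  [/\ lie_morphism p, (forall y, exists x, p x = y) &
      forall x, p x = 0 <-> I x].

Definition symmetrizable_by (R : realType) (r n : nat) (A : 'M[cd R r]_n)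
    (d : 'I_n -> R) (B : 'M[cd R r]_n) : Prop :=
  [/\ (forall j, d j != 0), B^T = B & forall j k, A j k = d j *: B j k].

Definition complementary (R : realType) (r : nat) (V : lmodType R)
    (W1 W2 : set (cdV V r)) : Prop :=
  (forall x, W1 x -> W2 x -> x = 0) /\
  (forall x, exists y z, [/\ W1 y, W2 z & x = y + z]).

Section Roots.
Variables (R : realType) (r n : nat) (h : vectType R).
Variables (beta : 'I_n -> cddual R h r) (g : lieCD R r).
Variable i : cdV h r -> cdV (lie0 g) r.

Definition root_lattice : set (cddual R h r) :=
  [set b | exists c : 'I_n -> int, b = \sum_j beta j *~ c j].

Definition root_space (b : cddual R h r) : set (cdV (lie0 g) r) :=
  [set x | forall y : cdV h r, bracket (i y) x = lact (ev b y) x].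

Definition root_set : set (cddual R h r) :=
  [set b | [/\ root_lattice b, b != 0 & exists2 x, x != 0 & root_space b x]].

Definition root_sum (b c : cddual R h r) : set (cdV (lie0 g) r) :=
  [set x | exists y z, [/\ root_space b y, root_space c z & x = y + z]].

End Roots.

Section Forms.
Variables (R : realType) (r : nat) (V : lmodType R).
Variable form : cdV V r -> cdV V r -> cd R r.

Definition nondegenerate_on (S : set (cdV V r)) : Prop :=
  (forall x, S x -> (forall y, S y -> form x y = 0) -> x = 0) /\
  (forall y, S y -> (forall x, S x -> form x y = 0) -> y = 0).

(* Symmetry in the graded sense, with the sign rule of the pairings; on [_0 V]
   it is ordinary symmetry. *)
Definition form_symmetric : Prop :=
  forall (k j : 'I_(cddim r)) (x y : V),
    form (pure k x) (pure j y) = (-1) ^+ chi k j *: form (pure j y) (pure k x).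

Definition form_linear : Prop :=
  (forall y, left_linear (@cdmul R r) (form^~ y)) /\
  (forall x, right_linear (@cdmul R r) (form x)).

End Forms.

(* Main.v *)
From HB Require Import structures.
Require Import Defs.
From mathcomp Require Import all_boot all_order all_algebra ring zify.
From mathcomp Require Import boolp classical_sets reals.

(* The [beta_j] are real on [_0 h], and the inclusion of [h] in [eta (A)] forces
   the [gamma_j] to lie in [_0 h]. Hence all the data are real, and [g (A)] is the
   extension of scalars of a real contragredient Lie algebra [_0 g], and the
   form is the extension of a real invariant form on [_0 g].

   That form is built on [_0 eta]. It is spanned by [h] and the right-normed
   brackets [e_w], [f_u] of words in the [e_j] and in the [f_j]. Invariance
   dictates the functional [(e_w | -)]: move the letters of [w] one by one to
   the right argument and read off the coefficient of [f_j] for the last letter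
   [j]; likewise for [(f_u | -)]. By induction on the length of the words, the
   value of [(e_w | -)] at [f_u] is that of [(f_u | -)] at [e_w] (this is where
   [d_i <beta_i, gamma_j> = d_j <beta_j, gamma_i>] enters), which makes the
   bilinear form well defined, symmetric and invariant. The coefficient
   functionals come from the action of [_0 eta] on a module of Verma type.

   An ideal meeting [h] trivially is orthogonal to [h], as one sees from the
   principal grading, hence to everything; conversely the radical is an ideal
   meeting [h] trivially because the form is non-degenerate on [h]. So [tau] is
   the radical. On [h] non-degeneracy is the dimension condition of a
   realization; the rank over [A_r] is the real one because [A_2] and [A_3] have
   no zero divisors. *)

Set Implicit Arguments.
Unset Strict Implicit.
Unset Printing Implicit Defensive.

Import Order.TTheory GRing.Theory Num.Theory.
Local Open Scope ring_scope.

(** * Norm and absence of zero divisors *)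

Section CDNorm.
Variable R : realType.

Lemma cdP r (x : cd R r.+1) : exists a b : cd R r, x = row_mx a b.
Proof. by exists (lsubmx x), (rsubmx x); rewrite hsubmxK. Qed.

Lemma cdconj_row r (a b : cd R r) :
  cdconj (row_mx a b : cd R r.+1) = row_mx (cdconj a) (- b).
Proof. by rewrite /= row_mxKl row_mxKr. Qed.

Lemma cdmul_row r (a b c d : cd R r) :
  cdmul (row_mx a b : cd R r.+1) (row_mx c d) =
  row_mx (cdmul a c - cdmul (cdconj d) b) (cdmul d a + cdmul b (cdconj c)).
Proof. by rewrite /= !row_mxKl !row_mxKr. Qed.

Lemma cdconjK r : involutive (@cdconj R r).
Proof.
elim: r => [|r IH] // x; have [a [b ->]] := cdP x.
by rewrite !cdconj_row IH opprK.
Qed.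

Lemma cdconjM r (x y : cd R r) :
  cdconj (cdmul x y) = cdmul (cdconj y) (cdconj x).
Proof.
elim: r x y => [|r IH] x y.
  by apply/rowP=> j; rewrite !mxE (ord1 j) mulrC.
have [a [b ->]] := cdP x; have [c [d ->]] := cdP y.
rewrite !(cdmul_row, cdconj_row) !(cdconjD, cdconjN, IH) !cdconjK.
rewrite !(cdmulNl, cdmulNr) opprK.
by rewrite opprD [- _ - cdmul d a]addrC.
Qed.

Definition cdassoc r := forall x y z : cd R r,
  cdmul x (cdmul y z) = cdmul (cdmul x y) z.

(** Written in the four real coordinates of each factor, both sides become polynomials, and
    associativity is a ring identity in each coordinate. *)
Lemma cdmul2A : cdassoc 2.
Proof.
have P (x : cd R 2) : exists a b c d : cd R 0,
    x = row_mx (row_mx a b : cd R 1) (row_mx c d : cd R 1).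
  have [y [z ->]] := cdP x; have [a [b ->]] := cdP y; have [c [d ->]] := cdP z.
  by exists a, b, c, d.
move=> x y z.
have [x1 [x2 [x3 [x4 ->]]]] := P x; have [y1 [y2 [y3 [y4 ->]]]] := P y.
have [z1 [z2 [z3 [z4 ->]]]] := P z.
do 6!rewrite ?(cdmul_row, cdconj_row, add_row_mx, opp_row_mx).
have E (a b c d a' b' c' d' : cd R 0) : a 0 0 = a' 0 0 -> b 0 0 = b' 0 0 ->
    c 0 0 = c' 0 0 -> d 0 0 = d' 0 0 ->
    row_mx (row_mx a b : cd R 1) (row_mx c d : cd R 1) =
    row_mx (row_mx a' b' : cd R 1) (row_mx c' d' : cd R 1) :> cd R 2.
  have e (u v : cd R 0) : u 0 0 = v 0 0 -> u = v.
    by move=> uv; apply/rowP=> j; rewrite (ord1 j).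
  by move=> /e-> /e-> /e-> /e->.
by apply: E; do 4!rewrite /= ?mxE ?split_lshift ?split_rshift; ring.
Qed.

Definition cdnorm r (x : cd R r) : R := \sum_k x 0 k ^+ 2.

Lemma cdnorm_row r (a b : cd R r) :
  cdnorm (row_mx a b : cd R r.+1) = cdnorm a + cdnorm b.
Proof.
rewrite /cdnorm big_split_ord /=.
by congr (_ + _); apply: eq_bigr => k _; rewrite ?row_mxEl ?row_mxEr.
Qed.

Lemma cdnorm_eq0 r (x : cd R r) : cdnorm x = 0 -> x = 0.
Proof.
move/eqP; rewrite psumr_eq0 => [/allP x0|k _]; last exact: sqr_ge0.
apply/rowP=> k; rewrite mxE; apply/eqP; rewrite -sqrf_eq0.
exact: x0 (mem_index_enum k).
Qed.

Lemma cdconj_mul r (x : cd R r) :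
  cdmul (cdconj x) x = cdnorm x *: cdgen R (cdi0 r) /\
  cdmul x (cdconj x) = cdnorm x *: cdgen R (cdi0 r).
Proof.
elim: r x => [|r IH] x.
  rewrite /cdnorm /= big_ord1; split; apply/rowP=> j.
    by rewrite !mxE (ord1 j) !eqxx mulr1.
  by rewrite !mxE (ord1 j) !eqxx mulr1.
have IHl y := (IH y).1; have IHr y := (IH y).2.
have [a [b ->]] := cdP x.
rewrite cdconj_row !cdmul_row cdnorm_row [cdi0 _]/= cdgen_lshift.
rewrite !(cdconjN, cdconjK, cdmulNl, cdmulNr) !opprK !IHl !IHr -scalerDl.
by rewrite subrr addNr scale_row_mx scaler0.
Qed.

(** Left cancellation survives one doubling of an associative algebra, which is how the octonions
    are reached. Associativity of the halves lets each component meet its own conjugate, and the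
    mixed terms cancel. *)
Lemma cdconj_mulAS r (x y : cd R r.+1) : cdassoc r ->
  cdmul (cdconj x) (cdmul x y) = cdnorm x *: y.
Proof.
move=> A; have Nl z : cdmul (cdconj z) z = _ := (@cdconj_mul r z).1.
have Nr z : cdmul z (cdconj z) = _ := (@cdconj_mul r z).2.
have [a [b ->]] := cdP x; have [c [d ->]] := cdP y.
rewrite cdconj_row !cdmul_row cdnorm_row.
rewrite !(cdconjD, cdconjN, cdconjM, cdconjK).
rewrite !(cdmulDl, cdmulDr, cdmulNl, cdmulNr) !opprK.
rewrite ![cdmul (cdconj a) (cdmul _ _)]A Nl -[cdmul (cdmul c _) b]A Nl.
rewrite -[cdmul (cdmul d a) _]A Nr ![cdmul b (cdmul _ _)]A Nr.
rewrite !(cdmulZl, cdmulZr, cdmul1l, cdmul1r).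
rewrite -[X in row_mx _ X]addrA addNKr -opprD opprK addrA subrK.
by rewrite -!scalerDl scale_row_mx.
Qed.

Lemma cdconj_mulA r (x y : cd R r) : r = 2%N \/ r = 3%N ->
  cdmul (cdconj x) (cdmul x y) = cdnorm x *: y.
Proof.
move=> r23; case: r23 x y => -> x y; last exact: cdconj_mulAS cdmul2A.
by rewrite cdmul2A (cdconj_mul x).1 cdmulZl cdmul1l.
Qed.

Lemma cdmul_neq0 r (x y : cd R r) : r = 2%N \/ r = 3%N ->
  x != 0 -> y != 0 -> cdmul x y != 0.
Proof.
move=> r23 x0 y0; apply: contra_neq (y0) => xy.
have := cdconj_mulA x y r23; rewrite xy cdmul0r => /esym/eqP.
rewrite scaler_eq0 => /orP[/eqP/cdnorm_eq0 xE|/eqP //].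
by rewrite xE eqxx in x0.
Qed.

End CDNorm.

(** * Invariant forms on real contragredient Lie algebras *)

Section FormFromKernel.
Variables (K : fieldType) (L : lmodType K) (X : Type) (v : X -> L).
Variable N : X -> L -> K.

(** Subspaces are predicates, so that spanning and generation become induction principles and no
    basis of [L] has to be chosen. *)
Definition lin_closed (W : L -> Prop) : Prop :=
  W 0 /\ forall c x y, W x -> W y -> W (c *: x + y).

Hypothesis v_span : forall W, lin_closed W -> (forall a, W (v a)) -> forall x, W x.
Hypothesis N_scalar : forall a, scalar (N a).
Hypothesis N_sym : forall a b, N a (v b) = N b (v a).

Lemma functional0 (f : L -> K) : scalar f -> f 0 = 0.
Proof.
by move=> lf; have := lf (-1) 0 0; rewrite scaler0 addr0 mulN1r addNr.
Qed.

Lemma functionalZ (f : L -> K) c x : scalar f -> f (c *: x) = c * f x.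
Proof. by move=> lf; have := lf c x 0; rewrite addr0 (functional0 lf) addr0. Qed.

Lemma functionalD (f : L -> K) x y : scalar f -> f (x + y) = f x + f y.
Proof. by move=> lf; have := lf 1 x y; rewrite scale1r mul1r. Qed.

Lemma functionalN (f : L -> K) x : scalar f -> f (- x) = - f x.
Proof. by move=> lf; rewrite -scaleN1r functionalZ // mulN1r. Qed.

Let scalar_ext (f g : L -> K) : scalar f -> scalar g ->
  (forall b, f (v b) = g (v b)) -> forall x, f x = g x.
Proof.
move=> lf lg fg; apply: v_span => //; split; first by rewrite !functional0.
by move=> c x y fx fy; rewrite lf lg fx fy.
Qed.

(** The spanning vectors [v a] may be dependent, so prescribed values need not extend linearly. Here
    they do: by [N_sym] the functional [N a] realizes the values prescribed for [y = v a], and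
    realizability passes to linear combinations of the [y]. Spanning gives uniqueness, hence
    linearity in [y]. *)
Lemma form_of_kernel : exists B : L -> L -> K,
  [/\ forall y, scalar (B y), forall y, scalar (B^~ y),
      forall x y, B x y = B y x & forall a z, B (v a) z = N a z].
Proof.
have ex y : exists f : L -> K, scalar f /\ forall b, f (v b) = N b y.
  apply: (v_span (W := fun y =>
    exists f : L -> K, scalar f /\ forall b, f (v b) = N b y)).
    split.
      by exists (fun=> 0); split=> [c x z|b]; rewrite ?mulr0 ?addr0 ?functional0.
    move=> c x z [f [lf fE]] [g [lg gE]].
    exists (fun u => c * f u + g u); split=> [d u w|b]; last first.
      by rewrite fE gE N_scalar.
    by rewrite lf lg; ring.
  by move=> a; exists (N a); split=> // b; rewrite N_sym.
pose B y := projT1 (cid (ex y)).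
have lB y : scalar (B y) by rewrite /B; case: cid => /= f [].
have BE y b : B y (v b) = N b y by rewrite /B; case: cid => /= f [_ ->].
have Bv a z : B (v a) z = N a z.
  by apply: scalar_ext => // b; rewrite BE N_sym.
have BlE c x y z : B (c *: x + y) z = c * B x z + B y z.
  apply: (scalar_ext (f := B _) (g := fun z => c * B x z + B y z)) => //.
    by move=> d u w; rewrite !lB; ring.
  by move=> b; rewrite !BE N_scalar.
exists B; split=> // [y c x z|x y]; first exact: BlE.
apply: (scalar_ext (f := B x) (g := B^~ x)) => // [c u w|b]; first exact: BlE.
by rewrite BE Bv.
Qed.

End FormFromKernel.

(** * Chevalley relations and the spanning set of words *)

Section RealLie.
Variables (K : numFieldType) (L : lmodType K) (br : L -> L -> L).
Hypothesis br_linearl : forall y, linear (br^~ y).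
Hypothesis br_linearr : forall x, linear (br x).
Hypothesis brC : forall x y, br x y = - br y x.
Hypothesis br_jacobi :
  forall x y z, br x (br y z) + br y (br z x) + br z (br x y) = 0.
Variables (n : nat) (h : lmodType K) (beta : 'I_n -> h -> K) (gamma : 'I_n -> h).
Hypothesis beta_scalar : forall j, scalar (beta j).

Lemma brDl x y z : br (x + y) z = br x z + br y z.
Proof. by have := br_linearl z 1 x y; rewrite /= !scale1r. Qed.
Lemma brDr x y z : br z (x + y) = br z x + br z y.
Proof. by have := br_linearr z 1 x y; rewrite /= !scale1r. Qed.
Lemma br_l0 z : br 0 z = 0.
Proof. by apply: (addrI (br 0 z)); rewrite -brDl !addr0. Qed.
Lemma br_r0 z : br z 0 = 0.
Proof. by rewrite brC br_l0 oppr0. Qed.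
Lemma br_Zl c x z : br (c *: x) z = c *: br x z.
Proof. by have := br_linearl z c x 0; rewrite /= !br_l0 !addr0. Qed.
Lemma br_Zr c x z : br z (c *: x) = c *: br z x.
Proof. by rewrite brC br_Zl -scalerN -brC. Qed.
Lemma br_Nl x z : br (- x) z = - br x z.
Proof. by rewrite -scaleN1r br_Zl scaleN1r. Qed.
Lemma br_Nr x z : br z (- x) = - br z x.
Proof. by rewrite -scaleN1r br_Zr scaleN1r. Qed.

Lemma br_leibniz x y z : br x (br y z) = br (br x y) z + br y (br x z).
Proof.
have /eqP := br_jacobi x y z; rewrite -addrA addr_eq0 => /eqP ->.
by rewrite opprD addrC (brC z) opprK (brC z x) br_Nr opprK.
Qed.

Record chevalley (e f : 'I_n -> L) (H : h -> L) : Prop := Chevalley {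
  chev_lin : linear H;
  chev_ef : forall k j, br (e k) (f j) = if k == j then H (gamma j) else 0;
  chev_hh : forall x y, br (H x) (H y) = 0;
  chev_he : forall x j, br (H x) (e j) = beta j x *: e j;
  chev_hf : forall x j, br (H x) (f j) = - (beta j x *: f j)
}.

Lemma chev_HN e f H x : chevalley e f H -> H (- x) = - H x.
Proof.
case=> lH _ _ _ _; have H0 : H 0 = 0.
  by have := lH (-1) 0 0; rewrite !scaleN1r !addNr.
by have := lH (-1) x 0; rewrite !addr0 !scaleN1r H0 addr0.
Qed.

(** The relations are symmetric under exchanging [e] and [f] and negating [h], so each statement on
    words in [e] also gives one on words in [f]. *)
Lemma chevalley_swap e f H : chevalley e f H -> chevalley f e (fun x => H (- x)).
Proof.
move=> C; have HN x := chev_HN x C; case: C => lH ef hh he hf.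
split=> [c x y|k j|x y|x j|x j]; rewrite ?HN ?br_Nl ?br_Nr.
- by rewrite lH opprD scalerN.
- by rewrite brC ef eq_sym; case: eqP => [->|_]; rewrite ?oppr0 ?HN.
- by rewrite hh !oppr0.
- by rewrite hf opprK.
- by rewrite he.
Qed.

(* Words are nonempty: [i] is the first letter, [w] the remaining ones. *)
Fixpoint word_br (v : 'I_n -> L) i (w : seq 'I_n) : L :=
  if w is j :: w' then br (v i) (word_br v j w') else v i.

Definition word_weight i (w : seq 'I_n) (x : h) : K := \sum_(j <- i :: w) beta j x.

Lemma word_weight_cons i j w x :
  word_weight i (j :: w) x = beta i x + word_weight j w x.
Proof. by rewrite /word_weight big_cons. Qed.

Lemma word_weightN i w x : word_weight i w (- x) = - word_weight i w x.
Proof.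
rewrite /word_weight -sumrN; apply: eq_bigr => j _; exact: functionalN (beta_scalar j).
Qed.

Lemma br_h_word e f H i w x : chevalley e f H ->
  br (H x) (word_br e i w) = word_weight i w x *: word_br e i w.
Proof.
move=> C; elim: w i => [|j w IH] i /=.
  by rewrite (chev_he C) /word_weight big_seq1.
by rewrite br_leibniz (chev_he C) br_Zl IH br_Zr word_weight_cons scalerDl.
Qed.

Lemma br_h_word_f e f H i w x : chevalley e f H ->
  br (H x) (word_br f i w) = - (word_weight i w x *: word_br f i w).
Proof.
move=> C; have := br_h_word i w x (chevalley_swap C).
by rewrite (chev_HN _ C) br_Nl => <-; rewrite opprK.
Qed.

(** Bracketing with [f k] sends a word of at least two letters into the span of the words with one
    letter less. The span is expressed by quantifying over all subspaces [W] that contain these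
    words. *)
Lemma br_f_word e f H k i j w (W : L -> Prop) : chevalley e f H -> lin_closed W ->
  (forall l t, size t = size w -> W (word_br e l t)) ->
  W (br (f k) (word_br e i (j :: w))).
Proof.
move=> C; have EF a b : br (f a) (e b) = if b == a then - H (gamma a) else 0.
  by rewrite brC (chev_ef C); case: eqP => // _; rewrite oppr0.
elim: w i j W => [|l w IH] i j W [W0 Wc] Ww.
  rewrite /= br_leibniz !EF.
  have WZ c x : W x -> W (c *: x) by move=> Wx; rewrite -[_ *: _]addr0; exact: Wc.
  have -> : br (if i == k then - H (gamma k) else 0) (e j) =
      (if i == k then - beta j (gamma k) else 0) *: e j.
    by case: eqP; rewrite ?br_l0 ?scale0r // br_Nl (chev_he C) scaleNr.
  apply: Wc; first exact: (Ww j [::]).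
  have -> : br (e i) (if j == k then - H (gamma k) else 0) =
      (if j == k then beta i (gamma k) else 0) *: e i.
    by case: eqP; rewrite ?br_r0 ?scale0r // br_Nr brC (chev_he C) opprK.
  by apply: WZ; exact: (Ww i [::]).
rewrite [word_br _ _ _]/= br_leibniz EF.
have -> : br (if i == k then - H (gamma k) else 0) (word_br e j (l :: w)) =
    (if i == k then - word_weight j (l :: w) (gamma k) else 0) *: word_br e j (l :: w).
  by case: eqP; rewrite ?br_l0 ?scale0r // br_Nl (br_h_word _ _ _ C) scaleNr.
apply: (Wc); first exact: Ww.
(* The induction hypothesis is used for the preimage of [W] under the bracket with [e i]. *)
apply: (IH j l (fun x => W (br (e i) x))).
  by split=> [|c x y Wx Wy]; rewrite ?br_r0 // brDr br_Zr; exact: Wc.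
by move=> l' t st; apply: (Ww i (l' :: t)); rewrite /= st.
Qed.

(** The span [S] of the words and of the image of [H] is stable under bracketing with each
    generator, and by the Jacobi identity the elements stabilizing [S] are closed under the
    bracket. *)
Lemma word_span e f H : chevalley e f H ->
  (forall W : L -> Prop, (forall j, W (e j)) -> (forall j, W (f j)) ->
    (forall x, W (H x)) -> lin_closed W ->
    (forall x y, W x -> W y -> W (br x y)) -> forall x, W x) ->
  forall W : L -> Prop, lin_closed W ->
  (forall i w, W (word_br e i w)) -> (forall i w, W (word_br f i w)) ->
  (forall x, W (H x)) -> forall x, W x.
Proof.
move=> C gen.
pose S x := forall W : L -> Prop, lin_closed W ->
  (forall i w, W (word_br e i w)) -> (forall i w, W (word_br f i w)) ->
  (forall x, W (H x)) -> W x.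
suff Sx x : S x by move=> W Wl We Wf Wh x; exact: Sx.
have Sl : lin_closed S.
  split=> [W [] //|c y z Sy Sz W Wl We Wf Wh]; have [_ Wc] := Wl.
  by apply: Wc; [exact: Sy|exact: Sz].
have [S0 Sc] := Sl.
have SZ c y : S y -> S (c *: y) by move=> Sy; rewrite -[_ *: _]addr0; exact: Sc.
have SN y : S y -> S (- y) by move=> Sy; rewrite -scaleN1r; exact: SZ.
have Se i w : S (word_br e i w) by move=> W _ We.
have Sf i w : S (word_br f i w) by move=> W _ _ Wf.
have Sh y : S (H y) by move=> W _ _ _.
have C' := chevalley_swap C.
have HN y := chev_HN y C.
have step y : (forall i w, S (br y (word_br e i w))) ->
    (forall i w, S (br y (word_br f i w))) ->
    (forall x, S (br y (H x))) -> forall z, S z -> S (br y z).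
  move=> He Hf Hh z Sz; apply: (Sz (fun z => S (br y z))) => //.
  split=> [|c u v Su Sv]; rewrite ?br_r0 // brDr br_Zr; exact: Sc.
(* Membership and stability are carried together: a bracket of two such elements lies in [S] because
   the first stabilizes [S] and the second belongs to it. *)
pose T y := S y /\ forall z, S z -> S (br y z).
suff [] : T x by [].
apply: gen => [j|j|y||u v [Su Tu] [Sv Tv]].
- split; first exact: (Se j [::]).
  apply: step => [i w|i w|y]; first exact: (Se j (i :: w)).
    case: w => [|k w]; last by apply: (br_f_word _ _ _ C').
    by rewrite /= (chev_ef C); case: eqP.
  rewrite brC (chev_he C) -scaleNr; apply: SZ; exact: (Se j [::]).
- split; first exact: (Sf j [::]).
  apply: step => [i w|i w|y]; last 1 first.
  + by rewrite brC (chev_hf C) opprK; apply: SZ; exact: (Sf j [::]).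
  + case: w => [|k w]; last by apply: (br_f_word _ _ _ C).
    by rewrite /= brC (chev_ef C); case: eqP => // _; rewrite ?oppr0 //; exact: SN.
  + exact: (Sf j (i :: w)).
- split=> //; apply: step => [i w|i w|x'].
  + by rewrite (br_h_word _ _ _ C); exact: SZ.
  + by rewrite (br_h_word_f _ _ _ C) -scaleNr; exact: SZ.
  + by rewrite (chev_hh C).
- split=> [|c u v [Su Tu] [Sv Tv]]; first by split=> // z _; rewrite br_l0.
  split; first exact: Sc.
  by move=> z Sz; rewrite brDl br_Zl; apply: Sc; [exact: Tu|exact: Tv].
- split; first exact: Tu.
  move=> z Sz; have -> : br (br u v) z = br u (br v z) - br v (br u z).
    by rewrite br_leibniz addrK.
  rewrite addrC -scaleN1r; apply: Sc.
    by apply: Tv; exact: Tu.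
  by apply: Tu; exact: Tv.
Qed.


Variable d : 'I_n -> K.
Hypothesis d_sym : forall i j, d i * beta i (gamma j) = d j * beta j (gamma i).

(* [cf j] reads off the coefficient of [f j] in the triangular
   decomposition. *)
Record f_coef (e f : 'I_n -> L) (H : h -> L) (cf : 'I_n -> L -> K) : Prop :=
  FCoef {
  fc_scalar : forall i, scalar (cf i);
  fc_f : forall i j, cf i (f j) = (i == j)%:R;
  fc_ff : forall i j k w, cf i (word_br f j (k :: w)) = 0;
  fc_h : forall i x, cf i (H x) = 0;
  fc_e : forall i j w, cf i (word_br e j w) = 0
}.

(* The value of the invariant form at [(word_br v i w, z)], obtained by moving the
   letters of the word to the right argument one at a time. *)
Fixpoint word_pair (v : 'I_n -> L) (c : 'I_n -> L -> K) i w (z : L) : K :=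
  if w is j :: w' then - word_pair v c j w' (br (v i) z) else d i * c i z.

Lemma word_pair_scalar v c i w : (forall i, scalar (c i)) -> scalar (word_pair v c i w).
Proof.
move=> lc; elim: w i => [|j w IH] i a x y /=; first by rewrite lc; ring.
by rewrite brDr br_Zr IH; ring.
Qed.

(** * Values and weights of the functionals attached to words *)

Section Pairing.
Variables (e f : 'I_n -> L) (H : h -> L) (cf : 'I_n -> L -> K).
Hypothesis C : chevalley e f H.
Hypothesis Fc : f_coef e f H cf.
Hypothesis span : forall W : L -> Prop, lin_closed W ->
  (forall i w, W (word_br e i w)) -> (forall i w, W (word_br f i w)) ->
  (forall x, W (H x)) -> forall x, W x.

Notation P := (word_pair e cf).
Let Ps i w : scalar (P i w).
Proof. by apply: word_pair_scalar; exact: fc_scalar Fc. Qed.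

Lemma word_pair_e i w j u : P i w (word_br e j u) = 0.
Proof.
elim: w i j u => [|k w IH] i j u /=; first by rewrite (fc_e Fc) mulr0.
by rewrite (IH _ i (j :: u)) oppr0.
Qed.

Lemma word_pair_h i w x : P i w (H x) = 0.
Proof.
case: w => [|k w] /=; first by rewrite (fc_h Fc) mulr0.
rewrite brC (chev_he C) -scaleNr (functionalZ _ _ (@Ps _ _)).
by rewrite (word_pair_e _ _ i [::]) mulr0 oppr0.
Qed.

Lemma word_pair_f1 i w j : P i w (f j) = if nilp w && (i == j) then d i else 0.
Proof.
case: w => [|k w] /=; first by rewrite (fc_f Fc); case: eqP; rewrite ?mulr1 ?mulr0.
by rewrite (chev_ef C); case: eqP => _; rewrite ?word_pair_h ?(functional0 (@Ps _ _)) oppr0.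
Qed.

(** The functional of a word only sees the part of [z] of the opposite weight. For one letter this
    is checked on the spanning set, where only [f i] contributes; each further letter adds its own
    root. *)
Lemma word_pair_weight i w x z : P i w (br (H x) z) = - (word_weight i w x * P i w z).
Proof.
elim: w i z => [|k w IH] i z /=.
  rewrite /word_weight big_seq1; suff -> : cf i (br (H x) z) = - (beta i x * cf i z) by ring.
  apply: (span (W := fun z => cf i (br (H x) z) = - (beta i x * cf i z))).
  - have ls := fc_scalar Fc i; split; first by rewrite br_r0 (functional0 ls) mulr0 oppr0.
    by move=> c u v uE vE; rewrite brDr br_Zr !ls uE vE; ring.
  - move=> j w; rewrite (br_h_word _ _ _ C) (functionalZ _ _ (fc_scalar Fc i)).
    by rewrite (fc_e Fc); ring.
  - move=> j [|k w]; rewrite (br_h_word_f _ _ _ C) (functionalN _ (fc_scalar Fc i)).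
      rewrite (functionalZ _ _ (fc_scalar Fc i)) /= (fc_f Fc) /word_weight big_seq1.
      by case: eqP => [->|_] //; rewrite !mulr0.
    by rewrite (functionalZ _ _ (fc_scalar Fc i)) (fc_ff Fc); ring.
  - by move=> y; rewrite (chev_hh C) (functional0 (fc_scalar Fc i)) (fc_h Fc) mulr0 oppr0.
have -> : br (e i) (br (H x) z) = br (H x) (br (e i) z) - beta i x *: br (e i) z.
  by rewrite (br_leibniz (H x)) (chev_he C) br_Zl [RHS]addrC addKr.
rewrite -scaleNr addrC (@Ps k w) IH word_weight_cons; ring.
Qed.

End Pairing.

(** * Symmetry of the pairing between words in the [e] and in the [f] *)

Section Symmetry.
Variables (e f : 'I_n -> L) (H : h -> L) (cf ce : 'I_n -> L -> K).
Hypothesis C : chevalley e f H.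
Hypothesis Fc : f_coef e f H cf.
Hypothesis Ec : f_coef f e (fun x => H (- x)) ce.
Hypothesis span : forall W : L -> Prop, lin_closed W ->
  (forall i w, W (word_br e i w)) -> (forall i w, W (word_br f i w)) ->
  (forall x, W (H x)) -> forall x, W x.

Notation P := (word_pair e cf).
Notation P' := (word_pair f ce).
Let C' := chevalley_swap C.
Let Ps i w : scalar (P i w).
Proof. by apply: word_pair_scalar; exact: fc_scalar Fc. Qed.
Let Ps' i w : scalar (P' i w).
Proof. by apply: word_pair_scalar; exact: fc_scalar Ec. Qed.
Let fe a b : br (f a) (e b) = if b == a then - H (gamma a) else 0.
Proof. by rewrite brC (chev_ef C); case: eqP => // _; rewrite oppr0. Qed.
Let fh a x : br (f a) (H x) = beta a x *: f a.
Proof. by rewrite brC (chev_hf C) opprK. Qed.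
Let eh a x : br (e a) (H x) = - (beta a x *: e a).
Proof. by rewrite brC (chev_he C). Qed.

(** This is the part of the inductive step in which [e i] and [f j] have been commuted past each
    other. For longer words, [br (e i)] and [br (f j)] shorten the words they act on, and the
    assumed symmetry for shorter words applies to the results. *)
Let cross m i j k w l u : (size w < m)%N ->
  (forall i w j u, (size w < m)%N -> P i w (word_br f j u) = P' j u (word_br e i w)) ->
  P k w (br (f j) (br (e i) (word_br f l u))) =
  P' l u (br (e i) (br (f j) (word_br e k w))).
Proof.
case: w => [|a w] sw IH.
  rewrite [word_br e k _]/= fe; case: u => [|b u].
    (* Two single letters: both sides are zero unless [i = l] and [k = j], and then they are the two
       sides of [d_sym]. *)
    rewrite [word_br f l _]/= (chev_ef C).
    have -> : P k [::] (br (f j) (if i == l then H (gamma l) else 0)) =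
        if (i == l) && (k == j) then d j * beta j (gamma i) else 0.
      case: (i =P l) => [<-|_]; last by rewrite br_r0 (functional0 (@Ps _ _)).
      rewrite fh (functionalZ _ _ (@Ps _ _)) (word_pair_f1 C Fc) /=.
      by case: eqP => [->|_]; rewrite ?mulr0 // mulrC.
    have -> : P' l [::] (br (e i) (if k == j then - H (gamma j) else 0)) =
        if (i == l) && (k == j) then d i * beta i (gamma j) else 0.
      case: (k =P j) => [<-|_]; last by rewrite br_r0 (functional0 (@Ps' _ _)) andbF.
      rewrite br_Nr eh opprK (functionalZ _ _ (@Ps' _ _)) (word_pair_f1 C' Ec) /= andbT.
      by rewrite eq_sym; case: eqP => [->|_]; rewrite ?mulr0 // mulrC.
    by rewrite d_sym.
  (* When exactly one of the two words is a single letter, the degrees do not match and both sides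
     vanish. *)
  have -> : P' l (b :: u) (br (e i) (if k == j then - H (gamma j) else 0)) = 0.
    case: eqP => _; last by rewrite br_r0 (functional0 (@Ps' _ _)).
    rewrite br_Nr eh opprK (functionalZ _ _ (@Ps' _ _)) (word_pair_f1 C' Ec).
    by rewrite mulr0.
  apply: (br_f_word (W := fun z => P k [::] (br (f j) z) = 0) _ _ _ C').
    split=> [|c x y xE yE]; first by rewrite br_r0 (functional0 (@Ps _ _)).
    by rewrite brDr br_Zr Ps xE yE mulr0 addr0.
  by move=> l' t _ /=; rewrite -[br _ _]/(word_br f j (l' :: t)) (fc_ff Fc) mulr0.
case: u => [|b u].
  rewrite [word_br f l _]/= (chev_ef C).
  have -> : P k (a :: w) (br (f j) (if i == l then H (gamma l) else 0)) = 0.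
    case: eqP => _; last by rewrite br_r0 (functional0 (@Ps _ _)).
    by rewrite fh (functionalZ _ _ (@Ps _ _)) (word_pair_f1 C Fc) mulr0.
  apply/esym; apply: (br_f_word (W := fun z => P' l [::] (br (e i) z) = 0) _ _ _ C).
    split=> [|c x y xE yE]; first by rewrite br_r0 (functional0 (@Ps' _ _)).
    by rewrite brDr br_Zr Ps' xE yE mulr0 addr0.
  by move=> l' t _ /=; rewrite -[br _ _]/(word_br e i (l' :: t)) (fc_ff Ec) mulr0.
(* [phi] extends [(x | -)], for the element [x = br (f j) (word_br e k (a :: w))]
   of smaller degree, linearly beyond the words in the [f j]. *)
have [phi [phis phiE phiF]] : exists phi : L -> K, [/\ scalar phi,
    forall c t, phi (word_br f c t) = - P' c t (br (f j) (word_br e k (a :: w))) &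
    phi (br (e i) (word_br f l (b :: u))) =
      P' l (b :: u) (br (e i) (br (f j) (word_br e k (a :: w))))].
  apply: (br_f_word (W := fun x => exists phi : L -> K, [/\ scalar phi,
    forall c t, phi (word_br f c t) = - P' c t x &
    phi (br (e i) (word_br f l (b :: u))) = P' l (b :: u) (br (e i) x)]) _ _ _ C).
    split.
      exists (fun=> 0); split=> [c x y|c t|].
      - by rewrite mulr0 addr0.
      - by rewrite (functional0 (@Ps' _ _)) oppr0.
      - by rewrite br_r0 (functional0 (@Ps' _ _)).
    move=> c x y [p [ps pE pF]] [q [qs qE qF]].
    exists (fun z => c * p z + q z); split=> [c' u' v'|c' t|].
    - by rewrite ps qs; ring.
    - by rewrite pE qE Ps'; ring.
    - by rewrite pF qF brDr br_Zr Ps'.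
  move=> c s ss; exists (fun z => - P c s z); split=> [c' u' v'|c' t|].
  - by rewrite Ps; ring.
  - by rewrite IH // ss; exact: ltnW.
  - by rewrite -[LHS]/(P i (c :: s) (word_br f l (b :: u))) IH //= ss.
rewrite -phiF.
apply: (br_f_word (W := fun z => P k (a :: w) (br (f j) z) = phi z) _ _ _ C').
  split=> [|c x y xE yE].
    by rewrite br_r0 (functional0 (@Ps _ _)) (functional0 phis).
  by rewrite brDr br_Zr Ps xE yE phis.
move=> c t _; rewrite -[br _ _]/(word_br f j (c :: t)) IH // phiE.
Qed.

(** Induction on the length of [w]. Once a letter has been moved on each side, the Leibniz rule
    leaves the term [cross] and a term with the bracket of [e i] and [f j]. The latter lies in the
    image of [H], so it acts by the same scalar on both sides. *)
Lemma word_pair_sym i w j u : P i w (word_br f j u) = P' j u (word_br e i w).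
Proof.
have [m] := ubnP (size w); elim: m i w j u => // m IH i w j u; rewrite ltnS.
case: w => [|k w] sw; case: u => [|l u].
- rewrite [word_br f j _]/= [word_br e i _]/= (word_pair_f1 C Fc) (word_pair_f1 C' Ec) /=.
  by rewrite eq_sym; case: eqP => [->|].
- by rewrite [word_br e i _]/= (word_pair_f1 C' Ec) /=
    -[br _ _]/(word_br f j (l :: u)) (fc_ff Fc) mulr0.
- by rewrite [word_br f j _]/= (word_pair_f1 C Fc) /=
    -[br _ _]/(word_br e i (k :: w)) (fc_ff Ec) mulr0.
rewrite /= (br_leibniz (e i)) (br_leibniz (f j) (e i) (word_br e k w)) (chev_ef C) fe.
rewrite (functionalD _ _ (@Ps _ _)) (functionalD _ _ (@Ps' _ _)) (cross i j k l u sw IH).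
congr (- (_ + _)); case: (i =P j) => [<-|_]; last first.
  by rewrite !br_l0 (functional0 (@Ps _ _)) (functional0 (@Ps' _ _)).
rewrite (word_pair_weight C Fc span) br_Nl (br_h_word _ _ _ C) (functionalN _ (@Ps' _ _)).
by rewrite (functionalZ _ _ (@Ps' _ _)) IH.
Qed.

End Symmetry.

Lemma lin_closedZ (W : L -> Prop) c x : lin_closed W -> W x -> W (c *: x).
Proof. by case=> W0 Wc Wx; rewrite -[_ *: _]addr0; exact: Wc. Qed.

(** Invariance is stated one element at a time: it passes to linear combinations and to brackets, so
    it is enough to verify it for the generators. *)
Definition ad_skew (B : L -> L -> K) u :=
  forall y z, B (br u y) z = - B y (br u z).

(** * Invariance under the generators *)

Section Invariance.
Variables (e f : 'I_n -> L) (H : h -> L) (cf ce : 'I_n -> L -> K) (B : L -> L -> K).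
Hypothesis C : chevalley e f H.
Hypothesis Fc : f_coef e f H cf.
Hypothesis Ec : f_coef f e (fun x => H (- x)) ce.
Hypothesis span : forall W : L -> Prop, lin_closed W ->
  (forall i w, W (word_br e i w)) -> (forall i w, W (word_br f i w)) ->
  (forall x, W (H x)) -> forall x, W x.
Hypothesis Br : forall y, scalar (B y).
Hypothesis Bl : forall y, scalar (B^~ y).
Hypothesis BC : forall x y, B x y = B y x.
Hypothesis Be : forall i w z, B (word_br e i w) z = word_pair e cf i w z.
Hypothesis Bf : forall i w z, B (word_br f i w) z = word_pair f ce i w z.
Hypothesis Bh : forall x j, B (H x) (H (gamma j)) = d j * beta j x.

Let C' := chevalley_swap C.

Let Bhe x i w : B (H x) (word_br e i w) = 0.
Proof. by rewrite BC Be (word_pair_h C Fc). Qed.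

Let Bhf x i w : B (H x) (word_br f i w) = 0.
Proof.
by have := word_pair_h C' Ec i w (- x); rewrite opprK BC Bf.
Qed.

Lemma lin_closed_eq (f1 f2 : L -> K) : scalar f1 -> scalar f2 ->
  lin_closed (fun z => f1 z = f2 z).
Proof.
move=> l1 l2; split=> [|c x y xE yE]; first by rewrite !functional0.
by rewrite l1 l2 xE yE.
Qed.

Let Bskewr u y : scalar (fun z => - B y (br u z)).
Proof. by move=> c z w; rewrite brDr br_Zr Br; ring. Qed.

Let Bskewl u z : scalar (fun y => - B y (br u z)).
Proof. by move=> c x y; rewrite Bl; ring. Qed.

Let Bbrl u z : scalar (fun y => B (br u y) z).
Proof. by move=> c x y; rewrite brDr br_Zr Bl. Qed.

(** Against a word in [e] the identity is the recursion defining [word_pair], and symmetry covers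
    such a word on the right. For two words in [f] both sides vanish, since [e i] turns such a word
    into shorter ones or into an element of [H]. The image of [H] is left. *)
Lemma ad_skew_e i : ad_skew B (e i).
Proof.
have inv_e a w z : B (br (e i) (word_br e a w)) z = - B (word_br e a w) (br (e i) z).
  by rewrite -[br _ _]/(word_br e i (a :: w)) !Be.
have Bff a w l t : B (word_br f a w) (br (e i) (word_br f l t)) = 0.
  case: t => [|b t].
    rewrite /= (chev_ef C); case: eqP => _; last exact: functional0 (Br _).
    by rewrite BC Bhf.
  apply: (br_f_word (W := fun z => B (word_br f a w) z = 0) _ _ _ C').
    by split=> [|c x y xE yE]; rewrite ?(functional0 (Br _)) // Br xE yE mulr0 addr0.
  by move=> l' t' _; rewrite Bf (word_pair_e Ec).
(* Among the spanning vectors only [z = f i] can give nonzero values; both are then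
   [d i * beta i x], by the normalization of [word_pair] and by [Bh]. *)
have inv_h x z : B (br (e i) (H x)) z = - B (H x) (br (e i) z).
  rewrite brC (chev_he C) -scaleNr (functionalZ _ _ (Bl z)) mulNr; congr (- _).
  move: z; apply: (span (W := fun z => beta i x * B (e i) z = B (H x) (br (e i) z))).
  - apply: lin_closed_eq => c u v; first by rewrite Br; ring.
    by rewrite brDr br_Zr Br.
  - move=> a w; rewrite -[e i]/(word_br e i [::]) Be (word_pair_e Fc) mulr0.
    by rewrite -[br _ _]/(word_br e i (a :: w)) Bhe.
  - move=> a [|b w].
      rewrite -[e i]/(word_br e i [::]) Be [word_br f a _]/= (word_pair_f1 C Fc) /= (chev_ef C).
      case: eqP => [<-|_]; first by rewrite Bh mulrC.
      by rewrite mulr0 (functional0 (Br _)).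
    rewrite -[e i]/(word_br e i [::]) Be /= -[br (f a) _]/(word_br f a (b :: w)) (fc_ff Fc).
    rewrite !mulr0; apply/esym.
    apply: (br_f_word (W := fun z => B (H x) z = 0) _ _ _ C') => //.
    by split=> [|c u v uE vE]; rewrite ?(functional0 (Br _)) // Br uE vE mulr0 addr0.
  - move=> y; rewrite -[e i]/(word_br e i [::]) Be (word_pair_h C Fc) mulr0 brC (chev_he C).
    by rewrite (functionalN _ (Br _)) (functionalZ _ _ (Br _)) (Bhe x i [::]) mulr0 oppr0.
move=> y z; move: y; apply: span => [|a w|a w|x].
- by apply: lin_closed_eq.
- exact: inv_e.
- move: z; apply: span => [|b t|b t|x].
  + by apply: lin_closed_eq.
  + by rewrite [in RHS]BC inv_e opprK BC.
  + by rewrite Bff oppr0 BC Bff.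
  + by rewrite [in RHS]BC inv_h opprK BC.
- exact: inv_h.
Qed.

Lemma ad_skew_h x : ad_skew B (H x).
Proof.
move=> y z; move: y; apply: span => [|a w|a w|y].
- by apply: lin_closed_eq.
- rewrite (br_h_word _ _ _ C) (functionalZ _ _ (Bl _)) !Be (word_pair_weight C Fc span).
  by rewrite opprK.
(* In the swapped data the Cartan map is [H (- x)], so the weight formula is taken at [- x]. *)
- have := word_pair_weight C' Ec _ a w (- x) z; rewrite opprK => weight.
  rewrite (br_h_word_f _ _ _ C) (functionalN _ (Bl _)) (functionalZ _ _ (Bl _)) !Bf.
  rewrite weight ?word_weightN ?mulNr ?opprK //.
  move=> W Wl Wf We Wh u; apply: span => // y.
  by rewrite -[y]opprK.
- rewrite (chev_hh C) (functional0 (Bl _)).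
  suff -> : B (H y) (br (H x) z) = 0 by rewrite oppr0.
  move: z; apply: span => [|a w|a w|z].
  + by apply: lin_closed_eq => c u v; rewrite ?mulr0 ?addr0 // brDr br_Zr Br.
  + by rewrite (br_h_word _ _ _ C) (functionalZ _ _ (Br _)) Bhe mulr0.
  + rewrite (br_h_word_f _ _ _ C) (functionalN _ (Br _)) (functionalZ _ _ (Br _)).
    by rewrite Bhf mulr0 oppr0.
  + by rewrite (chev_hh C) (functional0 (Br _)).
Qed.

End Invariance.

Lemma ad_skewM B u v : (forall y, scalar (B y)) -> (forall y, scalar (B^~ y)) ->
  ad_skew B u -> ad_skew B v -> ad_skew B (br u v).
Proof.
move=> Br Bl su sv y z.
have brE w : br (br u v) w = br u (br v w) - br v (br u w) by rewrite br_leibniz addrK.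
rewrite !brE (functionalD _ _ (Bl z)) (functionalN _ (Bl z)) (functionalD _ _ (Br y)).
by rewrite (functionalN _ (Br y)) /= !(su, sv) !opprK opprB.
Qed.

(** * Existence of the invariant form *)

Section InvariantForm.
Variables (e f : 'I_n -> L) (H : h -> L) (cf ce : 'I_n -> L -> K).
Variables (S : h -> h -> K) (Q : h -> L -> K).
Hypothesis C : chevalley e f H.
Hypothesis Fc : f_coef e f H cf.
Hypothesis Ec : f_coef f e (fun x => H (- x)) ce.
Hypothesis gen : forall W : L -> Prop, (forall j, W (e j)) -> (forall j, W (f j)) ->
    (forall x, W (H x)) -> lin_closed W ->
    (forall x y, W x -> W y -> W (br x y)) -> forall x, W x.
Hypothesis S_scalar : forall x, scalar (S x).
Hypothesis S_sym : forall x y, S x y = S y x.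
Hypothesis S_gamma : forall x j, S x (gamma j) = d j * beta j x.
Hypothesis Q_scalar : forall x, scalar (Q x).
Hypothesis Q_h : forall x y, Q x (H y) = S x y.
Hypothesis Q_e : forall x i w, Q x (word_br e i w) = 0.
Hypothesis Q_f : forall x i w, Q x (word_br f i w) = 0.

Let C' := chevalley_swap C.
Let span := word_span C gen.

Let span' (W : L -> Prop) : lin_closed W -> (forall i w, W (word_br f i w)) ->
  (forall i w, W (word_br e i w)) -> (forall x, W (H (- x))) -> forall x, W x.
Proof.
move=> Wl Wf We Wh; apply: span => // x.
by rewrite -[x]opprK.
Qed.

(** The kernel uses [word_pair] on words and [Q x] on [H x]. The functional [Q x] extends [S x] by
    zero on all words; its existence is a hypothesis because it rests on the triangular
    decomposition, which the Chevalley relations alone do not provide. *)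
Lemma invariant_form : exists B : L -> L -> K,
  [/\ (forall y, scalar (B y)) /\ (forall y, scalar (B^~ y)),
      forall x y, B x y = B y x,
      forall x y z, B (br x y) z = B x (br y z) &
      forall x y, B (H x) (H y) = S x y].
Proof.
pose X := (('I_n * seq 'I_n) + ('I_n * seq 'I_n) + h)%type.
pose v (a : X) : L := match a with
  | inl (inl (i, w)) => word_br e i w | inl (inr (i, w)) => word_br f i w
  | inr x => H x end.
pose N (a : X) : L -> K := match a with
  | inl (inl (i, w)) => word_pair e cf i w
  | inl (inr (i, w)) => word_pair f ce i w | inr x => Q x end.
have vspan W : lin_closed W -> (forall a, W (v a)) -> forall x, W x.
  move=> Wl Wv; apply: span => // [i w|i w|x].
  - exact: (Wv (inl (inl (i, w)))).
  - exact: (Wv (inl (inr (i, w)))).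
  - exact: (Wv (inr x)).
have Ns a : scalar (N a).
  case: a => [[[i w]|[i w]]|x] //=.
    by apply: word_pair_scalar; exact: fc_scalar Fc.
  by apply: word_pair_scalar; exact: fc_scalar Ec.
have fh i w x : word_pair f ce i w (H x) = 0.
  by have := word_pair_h C' Ec i w (- x); rewrite opprK.
have Nsym a b : N a (v b) = N b (v a).
  case: a => [[[i w]|[i w]]|x]; case: b => [[[j u]|[j u]]|y] //=;
    rewrite ?(word_pair_e Fc) ?(word_pair_e Ec) ?(word_pair_h C Fc) ?fh ?Q_e ?Q_f ?Q_h //.
  - exact: (word_pair_sym C Fc Ec span).
  - by apply/esym; exact: (word_pair_sym C Fc Ec span).
have [B [Br Bl BC Bv]] := form_of_kernel vspan Ns Nsym.
have Be i w z : B (word_br e i w) z = word_pair e cf i w z := Bv (inl (inl (i, w))) z.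
have Bf i w z : B (word_br f i w) z = word_pair f ce i w z := Bv (inl (inr (i, w))) z.
have Bh x z : B (H x) z = Q x z := Bv (inr x) z.
have Bhg x j : B (H x) (H (gamma j)) = d j * beta j x by rewrite Bh Q_h.
have Bhg' x j : B (H (- x)) (H (- gamma j)) = d j * beta j x.
  rewrite Bh Q_h (functionalN _ (S_scalar _)) S_sym (functionalN _ (S_scalar _)) opprK.
  by rewrite S_sym.
(* Invariance under [f j] is [ad_skew_e] for the swapped data, whose own swap has the Cartan map
   [H (- - x)]. *)
have Fc' : f_coef e f (fun x => H (- - x)) cf.
  by case: Fc => ? ? ? Fh ?; split=> // i x; exact: Fh.
have skew u : ad_skew B u.
  move: u; apply: gen => [j|j|x||x y].
  - exact: (ad_skew_e C Fc Ec span Br Bl BC Be Bf Bhg).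
  - exact: (ad_skew_e C' Ec Fc' span' Br Bl BC Bf Be Bhg').
  - exact: (ad_skew_h C Fc Ec span Br Bl BC Be Bf).
  - split=> [y z|c x y sx sy w z].
      by rewrite !br_l0 (functional0 (Bl _)) (functional0 (Br _)) oppr0.
    by rewrite !brDl !br_Zl [LHS](Bl z) Br /= sx sy; ring.
  - exact: ad_skewM.
exists B; split=> // [x y z|x y]; last by rewrite Bh Q_h.
by rewrite brC (functionalN _ (Bl _)) skew opprK.
Qed.

End InvariantForm.

(** * Ideals meeting the Cartan subalgebra trivially *)

Section Radical.
Variables (e f : 'I_n -> L) (H : h -> L) (B : L -> L -> K) (x0 : h).
Hypothesis C : chevalley e f H.
Hypothesis gen : forall W : L -> Prop, (forall j, W (e j)) -> (forall j, W (f j)) ->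
    (forall x, W (H x)) -> lin_closed W ->
    (forall x y, W x -> W y -> W (br x y)) -> forall x, W x.
Hypothesis Br : forall y, scalar (B y).
Hypothesis Bl : forall y, scalar (B^~ y).
Hypothesis Binv : forall x y z, B (br x y) z = B x (br y z).
Hypothesis x0_beta : forall j, beta j x0 = 1.

(* [x0] defines the principal grading; the product of the factors
   [ad x0 - k] over the nonzero degrees [k] occurring in [x] kills all but the
   [H]-component of [x]. *)
Let T k x := br (H x0) x - k *: x.

Let T_lin k : linear (T k).
Proof.
move=> c x y; rewrite /T br_linearr !scalerDr scalerN !scalerA (mulrC k).
by rewrite opprD addrACA.
Qed.

Let TC k l x : T k (T l x) = T l (T k x).
Proof.
rewrite /T !brDr !br_Nr !br_Zr !scalerBr !scalerA (mulrC k) !opprB.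
rewrite -!addrA; congr (_ + _); rewrite addrCA [RHS]addrCA; congr (_ + _).
by rewrite addrC.
Qed.

Let Ts s x := foldr T x s.

Let Ts_lin s : linear (Ts s).
Proof.
by elim: s => // k s IH c x y; rewrite -[LHS]/(T k (Ts s _)) IH T_lin.
Qed.

Let Ts_T s k x : Ts s (T k x) = T k (Ts s x).
Proof. by elim: s => // l s IH; rewrite -[LHS]/(T l (Ts s _)) IH TC. Qed.

Let TsC s t x : Ts s (Ts t x) = Ts t (Ts s x).
Proof. by elim: t => // k t IH; rewrite -[RHS]/(T k (Ts t (Ts s x))) -IH -Ts_T. Qed.

Let HZ c x : H (c *: x) = c *: H x.
Proof.
have H0 : H 0 = 0.
  by have := chev_lin C (-1) 0 0; rewrite !scaleN1r !addNr.
by have := chev_lin C c x 0; rewrite H0 !addr0.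
Qed.

Let Ts_h s x : exists y, Ts s (H x) = H y.
Proof.
elim: s => [|k s [y E]]; first by exists x.
by exists (- k *: y); rewrite -[LHS]/(T k (Ts s _)) E /T (chev_hh C) sub0r HZ scaleNr.
Qed.

Let wt_x0 i w : word_weight i w x0 = (size w).+1%:R.
Proof.
rewrite /word_weight (eq_bigr (fun=> 1)) => [|j _]; last exact: x0_beta.
by rewrite big_const_seq count_predT iter_addr_0.
Qed.

Let Ts_proj x : exists s, all (predC1 0) s /\ exists y, Ts s x = H y.
Proof.
move: x; apply: (word_span C gen) => [|i w|i w|x].
- have H0 : H 0 = 0 by rewrite -(scale0r 0) HZ scale0r.
  split=> [|c x y [s [s0 [x' xE]]] [t [t0 [y' yE]]]].
    by exists [::]; split=> //; exists 0.
  exists (s ++ t); split; first by rewrite all_cat s0.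
  have [x1 E1] := Ts_h t x'; have [y1 E2] := Ts_h s y'.
  exists (c *: x1 + y1); rewrite (chev_lin C) -E1 -E2 -xE -yE.
  by rewrite (TsC t s) /Ts foldr_cat -!/(Ts _ _) !Ts_lin.
- exists [:: word_weight i w x0]; rewrite /= wt_x0 pnatr_eq0; split=> //.
  exists 0; rewrite -(scale0r 0) HZ scale0r /T (br_h_word _ _ _ C) wt_x0.
  by rewrite subrr.
- exists [:: - word_weight i w x0]; rewrite /= wt_x0 oppr_eq0 pnatr_eq0; split=> //.
  exists 0; rewrite -(scale0r 0) HZ scale0r /T (br_h_word_f _ _ _ C) wt_x0.
  by rewrite scaleNr subrr.
- by exists [::]; split=> //; exists x.
Qed.

(** For [t] in [I], the projection [Ts s t] lies in [I] and in the image of [H], so it is zero. By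
    invariance [T k] multiplies the pairing with [H y] by [- k], and the [k] are nonzero; hence [t]
    is orthogonal to [H y]. Invariance carries orthogonality over to the generators and their
    brackets. *)
Lemma trivial_ideal_radical (I : L -> Prop) : lin_closed I ->
  (forall x y, I y -> I (br x y)) -> (forall x, I (H x) -> H x = 0) ->
  forall t x, I t -> B t x = 0.
Proof.
move=> Il Ibr Ih; have Bth t y : I t -> B t (H y) = 0.
  move=> It; have [s [s0 [z zE]]] := Ts_proj t.
  have ITs s' : I (Ts s' t).
    elim: s' => //= k s' IH; rewrite /T -scaleNr addrC.
    by case: (Il) => _; apply=> //; exact: Ibr.
  have : B (Ts s t) (H y) = 0.
    by have := ITs s; rewrite zE => /Ih ->; rewrite (functional0 (Bl _)).
  elim: s s0 {zE} => //= k s IH /andP[k0 /IH s0].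
  rewrite /T (functionalD _ _ (Bl _)) (functionalN _ (Bl _)) (functionalZ _ _ (Bl _)).
  rewrite brC (functionalN _ (Bl _)) Binv (chev_hh C) (functional0 (Br _)) oppr0 add0r.
  by move/eqP; rewrite oppr_eq0 mulf_eq0 (negPf k0) => /eqP/s0.
move=> t x; move: x t.
have Itx x t : I t -> I (br t x).
  by move=> It; rewrite brC -scaleN1r; apply: lin_closedZ => //; exact: Ibr.
apply: gen => [j t It|j t It|x t It||x y Wx Wy t It].
(* Since [beta j x0 = 1], the generator [e j] is the bracket of [H x0] with itself, and [e j] can be
   moved to the side of [t], which stays in [I]. *)
- rewrite -[e j]scale1r -(x0_beta j) -(chev_he C) brC (functionalN _ (Br _)) -Binv.
  by rewrite Bth ?oppr0 //; exact: Itx.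
- rewrite -[f j]opprK -[f j]scale1r -(x0_beta j) -(chev_hf C) brC.
  by rewrite opprK -Binv Bth //; exact: Itx.
- exact: Bth.
- split=> [t It|c x y Wx Wy t It]; first exact: functional0 (Br _).
  by rewrite Br Wx // Wy // mulr0 addr0.
- by rewrite -Binv Wy //; exact: Itx.
Qed.

End Radical.

End RealLie.

(** * The real form of [eta (A)] *)

Section EtaCoef.
Variables (R : realType) (r n : nat) (h : vectType R).
Variables (beta : 'I_n -> cddual R h r) (gamma : 'I_n -> cdV h r).
Hypothesis r_gt1 : (1 < r)%N.
Hypothesis beta_real : forall j (y : h), cdreal (ev (beta j) (pure0 r y)).
Hypothesis gamma_real : forall j m, m != cdi0 r -> gamma j m = 0.

Let al j (x : h) : R := beta j (cdi0 r) x.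
Let g j : h := gamma j (cdi0 r).
Notation L := (lie0 (eta beta gamma)).
Notation br := (@eta0_br R r n h beta gamma).
Notation cls := (@cls R r n h beta gamma).
Notation e := (@eta_e R r n h beta gamma).
Notation f := (@eta_f R r n h beta gamma).
Definition eta_th (x : h) : eta0 beta gamma := cls (TH x).
Notation H := eta_th.

Lemma eta_chevalley : chevalley (h := h) br al g e f H.
Proof.
have E := eta_satisfies beta gamma.
have pI := @pure0_inj R r (eta0 beta gamma).
have HE x : eta_h beta gamma (pure0 r x) = pure0 r (H x) by exact: eta_h_pure0.
have pE j (x : h) : pairing (beta j) (pure0 r x) = al j x *: cdgen R (cdi0 r).
  apply/rowP=> m; rewrite (pairing_coord beta_real) !mxE eqxx /= ffunE.
  by case: eqP => _; rewrite /al ?mulr1 // linear0 mulr0.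
split.
- by move=> c x y; rewrite /eta_th -cls_H.
- move=> k j; apply: pI; rewrite -eta_bracket_pure0 (eta_rel_ef E).
  case: eqP => _; last by apply/ffunP=> m; rewrite !ffunE if_same.
  rewrite -HE; congr (eta_h _ _ _); apply/ffunP=> m; rewrite ffunE.
  by case: eqP => [->|/eqP/gamma_real].
- move=> x y; apply: pI; rewrite -eta_bracket_pure0 -!HE (eta_rel_hh E).
  by apply/ffunP=> m; rewrite !ffunE if_same.
- move=> x j; apply: pI; rewrite -eta_bracket_pure0 -HE (eta_rel_he E) pE.
  by rewrite lactZl -pure0E; apply/ffunP=> m; rewrite !ffunE; case: eqP; rewrite ?scaler0.
- move=> x j; apply: pI; rewrite -eta_bracket_pure0 -HE (eta_rel_hf E) pE.
  rewrite lactZl -pure0E; apply/ffunP=> m; rewrite !ffunE.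
  by case: eqP; rewrite ?scaler0 ?oppr0.
Qed.

Lemma eta_gen (W : L -> Prop) : (forall j, W (e j)) -> (forall j, W (f j)) ->
  (forall x, W (H x)) -> lin_closed W ->
  (forall x y, W x -> W y -> W (br x y)) -> forall x, W x.
Proof.
move=> We Wf Wh [W0 Wc] Wb; apply: eta_ind => //.
- by move=> x; rewrite eta_h_pure0 ffunE eqxx; exact: Wh.
- by move=> x y Wx Wy; rewrite -[x]scale1r; exact: Wc.
- by move=> c x Wx; rewrite -[_ *: _]addr0; exact: Wc.
Qed.

(** * The action on a module of Verma type *)

Section Action.
Variable lam : 'Hom(h, R^o).

(** [G w] is the coefficient of the product of the [f j] along [w], applied to a highest weight
    vector of weight [lam]; [vac] below is that vector. *)
Definition eta_act (z : eta0 beta gamma) (G : seq 'I_n -> R) : seq 'I_n -> R :=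
  op beta gamma lam (rep z) G.

Lemma eta_act_cls t : eta_act (cls t) = op beta gamma lam t.
Proof. by rewrite /eta_act (op_eq beta_real lam gamma_real (rep_cls beta gamma t)). Qed.

Lemma eta_act_scalar G w : scalar (fun z => eta_act z G w).
Proof.
move=> c; elim/cls_ind=> x; elim/cls_ind=> y.
by rewrite -clsZ -clsD !eta_act_cls.
Qed.

Lemma eta_act_br x y G w :
  eta_act (br x y) G w = eta_act x (eta_act y G) w - eta_act y (eta_act x G) w.
Proof.
elim/cls_ind: x => x; elim/cls_ind: y => y.
by rewrite cls_br !eta_act_cls.
Qed.

Lemma eta_act0 z w : eta_act z (fun=> 0) w = 0.
Proof.
rewrite /eta_act; set G := fun=> 0.
have E := op_lin beta gamma lam (rep z) (-1) G G w.
have GE : (fun w => -1 * G w + G w) = G by apply/funext=> v; rewrite mulr0 addr0.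
by rewrite GE in E; rewrite E mulN1r addNr.
Qed.

Definition vac (w : seq 'I_n) : R := (nilp w)%:R.

Lemma eta_act_f j G w :
  eta_act (f j) G w = if w is k :: w' then (if k == j then G w' else 0) else 0.
Proof. by rewrite eta_act_cls. Qed.

Lemma eta_act_word_vac i w : eta_act (word_br br e i w) vac = fun=> 0.
Proof.
have vac_e k : eta_act (e k) vac = fun=> 0.
  (* [Eop] recurses with [G] restricted to words with a given first letter, so the claim is
     generalized to every [G] vanishing on nonempty words. *)
  suff E (G : seq 'I_n -> R) : (forall j u, G (j :: u) = 0) ->
      forall u, Eop beta gamma lam k G u = 0.
    by rewrite eta_act_cls; apply/funext => u; exact: E.
  move=> G0 u; elim: u G G0 => [|l u IH] G G0 /=; first by rewrite G0 mulr0 addr0.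
  by rewrite G0 mulr0 add0r IH // => j v; rewrite G0.
elim: w i => [|j w IH] i; first exact: vac_e.
apply/funext=> u; rewrite [word_br _ _ _ _]/= eta_act_br IH vac_e !eta_act0.
exact: subrr.
Qed.

Lemma eta_act_word_f_nil i w G : eta_act (word_br br f i w) G [::] = 0.
Proof.
elim: w i G => [|j w IH] i G; first by rewrite [word_br _ _ _ _]/= eta_act_f.
by rewrite [word_br _ _ _ _]/= eta_act_br eta_act_f IH subr0.
Qed.

Lemma eta_act_word_f_letter i w G j :
  eta_act (word_br br f i w) G [:: j] = if nilp w && (i == j) then G [::] else 0.
Proof.
elim: w i G => [|k w IH] i G.
  by rewrite [word_br _ _ _ _]/= eta_act_f eq_sym.
rewrite [word_br _ _ _ _]/= eta_act_br eta_act_f eta_act_word_f_nil if_same IH.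
by rewrite eta_act_f if_same subr0.
Qed.

Lemma eta_act_h x G w : eta_act (H x) G w = wt beta lam w x * G w.
Proof. by rewrite eta_act_cls. Qed.

End Action.

(** Apply [z] to the highest weight vector and read the coefficient of the word [j]: words in [e]
    kill the vector, [H] keeps it in degree zero, and longer words in [f] only produce longer
    words. *)
Lemma eta_f_coef : f_coef br e f H (fun j z => eta_act 0 z vac [:: j]).
Proof.
split=> [i|i j|i j k w|i x|i j w].
- exact: eta_act_scalar.
- by rewrite eta_act_f; case: eqP.
- by rewrite eta_act_word_f_letter.
- by rewrite eta_act_h mulr0.
- by rewrite eta_act_word_vac.
Qed.

Lemma eta_relations_swap :
  eta_relations beta gamma f e (fun x => eta_h beta gamma (- x)).
Proof.
have E := eta_satisfies beta gamma.
have C' := chevalley_swap (@eta0_br_linearl _ _ _ _ beta gamma)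
  (@eta0_brC _ _ _ _ beta gamma) eta_chevalley.
have pN (x : h) : - pure0 r x = pure0 r (- x).
  by apply/ffunP=> m; rewrite !ffunE; case: eqP; rewrite ?oppr0.
have lN z (x : h) : eta_h beta gamma (- lact z (pure0 r x)) =
    lact z (eta_h beta gamma (- pure0 r x)).
  by rewrite -lact_pure0N eta_h_lact pN eta_h_pure0.
have lin : linear (fun x => eta_h beta gamma (- x)).
  by move=> c x y; rewrite opprD -scalerN eta_h_is_linear.
have pairN x j : pairing (beta j) (- x) = - pairing (beta j) x.
  by apply/rowP=> m; rewrite [RHS]mxE !(pairing_coord beta_real) ffunE linearN.
have lactN a (u : cdV L r) : lact (- a) u = - lact a u.
  by rewrite -scaleN1r lactZl scaleN1r.
split.
- split; split=> // z x; rewrite ?lN // ract_pure0 lN.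
  by rewrite pN eta_h_pure0 ract_pure0.
- move=> k j; rewrite eta_bracket_pure0 (chev_ef C').
  case: eqP => _; last by apply/ffunP=> m; rewrite !ffunE if_same.
  rewrite -[pure0 _ _]eta_h_pure0; congr (eta_h _ _ _); apply/ffunP=> m.
  by rewrite !ffunE; case: eqP => [->|/eqP/gamma_real ->]; rewrite ?oppr0.
- by move=> x y; exact: eta_rel_hh E _ _.
- by move=> x j; rewrite (eta_rel_hf E) pairN lactN opprK.
- by move=> x j; rewrite (eta_rel_he E) pairN lactN.
- exact: eta_rel_cdl E.
- exact: eta_rel_cdr E.
Qed.

(** A Chevalley involution, obtained from the universal property of [eta] for the exchanged
    generators. Composed with it, the coefficient functionals of the [f j] become those of the
    [e j]. *)
Lemma eta_swap : exists om : L -> L, [/\ linear om, {morph om : x y / br x y},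
  (forall j, om (e j) = f j), (forall j, om (f j) = e j) &
  forall x, om (H x) = H (- x)].
Proof.
have [p [[[pcd pbr] pe pf ph] _]] := eta_universal r_gt1 eta_relations_swap.
have pI := @pure0_inj R r (eta0 beta gamma).
pose om (x : L) : L := p (pure0 r x) (cdi0 r).
have omE x : p (pure0 r x) = pure0 r (om x) by exact: cd_linear_pure0.
have [[plin _] _] := pcd.
exists om; split.
- by move=> c x y; apply: pI; rewrite -omE !pure0_is_linear plin !omE.
- move=> x y; apply: pI.
  by rewrite -omE -!eta_bracket_pure0 [LHS]pbr !omE.
- by move=> j; apply: pI; rewrite -omE pe.
- by move=> j; apply: pI; rewrite -omE pf.
- move=> x; apply: pI; rewrite -omE -[pure0 r (H x)]eta_h_pure0 ph.
  rewrite -[pure0 r (H (- x))]eta_h_pure0; congr (eta_h _ _ _).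
  by apply/ffunP=> m; rewrite !ffunE; case: eqP; rewrite ?oppr0.
Qed.

Lemma eta_coefs : exists cf ce : 'I_n -> L -> R,
  f_coef br e f H cf /\ f_coef br f e (fun x => H (- x)) ce.
Proof.
have [om [lom mom oe of_ oh]] := eta_swap; have F := eta_f_coef.
pose cf j z := eta_act 0 z vac [:: j].
exists cf, (fun j z => cf j (om z)); split=> //.
have owe i w : om (word_br br e i w) = word_br br f i w.
  by elim: w i => [|j w IH] i; rewrite [LHS]/= ?oe // mom IH oe.
have owf i w : om (word_br br f i w) = word_br br e i w.
  by elim: w i => [|j w IH] i; rewrite [LHS]/= ?of_ // mom IH of_.
split=> [i c x y|i j|i j k w|i x|i j w].
- by rewrite lom; exact: (fc_scalar F).
- by rewrite oe; exact: (fc_f F).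
- by rewrite owe; exact: (fc_ff F).
- by rewrite oh; exact: (fc_h F).
- by rewrite owf; exact: (fc_e F).
Qed.

Lemma eta_form (d : 'I_n -> R) (S : h -> 'Hom(h, R^o)) :
  (forall i j, d i * al i (g j) = d j * al j (g i)) ->
  (forall x y, S x y = S y x) -> (forall x j, S x (g j) = d j * al j x) ->
  exists B : L -> L -> R,
  [/\ (forall y, scalar (B y)) /\ (forall y, scalar (B^~ y)),
      forall x y, B x y = B y x,
      forall x y z, B (br x y) z = B x (br y z) &
      forall x y, B (H x) (H y) = S x y].
Proof.
move=> dsym SC Sg; have [cf [ce [Fc Ec]]] := eta_coefs.
(* [Q x] is the coefficient of the highest weight vector in its image under [z], for the highest
   weight [S x]: [H y] contributes [S x y], and words contribute nothing. *)
apply: (invariant_form (@eta0_br_linearl _ _ _ _ beta gamma)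
  (@eta0_br_linearr _ _ _ _ beta gamma) (@eta0_brC _ _ _ _ beta gamma)
  (@eta0_jacobi _ _ _ _ beta gamma) (h := h) (beta := al) (gamma := g) (d := d)
  (S := fun x y => S x y) (Q := fun x z => eta_act (S x) z vac [::]) _ dsym
  eta_chevalley Fc Ec eta_gen) => //.
- move=> j c x y; rewrite /al linearP.  by [].
- move=> x c u v; rewrite linearP. by [].

- by move=> x; exact: eta_act_scalar.
- by move=> x y; rewrite eta_act_h mulr1.
- by move=> x i w; rewrite eta_act_word_vac.
- by move=> x i w; rewrite eta_act_word_f_nil.
Qed.

End EtaCoef.

(** * Subspaces and real independence *)

Section Subspace.
Variables (R : realType) (r : nat).
Implicit Type V : lmodType R.

Lemma pure0Z V c (x : V) : pure0 r (c *: x) = c *: pure0 r x.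
Proof. by apply/ffunP=> m; rewrite !ffunE; case: eqP; rewrite ?scaler0. Qed.

Lemma pure0_0 V : pure0 r (0 : V) = 0.
Proof. by apply/ffunP=> m; rewrite !ffunE if_same. Qed.

Lemma lact_real V c (x : cdV V r) : lact (c *: cdgen R (cdi0 r)) x = c *: x.
Proof.
rewrite lactZl; congr (_ *: _); apply/ffunP=> m; rewrite ffunE (bigD1 m) //=.
rewrite cdmul1l mxE !eqxx scale1r big1 ?addr0 // => s sm.
by rewrite cdmul1l mxE eq_sym (negPf sm) andbF scale0r.
Qed.

Lemma ract_real V c (x : cdV V r) : ract x (c *: cdgen R (cdi0 r)) = c *: x.
Proof.
apply/ffunP=> m; rewrite !ffunE (bigD1 m) //= cdmulZr cdmul1r !mxE !eqxx mulr1.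
rewrite big1 ?addr0 // => s sm.
by rewrite cdmulZr cdmul1r !mxE eq_sym (negPf sm) andbF mulr0 scale0r.
Qed.

Lemma lact_linear V a : linear (@lact R r V a).
Proof.
move=> c x y; rewrite lactD; congr (_ + _); apply/ffunP=> m.
rewrite !ffunE scaler_sumr; apply: eq_bigr => s _.
by rewrite ffunE !scalerA mulrC.
Qed.

Lemma ract_linear V a : linear (fun x : cdV V r => ract x a).
Proof.
move=> c x y; rewrite ractD; congr (_ + _); apply/ffunP=> m.
rewrite !ffunE scaler_sumr; apply: eq_bigr => s _.
by rewrite ffunE !scalerA mulrC.
Qed.

Lemma cdsubspaceZ V (W : set (cdV V r)) c x : cdsubspace W -> W x -> W (c *: x).
Proof. by case=> _ _ Wl _ Wx; rewrite -lact_real; exact: Wl. Qed.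

Hypothesis r23 : r = 2%N \/ r = 3%N.

Let r_gt1 : (1 < r)%N. Proof. by case: r23 => ->. Qed.

(** The sign separates the span of [1] and [i_t] from the other generators, so two-sided
    multiplication can isolate coordinates. *)
Lemma cdgen_sandwich (t s : 'I_(cddim r)) : t != cdi0 r ->
  cdmul (cdgen R t) (cdmul (cdgen R s) (cdgen R t)) =
  (-1) ^+ ((s == cdi0 r) || (s == t)) *: cdgen R s.
Proof.
move=> t0; have norm1 : cdnorm (cdgen R t) = 1.
  rewrite /cdnorm (bigD1 t) //= mxE !eqxx expr1n big1 ?addr0 // => k kt.
  by rewrite mxE (negPf kt) andbF expr0n.
have tt x : cdmul (cdgen R t) (cdmul (cdgen R t) x) = - x.
  have := cdconj_mulA (cdgen R t) x r23.
by rewrite norm1 scale1r cdconj_gen t0 sgnT cdmulNl => /eqP; rewrite eqr_oppLR => /eqP.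
rewrite cdmul_genC cdmulZr tt scalerN /chi t0 /=.
have [_|s0] := eqVneq s (cdi0 r); first by rewrite sgnF sgnT.
by have [_|st] := eqVneq s t; rewrite ?sgnF ?sgnT ?opprK.
Qed.

(** The map [pr t] doubles the coordinates at [1] and [i_t] and kills all others. Two such maps with
    distinct imaginary units leave only the coordinate at [1], multiplied by 4. *)
Lemma cdsubspace_pure0 V (W : set (cdV V r)) x s :
  cdsubspace W -> W x -> W (pure0 r (x s)).
Proof.
move=> Ws; have [W0 WD Wl Wr] := Ws.
pose pr t (y : cdV V r) := y - lact (cdgen R t) (ract y (cdgen R t)).
have Wpr t y : W y -> W (pr t y).
  move=> Wy; apply: WD => //; rewrite -scaleN1r; apply: cdsubspaceZ => //.
  by apply: Wl; apply: Wr.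
have prE t y m : t != cdi0 r ->
    pr t y m = if (m == cdi0 r) || (m == t) then 2 *: y m else 0.
  move=> t0; rewrite /pr.
  have -> : lact (cdgen R t) (ract y (cdgen R t)) =
      \sum_s (-1) ^+ ((s == cdi0 r) || (s == t)) *: pure s (y s).
    rewrite {1}(pure_sum y) (linear_sum_of _ (ract_linear _)).
    rewrite (linear_sum_of _ (lact_linear _)).
    apply: eq_bigr => s' _; rewrite pureE ractA_pure0 lactA_pure0.
    by rewrite cdgen_sandwich // lactZl.
  rewrite !ffunE sum_ffunE (bigD1 m) //= big1 => [|s' sm]; last first.
    by rewrite !ffunE [m == _]eq_sym (negPf sm) scaler0.
  rewrite !ffunE eqxx addr0; case: ifP => _.
    by rewrite sgnT opprK -mulr2n scaler_nat.
  by rewrite sgnF subrr.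
have W00 y : W y -> W (pure0 r (y (cdi0 r))).
  have [t [u [t0 u0 tu]]] : exists t u, [/\ t != cdi0 r, u != cdi0 r & t != u].
    have c2 : (2 < cddim r)%N by rewrite cddimE; case: r23 => ->.
    exists (Ordinal (ltnW c2)), (Ordinal c2).
    by split; apply/eqP => /(congr1 val) //=; rewrite val_cdi0.
  move=> Wy; have -> : pure0 r (y (cdi0 r)) = 4^-1 *: pr t (pr u y).
    apply/ffunP=> m; rewrite [RHS]ffunE !prE // ffunE; have [->|m0] := eqVneq m (cdi0 r).
      by rewrite /= !scalerA -{1}[y _]scale1r; congr (_ *: _); field.
    by have [->|] := eqVneq m t; rewrite /= ?(negPf tu) ?scaler0.
  by apply: cdsubspaceZ => //; apply: (Wpr); exact: Wpr.
(* Multiplication by [i_s] brings the coordinate [s] to the place of [1], up to a sign removed at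
   the end. *)
move=> Wx; have := W00 _ (Wl (cdgen R s) _ Wx); rewrite ffunE.
rewrite (bigD1 s) //= big1 => [|u us]; last first.
  have [b ->] := cdmul_gen R s u; rewrite !mxE -(cdidxx s).
  by rewrite (inj_eq (can_inj (cdidxK s))) eq_sym (negPf us) andbF mulr0 scale0r.
have [b ->] := cdmul_gen R s s; rewrite addr0 cdidxx !mxE !eqxx mulr1 pure0Z.
move/(cdsubspaceZ ((-1) ^+ b) Ws).
by rewrite scalerA -expr2 sqrr_sign scale1r.
Qed.

End Subspace.

(** * Independence and rank over the reals and over the Cayley-Dickson algebra *)

Section RealIndependence.
Variables (R : realType) (r n : nat).

Lemma pure0_indep (V : lmodType R) (v : 'I_n -> V) (c : 'I_n -> R) :
  vector_independent [set: 'I_n] (fun j => pure0 r (v j)) ->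
  \sum_j c j *: v j = 0 -> forall j, c j = 0.
Proof.
move=> ind cv j; apply/eqP; apply: contraT => cj.
pose cj' k := c k *: cdgen R (cdi0 r).
have /(ind cj' (fun=> cdgen R (cdi0 r)) xpred0)/eqP[] : exists2 j, j \in [set: 'I_n] &
    (cj' j != 0) && (cdgen R (cdi0 r) != 0).
  by exists j; rewrite ?finset.in_setT // scaler_eq0 negb_or cj !cdgen_neq0.
rewrite -[RHS](pure0_0 r V) -cv (linear_sum_of _ (@pure0_is_linear _ _ _)).
apply: eq_big => [k|k _]; first by rewrite finset.inE.
by rewrite /triple lact_real -[cdgen _ _]scale1r ract_real scale1r pure0Z.
Qed.

(** On a real row either bracketing of [a v b] is [(a b) v], and [a b] is nonzero. So a relation
    over the algebra among a maximal free family of real rows would give, coordinate by coordinate,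
    real relations among them. *)
Lemma rank_le_cdrank (A : 'M[cd R r]_n) (AR : 'M[R]_n) :
  r = 2%N \/ r = 3%N -> (forall k j, A k j = AR k j *: cdgen R (cdi0 r)) ->
  (\rank AR <= cdrank A)%N.
Proof.
move=> r23 AE; pose f := maxrankfun AR; pose J := [set f i | i : 'I_(\rank AR)].
have fI : injective f := maxrankfun_inj (A := AR).
have <- : #|J| = \rank AR by rewrite card_imset // card_ord.
apply: (@leq_bigmax_cond _ (fun J : {set 'I_n} =>
  `[< vector_independent J (cdrow A) >]) (fun J => #|J|)).
apply/asboolP => a b p [j0 j0J /andP[a0 b0]]; apply/eqP => sum0.
have rowE j : cdrow A j = pure0 r (row j AR).
  apply/ffunP=> s; rewrite !ffunE; apply/rowP=> k; rewrite !mxE AE !mxE eqxx /=.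
  by case: eqP => _; rewrite !mxE ?mulr1 ?mulr0.
have tripleE j : triple (p j) (a j) (cdrow A j) (b j) =
    lact (cdmul (a j) (b j)) (pure0 r (row j AR)).
  rewrite rowE /triple; case: (p j); first by rewrite ractA_pure0.
  by rewrite ract_pure0 lactA_pure0.
have /eqP[] := cdmul_neq0 r23 a0 b0; apply/rowP=> m; rewrite mxE.
have [i0 _ ->] := imsetP j0J.
pose u := \row_i cdmul (a (f i)) (b (f i)) 0 m.
suff /rowP/(_ i0) : u = 0 by rewrite !mxE.
apply: (row_free_inj (maxrowsub_free AR)); rewrite mul0mx mulmx_sum_row.
move/ffunP/(_ m): sum0; rewrite sum_ffunE ffunE big_imset /=; last exact: in2W.
move=> E; rewrite -[RHS]E; apply: eq_big => // i _.
rewrite tripleE lact_pure0E ffunE mxE.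
by rewrite row_rowsub.
Qed.

End RealIndependence.

(** * The form on the Cartan subalgebra *)

Section CartanForm.
Import VectorInternalTheory.
Variables (R : realType) (n : nat) (h : vectType R).
Variables (al : 'I_n -> 'Hom(h, R^o)) (g : 'I_n -> h) (A : 'M[R]_n).
Hypothesis al_free : forall c : 'I_n -> R, \sum_j c j *: al j = 0 -> forall j, c j = 0.
Hypothesis g_free : forall c : 'I_n -> R, \sum_j c j *: g j = 0 -> forall j, c j = 0.
Hypothesis A_E : forall k j, A k j = al j (g k).

Let m := dim h.
Let G : 'M[R]_(n, m) := \matrix_j v2r (g j).
Let Bt : 'M[R]_(m, n) := \matrix_(i, j) al j (r2v (delta_mx 0 i)).

Let mulG (c : 'rV_n) : c *m G = v2r (\sum_j c 0 j *: g j).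
Proof.
rewrite mulmx_sum_row linear_sum; apply: eq_bigr => j _.
by rewrite rowK linearZ.
Qed.

Let mulBt (x : h) : v2r x *m Bt = \row_j al j x.
Proof.
apply/rowP=> j; rewrite !mxE -[in RHS](v2rK x) [in RHS](row_sum_delta (v2r x)).
rewrite !linear_sum; apply: eq_bigr => i _.
by rewrite mxE !linearZ.
Qed.

Let G_free : row_free G.
Proof.
apply: inj_row_free => c; rewrite mulG => E.
have c0 : \sum_j c 0 j *: g j = 0 by rewrite -[LHS]v2rK E linear0.
by apply/rowP=> j; rewrite mxE (g_free c0).
Qed.

Let Bt_rank : \rank Bt = n.
Proof.
rewrite -mxrank_tr; apply/eqP/inj_row_free => c cB.
apply/rowP=> j; rewrite mxE; apply: (al_free (c := fun j => c 0 j)).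
apply/lfunP=> x; rewrite sum_lfunE zero_lfunE.
have := congr1 (fun M => (v2r x *m M^T) 0 0) cB.
rewrite trmx_mul trmxK mulmxA mulBt trmx0 mulmx0 !mxE => E; rewrite -[RHS]E.
by apply: eq_bigr => k _; rewrite !mxE scale_lfunE mulrC.
Qed.

Lemma dual_vector (v : 'I_n -> R) : exists x, forall j, al j x = v j.
Proof.
have /row_fullP [M MB] : row_full Bt by rewrite /row_full Bt_rank.
pose x : h := @r2v _ h (\row_j v j *m M).
exists x => j; have := mulBt x; rewrite r2vK -mulmxA MB mulmx1.
by move/rowP/(_ j); rewrite !mxE.
Qed.

(** The combinations of the [g j] with coefficients in the kernel of [A] are killed by all [al j].
    They form a space of dimension [n - \rank A], while the common kernel of the [al j] has
    dimension [m - n], which is no larger by hypothesis; so the two spaces agree. *)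
Lemma center_in_span (x : h) : (\dim {:h} + \rank A <= n + n)%N ->
  (forall j, al j x = 0) -> exists c : 'I_n -> R, x = \sum_j c j *: g j.
Proof.
rewrite dimvf => dimA xal; have GB : G *m Bt = A.
  apply/row_matrixP => k; rewrite row_mul rowK mulBt.
  by apply/rowP=> j; rewrite !mxE A_E.
have sub : (kermx A *m G <= kermx Bt)%MS.
  by apply/sub_kermxP; rewrite -mulmxA GB mulmx_ker.
have [_ eqk] := mxrank_leqif_sup sub.
have kerle : (kermx Bt <= kermx A *m G)%MS.
  rewrite -eqk eqn_leq mxrankS //= mxrankMfree // !mxrank_ker Bt_rank.
  by move: dimA (rank_leq_row A); rewrite -/m; lia.
have : (v2r x <= G)%MS.
  apply: submx_trans (submxMl (kermx A) G); apply: submx_trans kerle.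
  by apply/sub_kermxP; rewrite mulBt; apply/rowP=> j; rewrite !mxE.
case/submxP=> c; rewrite mulG => /(congr1 r2v); rewrite !v2rK => ->.
by exists (fun j => c 0 j).
Qed.

Variables (d : 'I_n -> R) (W : h -> Prop).
Hypothesis d_neq0 : forall j, d j != 0.
Hypothesis d_sym : forall i j, d i * al i (g j) = d j * al j (g i).
Hypothesis dimA : (\dim {:h} + \rank A <= n + n)%N.
Hypothesis W_lin : lin_closed W.
Hypothesis W_g : forall c : 'I_n -> R, W (\sum_j c j *: g j) -> forall j, c j = 0.
Hypothesis W_split : forall x, exists (c : 'I_n -> R) (y : h),
  W y /\ x = \sum_j c j *: g j + y.

(** Coordinates along the [g j] parallel to [W]; uniqueness of the decomposition makes the chosen
    coefficients linear. *)
Let coord_functional : exists c : 'I_n -> 'Hom(h, R^o),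
  [/\ forall j k, c j (g k) = (j == k)%:R, forall j y, W y -> c j y = 0 &
      forall x, exists2 y, W y & x = \sum_j c j x *: g j + y].
Proof.
have [W0 Wc] := W_lin.
pose c x : 'I_n -> R := projT1 (cid (W_split x)).
have cP x : exists2 y, W y & x = \sum_j c x j *: g j + y.
  by rewrite /c; case: cid => /= c' [y [Wy ->]]; exists y.
have cU x c' y : W y -> x = \sum_j c' j *: g j + y -> forall j, c x j = c' j.
  move=> Wy xE j; have [z Wz xE'] := cP x; apply/eqP; rewrite -subr_eq0; apply/eqP.
  apply: (W_g (c := fun j => c x j - c' j)).
  have -> : \sum_j (c x j - c' j) *: g j = -1 *: z + y.
    under eq_bigr do rewrite scalerBl.
    rewrite sumrB; apply/eqP; rewrite subr_eq scaleN1r addrAC -addrA -xE addrC.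
    by rewrite eq_sym subr_eq -xE'.
  exact: Wc.
have clin j : linear (fun x => c x j : R^o).
  move=> a x y; have [x' Wx xE] := cP x; have [y' Wy yE] := cP y.
  apply: (cU _ (fun j => a * c x j + c y j) (a *: x' + y')); first exact: Wc.
  rewrite [in LHS]xE [in LHS]yE scalerDr scaler_sumr addrACA -big_split /=.
  by congr (_ + _); apply: eq_bigr => i _; rewrite scalerA scalerDl.
pose cl j := HB.pack_for {linear h -> R^o} (fun x => c x j : R^o)
  (GRing.isLinear.Build _ _ _ _ _ (clin j)).
have clE j x : linfun (cl j) x = c x j by rewrite lfunE.
exists (fun j => linfun (cl j)); split=> [j k|j y Wy|x].
- rewrite clE (cU _ (fun j => (j == k)%:R) 0) // addr0 (bigD1 k) //= eqxx scale1r.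
  by rewrite big1 ?addr0 // => i /negPf ->; rewrite scale0r.
- rewrite clE (cU _ (fun=> 0) y) // big1 ?add0r // => i _; exact: scale0r.
- have [y Wy xE] := cP x; exists y => //; rewrite [LHS]xE.
  by congr (_ + _); apply: eq_bigr => j _; rewrite clE.
Qed.

(** For non-degeneracy, [S x = 0] gives [al j x = 0] for all [j], so [x] is a combination of the
    [g j]; then [S x] is a combination of the independent [al j] with coefficients [d j * b j]. *)
Lemma cartan_form : exists S : h -> 'Hom(h, R^o),
  [/\ linear S, forall x y, S x y = S y x,
      forall x j, S x (g j) = d j * al j x,
      forall x y, W x -> W y -> S x y = 0 &
      forall x, S x = 0 -> x = 0].
Proof.
have [c [cg cW cP]] := coord_functional.
(* The first sum pairs the [g]-part of [x] with [y], the second pairs [x] with the [g]-part of [y],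
   and the last removes the pairing of the two [g]-parts, counted twice. Nothing is left on [W]. *)
pose S x : 'Hom(h, R^o) := \sum_j (d j * c j x) *: al j + \sum_j (d j * al j x) *: c j
  - \sum_j \sum_k (c j x * (d j * al j (g k))) *: c k.
have SE x y : S x y = \sum_j (d j * c j x) * al j y + \sum_j (d j * al j x) * c j y
  - \sum_j \sum_k (c j x * (d j * al j (g k))) * c k y.
  rewrite /S add_lfunE opp_lfunE add_lfunE !sum_lfunE.
  congr (_ + _ - _); apply: eq_bigr => j _; rewrite ?scale_lfunE //.
  by rewrite sum_lfunE; apply: eq_bigr => k _; rewrite scale_lfunE.
have SC x y : S x y = S y x.
  rewrite !SE [X in X - _ = _]addrC; congr (_ + _ - _).
  - by apply: eq_bigr => j _; ring.
  - by apply: eq_bigr => j _; ring.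
  - rewrite exchange_big; apply: eq_bigr => j _; apply: eq_bigr => k _.
    by rewrite d_sym; ring.
have Sg x j : S x (g j) = d j * al j x.
  have pick (F : 'I_n -> R) : \sum_k F k * c k (g j) = F j.
    rewrite (bigD1 j) //= cg eqxx mulr1 big1 ?addr0 // => k /negPf kj.
    by rewrite cg kj mulr0.
  rewrite SE pick addrAC -[RHS]add0r; congr (_ + _); apply/eqP; rewrite subr_eq0.
  by apply/eqP/eq_bigr => k _; rewrite pick; ring.
clearbody S; exists S; split=> //.
- move=> a x y; apply/lfunP=> z; rewrite add_lfunE scale_lfunE.
  by rewrite ![S _ z]SC linearP.
- move=> x y Wx Wy; rewrite SE !big1 ?addr0 ?subr0 // => j _.
  + by rewrite big1 // => k _; rewrite (cW k) // mulr0.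
  + by rewrite cW // mulr0.
  + by rewrite cW // mulr0 mul0r.
- move=> x Sx; have alx j : al j x = 0.
    have := Sg x j; rewrite Sx zero_lfunE => /esym/eqP.
    by rewrite mulf_eq0 (negPf (d_neq0 j)) => /eqP.
  have [b xE] := center_in_span dimA alx; rewrite xE.
  have b0 : forall j, d j * b j = 0.
    apply: (al_free (c := fun j => d j * b j)); rewrite -[RHS]Sx xE.
    apply/lfunP=> y; rewrite SC linear_sum sum_lfunE; apply: eq_bigr => j _.
    by rewrite linearZ /= Sg scale_lfunE /GRing.scale /=; ring.
  rewrite big1 // => j _; have /eqP := b0 j.
  by rewrite mulf_eq0 (negPf (d_neq0 j)) => /eqP ->; rewrite scale0r.
Qed.

Lemma injective_dual_onto (S : h -> 'Hom(h, R^o)) : linear S ->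
  (forall x, S x = 0 -> x = 0) -> forall phi, exists x, S x = phi.
Proof.
move=> Sl S0 phi.
pose s := HB.pack_for {linear h -> 'Hom(h, R^o)} S
  (GRing.isLinear.Build _ _ _ _ S Sl).
pose f := linfun s.
have kf : lker f == 0%VS.
  apply/eqP/vspaceP=> x; rewrite memv_ker memv0 lfunE /=.
  by apply/eqP/eqP => [/S0|->] //; exact: (linear0 s).
have : limg f = fullv.
  apply/eqP; rewrite eqEdim subvf /= limg_dim_eq ?(eqP kf) ?capv0 //.
  by rewrite !dimvf -[X in (_ <= X)%N]muln1; exact: leqnn.
move=> /vspaceP/(_ phi); rewrite memvf => /memv_imgP[x _ ->].
by exists x; rewrite lfunE.
Qed.

End CartanForm.

(** * Real Cartan data extracted from a realization *)

Section CartanData.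
Variables (R : realType) (r n : nat) (A B : 'M[cd R r]_n) (d : 'I_n -> R).
Variables (h : vectType R) (beta : 'I_n -> cddual R h r) (gamma : 'I_n -> cdV h r).
Variable h2 : set (cdV h r).
Hypothesis r23 : r = 2%N \/ r = 3%N.
Hypothesis AdB : symmetrizable_by A d B.
Hypothesis Areal : realization A beta gamma.
Hypothesis gamma_inj : injective (eta_h beta gamma).
Hypothesis h2_sub : cdsubspace h2.
Hypothesis h2_compl : complementary (cdspan (range gamma)) h2.

Definition real_root j : 'Hom(h, R^o) := beta j (cdi0 r).
Definition real_coroot j : h := gamma j (cdi0 r).
Notation al := real_root.
Notation g := real_coroot.

Lemma beta_real j (y : h) : cdreal (ev (beta j) (pure0 r y)).
Proof. exact: realization_real Areal j y. Qed.

Lemma beta_pure0 j : beta j = pure0 r (al j).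
Proof.
apply/ffunP=> k; rewrite ffunE; case: eqP => [-> //|/eqP k0].
apply/lfunP=> y; have [c] := beta_real j y; rewrite ev_pure0.
move=> /rowP/(_ k); rewrite !mxE (negPf k0) andbF mulr0 => ->.
by rewrite lfunE.
Qed.

Lemma gamma_pure0 j : gamma j = pure0 r (g j).
Proof.
have [y yE] := (eta_h_injP gamma beta_real).1 gamma_inj j.
by rewrite /real_coroot yE ffunE eqxx.
Qed.

Lemma gamma_real j m : m != cdi0 r -> gamma j m = 0.
Proof. by rewrite gamma_pure0 ffunE => /negPf ->. Qed.

Let al_free (c : 'I_n -> R) : \sum_j c j *: al j = 0 -> forall j, c j = 0.
Proof.
apply: (@pure0_indep _ r); have := realization_indep_beta Areal.
by have -> : beta = (fun j => pure0 r (al j)) by apply/funext => j; exact: beta_pure0.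
Qed.

Let g_free (c : 'I_n -> R) : \sum_j c j *: g j = 0 -> forall j, c j = 0.
Proof.
apply: (@pure0_indep _ r); have := realization_indep_gamma Areal.
by have -> : gamma = (fun j => pure0 r (g j)) by apply/funext => j; exact: gamma_pure0.
Qed.

Let AE k j : A k j = al j (g k) *: cdgen R (cdi0 r).
Proof.
rewrite -(realization_entry Areal) gamma_pure0 ev_pure0; apply/rowP=> m.
rewrite !mxE eqxx beta_pure0 ffunE; case: eqP => _; rewrite ?mulr1 // mulr0.
by rewrite lfunE.
Qed.

Lemma root_coroot_sym i j : d i * al i (g j) = d j * al j (g i).
Proof.
have [_ BT AB] := AdB.
have E k l : al l (g k) = d k * B k l 0 (cdi0 r).
  by have /rowP/(_ (cdi0 r)) := AB k l; rewrite AE !mxE !eqxx mulr1.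
by rewrite !E -{1}BT mxE; ring.
Qed.

Let dimA : (\dim {:h} + \rank (\matrix_(k, j) al j (g k)) <= n + n)%N.
Proof.
have : (\rank (\matrix_(k, j) al j (g k)) <= cdrank A)%N.
  by apply: rank_le_cdrank => // k j; rewrite AE mxE.
have := realization_dim Areal; lia.
Qed.

Let g_span c : cdspan (range gamma) (pure0 r (\sum_j c j *: g j)).
Proof.
move=> W Ws sW; rewrite (linear_sum_of _ (@pure0_is_linear _ _ _)).
elim/big_rec: _ => [|j x _ Wx]; first by case: Ws.
rewrite pure0Z; have [_ WD _ _] := Ws; apply: WD => //.
apply: cdsubspaceZ => //; apply: sW; exists j => //; exact: gamma_pure0.
Qed.

Let span_coord (x : cdV h r) s : cdspan (range gamma) x ->
  exists c : 'I_n -> R, x s = \sum_j c j *: g j.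
Proof.
have scD (I : finType) (F : I -> R) (G : I -> h) :
    (forall i, exists c : 'I_n -> R, G i = \sum_j c j *: g j) ->
    exists c : 'I_n -> R, \sum_i F i *: G i = \sum_j c j *: g j.
  move=> /choice[c cE]; exists (fun j => \sum_i F i * c i j).
  under eq_bigr do rewrite cE scaler_sumr.
  rewrite exchange_big; apply: eq_bigr => j _; rewrite scaler_suml.
  by apply: eq_bigr => i _; rewrite scalerA.
move=> xs; apply: (xs [set x : cdV h r | forall s, exists c : 'I_n -> R,
    x s = \sum_j c j *: g j]%classic) => [|_ [j _ <-] t]; last first.
  rewrite gamma_pure0 ffunE; case: eqP => _.
    exists (fun k => (k == j)%:R); rewrite (bigD1 j) //= eqxx scale1r big1 ?addr0 //.
    by move=> k /negPf ->; rewrite scale0r.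
  by exists (fun=> 0); rewrite big1 // => k _; rewrite scale0r.
split=> [t|x' y' xE yE t|a x' xE t|a x' xE t].
- by exists (fun=> 0); rewrite ffunE big1 // => k _; rewrite scale0r.
- have [[b bE] [c cE]] := (xE t, yE t); exists (fun j => b j + c j).
  rewrite ffunE bE cE -big_split /=.
  by apply: eq_bigr => j _; rewrite scalerDl.
- by rewrite ffunE; exact: scD.
- by rewrite ffunE; exact: scD.
Qed.

Lemma cartan_data : exists (S : h -> 'Hom(h, R^o)) (x0 : h),
  [/\ linear S, forall x y, S x y = S y x,
      forall x j, S x (g j) = d j * al j x,
      forall x y, h2 (pure0 r x) -> h2 (pure0 r y) -> S x y = 0 &
      forall x, S x = 0 -> x = 0] /\ forall j, al j x0 = 1.
Proof.
have [d0 _ _] := AdB; have [h20 h2D _ _] := h2_sub.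
have [x0 x01] := dual_vector al_free (fun=> 1).
have [|||x|S Sp] := cartan_form (A := \matrix_(k, j) al j (g k)) al_free g_free _ d0
  root_coroot_sym dimA (W := fun y => h2 (pure0 r y)).
- by move=> k j; rewrite mxE.
- split=> [|c x y Wx Wy]; first by rewrite pure0_0.
  by rewrite pure0_is_linear; apply: h2D => //; exact: cdsubspaceZ.
- move=> c Wc; apply: g_free; apply: (@pure0_inj R r h); rewrite pure0_0.
  by apply: h2_compl.1 => //; exact: g_span.
(* Only the coordinate at [1] of the decomposition is kept; [cdsubspace_pure0] keeps it in [h2]. *)
- have [y [z [ys zh xE]]] := h2_compl.2 (pure0 r x).
  have [c cE] := span_coord (cdi0 r) ys; exists c, (z (cdi0 r)); split.
    exact: cdsubspace_pure0.
  by move/ffunP/(_ (cdi0 r)): xE; rewrite !ffunE eqxx cE.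
- by exists S, x0.
Qed.

End CartanData.

(** * Extension of scalars of forms *)

Section ExtendForm.
Variables (R : realType) (r : nat) (V : lmodType R) (B : V -> V -> R).

Definition extform (x y : cdV V r) : cd R r :=
  \sum_s \sum_t B (x s) (y t) *: cdmul (cdgen R s) (cdgen R t).

Lemma extform0 (x y : cdV V r) : (forall s t, B (x s) (y t) = 0) -> extform x y = 0.
Proof.
by move=> E; rewrite /extform big1 // => s _; rewrite big1 // => t _; rewrite E scale0r.
Qed.

Hypothesis Br : forall y, scalar (B y).
Hypothesis Bl : forall y, scalar (B^~ y).

Lemma extform_linearl y : linear (extform^~ y).
Proof.
move=> c x x'; rewrite /extform scaler_sumr -big_split; apply: eq_bigr => s _.
rewrite scaler_sumr -big_split; apply: eq_bigr => t _ /=.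
by rewrite !ffunE [B _ _]Bl scalerDl scalerA.
Qed.

Lemma extform_linearr x : linear (extform x).
Proof.
move=> c y y'; rewrite /extform scaler_sumr -big_split; apply: eq_bigr => s _.
rewrite scaler_sumr -big_split; apply: eq_bigr => t _ /=.
by rewrite !ffunE Br scalerDl scalerA.
Qed.

Lemma extform_pure k j x y :
  extform (pure k x) (pure j y) = B x y *: cdmul (cdgen R k) (cdgen R j).
Proof.
rewrite /extform (bigD1 k) //= [X in _ + X]big1 ?addr0 => [|s /negPf sk]; last first.
  by rewrite big1 // => t _; rewrite !ffunE sk (functional0 (Bl _)) scale0r.
rewrite (bigD1 j) //= big1 ?addr0 => [|t /negPf tj]; first by rewrite !ffunE !eqxx.
by rewrite !ffunE tj (functional0 (Br _)) scale0r.
Qed.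

Lemma extform_pure0l x y : extform (pure0 r x) y = \row_t B x (y t).
Proof.
rewrite {1}(pure_sum y) (linear_sum_of _ (extform_linearr _)) [RHS]row_sum_delta.
by apply: eq_bigr => t _; rewrite extform_pure cdmul1l mxE.
Qed.

Lemma extform_pure0r x y : extform x (pure0 r y) = \row_s B (x s) y.
Proof.
rewrite {1}(pure_sum x) (linear_sum_of _ (extform_linearl _)) [RHS]row_sum_delta.
by apply: eq_bigr => t _; rewrite extform_pure cdmul1r mxE.
Qed.

Lemma extform_lact a b x y :
  extform (lact a (pure0 r x)) (lact b (pure0 r y)) = B x y *: cdmul a b.
Proof.
rewrite !lact_pure0E cdmul_sum_genl scaler_sumr; apply: eq_bigr => s _.
rewrite [cdmul _ b]cdmul_sum_genr !scaler_sumr; apply: eq_bigr => t _.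
rewrite !ffunE (functionalZ _ _ (Br _)) (functionalZ _ _ (Bl _)) !scalerA.
by congr (_ *: _); ring.
Qed.

Lemma extform_form_linear : form_linear extform.
Proof.
split=> [y|x].
  split=> [|z x]; first exact: extform_linearl.
  rewrite (pure_sum y) !(linear_sum_of _ (extform_linearr _)) cdmul_sumr.
  apply: eq_bigr => t _; rewrite pureE extform_lact pure0E extform_lact.
  by rewrite cdmulZr cdmul1l.
split=> [|z y]; first exact: extform_linearr.
rewrite ract_pure0 (pure_sum x) !(linear_sum_of _ (extform_linearl _)) cdmul_suml.
apply: eq_bigr => t _; rewrite pureE extform_lact (pure0E _ y) extform_lact.
by rewrite cdmulZl cdmul1r.
Qed.

Lemma extform_symmetric : (forall x y, B x y = B y x) -> form_symmetric extform.
Proof.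
move=> BC k j x y; rewrite !extform_pure BC cdmul_genC.
by rewrite !scalerA mulrC.
Qed.

(** Pairing with a real vector [v] displays the values of [B] at [v] on all coordinates at once, so
    real test vectors from [Q] suffice. *)
Lemma extform_nondegenerate (P : set (cdV V r)) (Q : V -> Prop) :
  (forall x y, B x y = B y x) ->
  (forall x, P x -> forall s, (forall v, Q v -> B (x s) v = 0) -> x s = 0) ->
  (forall v, Q v -> P (pure0 r v)) -> nondegenerate_on extform P.
Proof.
move=> BC nd QP; split=> [x Px x0|y Py y0]; apply/ffunP=> s; rewrite ffunE.
  apply: nd => // v /QP/x0; rewrite extform_pure0r => /rowP/(_ s).
  by rewrite !mxE.
apply: nd => // v /QP/y0; rewrite extform_pure0l BC => /rowP/(_ s).
by rewrite !mxE.
Qed.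

End ExtendForm.

(** * The quotient by [tau] *)

Section QuotientReal.
Variables (R : realType) (r n : nat) (h : vectType R).
Variables (beta : 'I_n -> cddual R h r) (gamma : 'I_n -> cdV h r).
Variables (tau : set (cdV (lie0 (eta beta gamma)) r)) (g : lieCD R r).
Variable p : cdV (lie0 (eta beta gamma)) r -> cdV (lie0 g) r.
Hypothesis r_gt1 : (1 < r)%N.
Hypothesis pq : lie_quotient tau p.

Notation L := (lie0 (eta beta gamma)).
Notation M := (lie0 g).
Notation br := (@eta0_br R r n h beta gamma).
Notation H := (@eta_th R r n h beta gamma).

Definition quot0 (x : L) : M := p (pure0 r x) (cdi0 r).
Notation p0 := quot0.

Definition real_bracket (u v : M) : M :=
  bracket (pure0 r u : cdV M r) (pure0 r v) (cdi0 r).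
Notation brg := real_bracket.

Let p_cd : cd_linear p. Proof. by case: pq => -[]. Qed.
Let p_lin : linear p. Proof. by case: p_cd => -[]. Qed.

(** [p] commutes with left and right multiplication, and the real part is where the two
    multiplications agree. *)
Lemma quot0E x : p (pure0 r x) = pure0 r (p0 x).
Proof. exact: cd_linear_pure0. Qed.

Lemma quot_coord x m : p x m = p0 (x m).
Proof.
rewrite [in LHS](pure_sum x) (linear_sum_of _ p_lin) sum_ffunE (bigD1 m) //=.
have E s : p (pure s (x s)) = pure s (p0 (x s)).
  by rewrite !pureE; case: p_cd => -[_ -> _]; rewrite quot0E.
rewrite E ffunE eqxx big1 ?addr0 // => s /negPf sm.
by rewrite E ffunE eq_sym sm.
Qed.

Lemma quot0_linear : linear p0.
Proof.
by move=> c x y; apply: (@pure0_inj R r M); rewrite -quot0E !pure0_is_linear p_lin !quot0E.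
Qed.

Lemma quot0_onto u : exists x, p0 x = u.
Proof.
have [_ /(_ (pure0 r u)) [x xE] _] := pq; exists (x (cdi0 r)).
by rewrite -quot_coord xE ffunE eqxx.
Qed.

Lemma quot0_eq0 x : p0 x = 0 <-> tau (pure0 r x).
Proof.
have [_ _ /(_ (pure0 r x)) <-] := pq; rewrite quot0E; split=> [->|].
  exact: pure0_0.
by rewrite -[0](pure0_0 r M) => /pure0_inj.
Qed.

Lemma quot0_br x y : p0 (br x y) = brg (p0 x) (p0 y).
Proof.
rewrite /real_bracket -!quot0E; have [[_ <-] _ _] := pq.
by rewrite eta_bracket_pure0.
Qed.

(** Compatibility of the bracket with the scalars is not a field of [lieCD]; it descends from [eta]
    because [p] is onto. *)
Lemma quot_bracket_coord x y m : bracket x y m =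
  \sum_s \sum_t cdmul (cdgen R s) (cdgen R t) 0 m *: brg (x s) (y t).
Proof.
have [[_ pbr] onto _] := pq; have [x' <-] := onto x; have [y' <-] := onto y.
rewrite -pbr quot_coord ffunE (linear_sum_of _ quot0_linear).
apply: eq_bigr => s _; rewrite (linear_sum_of _ quot0_linear).
apply: eq_bigr => t _; rewrite !quot_coord -quot0_br.
set c := cdmul _ _ _ _; have p00 : p0 0 = 0.
  by have := quot0_linear (-1) 0 0; rewrite !scaleN1r !addNr.
by have := quot0_linear c (br (x' s) (y' t)) 0; rewrite p00 !addr0.
Qed.

Lemma quot0_lin_closed : lin_closed (fun x : L => p0 x = 0).
Proof.
split=> [|c x y xE yE]; last by rewrite quot0_linear xE yE scaler0 addr0.
by have := quot0_linear (-1) 0 0; rewrite !scaleN1r !addNr.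
Qed.

End QuotientReal.

(** * Descent of the form to the quotient *)

Section QuotientForm.
Variables (R : realType) (r n : nat) (d : 'I_n -> R).
Variables (h : vectType R) (beta : 'I_n -> cddual R h r) (gamma : 'I_n -> cdV h r).
Variables (tau : set (cdV (lie0 (eta beta gamma)) r)) (g : lieCD R r).
Variable p : cdV (lie0 (eta beta gamma)) r -> cdV (lie0 g) r.
Hypothesis r_gt1 : (1 < r)%N.
Hypothesis beta_real : forall j (y : h), cdreal (ev (beta j) (pure0 r y)).
Hypothesis gamma_real : forall j m, m != cdi0 r -> gamma j m = 0.
Hypothesis tau_max : maximal_trivial_ideal tau.
Hypothesis pq : lie_quotient tau p.
Variables (S : h -> 'Hom(h, R^o)) (x0 : h).
Hypothesis d_sym : forall i j, d i * real_root beta i (real_coroot gamma j) =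
  d j * real_root beta j (real_coroot gamma i).
Hypothesis S_sym : forall x y, S x y = S y x.
Hypothesis S_coroot : forall x j, S x (real_coroot gamma j) = d j * real_root beta j x.
Hypothesis S_inj : forall x, S x = 0 -> x = 0.
Hypothesis x0_root : forall j, real_root beta j x0 = 1.

Notation L := (lie0 (eta beta gamma)).
Notation M := (lie0 g).
Notation br := (@eta0_br R r n h beta gamma).
Notation H := (@eta_th R r n h beta gamma).
Notation p0 := (quot0 p).
Notation brg := (@real_bracket R r g).

Let brl := @eta0_br_linearl _ _ _ _ beta gamma.
Let brr := @eta0_br_linearr _ _ _ _ beta gamma.
Let brC := @eta0_brC _ _ _ _ beta gamma.
Let brJ := @eta0_jacobi _ _ _ _ beta gamma.

Lemma eta_h_coord x m : eta_h beta gamma x m = H (x m).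
Proof. by rewrite ffunE. Qed.

(** The kernel of [p0] is the radical of [F]: one inclusion is [trivial_ideal_radical], the other is
    the maximality of [tau]. So [F] descends, and what it induces is non-degenerate. *)
Lemma quotient_form : exists Bg : M -> M -> R,
  [/\ (forall y, scalar (Bg y)) /\ (forall y, scalar (Bg^~ y)),
      forall x y, Bg x y = Bg y x,
      forall x y z, Bg (brg x y) z = Bg x (brg y z),
      forall x y, Bg (p0 (H x)) (p0 (H y)) = S x y &
      forall x, (forall y, Bg x y = 0) -> x = 0].
Proof.
have [F [[Fr Fl] FC Finv FS]] :=
  eta_form r_gt1 beta_real gamma_real d_sym S_sym S_coroot.
have C := eta_chevalley beta_real gamma_real.
have p_lin := quot0_linear r_gt1 pq.
have [[tau_sub tau_br] tau_h tau_m] := tau_max.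
have kerF x y : p0 x = 0 -> F x y = 0.
  move=> px; apply: (trivial_ideal_radical brl brr brC brJ (H := H) C
    (@eta_gen _ _ _ _ _ _) Fr Fl Finv x0_root (I := fun x => p0 x = 0)) => //.
  - exact: (quot0_lin_closed r_gt1 pq).
  - move=> u v /(quot0_eq0 r_gt1 pq) tv; apply/(quot0_eq0 r_gt1 pq).
    by rewrite -eta_bracket_pure0; case: (tau_br (pure0 r u) _ tv).
  - move=> u /(quot0_eq0 r_gt1 pq); rewrite -[pure0 _ _]eta_h_pure0 => /tau_h.
    by move/ffunP/(_ (cdi0 r)); rewrite !ffunE eqxx.
have radF x : (forall y, F x y = 0) -> p0 x = 0.
  move=> x_rad; apply/(quot0_eq0 r_gt1 pq).
  (* The radical, extended coordinate by coordinate, is an ideal containing [tau]; it meets [h]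
     trivially because [S] is non-degenerate. *)
  pose I : set (cdV L r) := [set u | forall s v, F (u s) v = 0]%classic.
  suff <- : I = tau.
    by move=> s v; rewrite ffunE; case: ifP => _ //; rewrite (functional0 (Fl v)).
  have Isum (J : finType) (c : J -> R) (u : J -> L) v :
      (forall j, F (u j) v = 0) -> F (\sum_j c j *: u j) v = 0.
    move=> u0; apply: (big_ind (fun w => F w v = 0)) => [|w w' wE w'E|j _].
    - exact: functional0 (Fl v).
    - by rewrite (functionalD _ _ (Fl v)) /= wE w'E addr0.
    - by rewrite (functionalZ _ _ (Fl v)) /= u0 mulr0.
  have Ibr : lie_ideal I.
    split; first split.
    - by move=> s v; rewrite ffunE (functional0 (Fl v)).
    - by move=> u w uI wI s v; rewrite ffunE (functionalD _ _ (Fl v)) /= uI wI addr0.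
    - by move=> a u uI s v; rewrite ffunE; exact: Isum.
    - by move=> a u uI s v; rewrite ffunE; exact: Isum.
    have sumI (c : 'I_(cddim r) -> 'I_(cddim r) -> R) u v :
        (forall s t, F (u s t) v = 0) -> F (\sum_s \sum_t c s t *: u s t) v = 0.
      move=> u0; under eq_bigr do rewrite -[\sum_(t < _) _]scale1r.
      by apply: (Isum) => s; exact: Isum.
    move=> u w wI; split=> s v; rewrite ffunE; apply: sumI => s' t.
      by rewrite brC (functionalN _ (Fl v)) /= Finv wI oppr0.
    by rewrite Finv wI.
  apply: tau_m => // [u uI|u].
    apply/ffunP=> s; rewrite eta_h_coord ffunE.
    suff -> : u s = 0 by rewrite /eta_th cls_H0.
    apply: S_inj; apply/lfunP=> y; rewrite zero_lfunE -FS.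
    by rewrite -eta_h_coord.
  move=> tu s v; apply: kerF; rewrite -(quot_coord r_gt1 pq).
  by have [_ _ /(_ u)[_ ->]] := pq; rewrite ?ffunE.
have onto := quot0_onto r_gt1 pq.
pose rep (u : M) := projT1 (cid (onto u)).
have repK u : p0 (rep u) = u by rewrite /rep; case: cid.
have p0B x y : p0 x = p0 y -> p0 (x - y) = 0.
  by move=> E; rewrite addrC -scaleN1r p_lin E scaleN1r addNr.
have FE x x' y y' : p0 x = p0 x' -> p0 y = p0 y' -> F x y = F x' y'.
  move=> /p0B/kerF xx' /p0B/kerF yy'.
  rewrite -[x](subrK x') (functionalD _ _ (Fl _)) /= xx' add0r.
  by rewrite FC -[y](subrK y') (functionalD _ _ (Fl _)) /= yy' add0r FC.
pose Bg u v := F (rep u) (rep v).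
have BgE x y : Bg (p0 x) (p0 y) = F x y by apply: FE; rewrite repK.
exists Bg; split.
- split=> [u c v w|u c v w]; rewrite -(repK u) -(repK v) -(repK w) -p_lin !BgE.
    exact: Fr.
  exact: Fl.
- by move=> u v; exact: FC.
- move=> u v w; rewrite -(repK u) -(repK v) -(repK w).
  by rewrite -!(quot0_br r_gt1 pq) !BgE Finv.
- by move=> x y; rewrite BgE FS.
- move=> u u0; rewrite -(repK u); apply: radF => y.
  by rewrite -BgE repK u0.
Qed.

Lemma lattice_coord (c : 'I_n -> int) k y :
  (\sum_j beta j *~ c j) k y = \sum_j (c j)%:~R * beta j k y.
Proof.
rewrite sum_ffunE sum_lfunE; apply: eq_bigr => j _.
by rewrite -scaler_int ffunE scale_lfunE.
Qed.

Definition weight_vector (b : cddual R h r) (v : M) : Prop :=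
  forall y : h, brg (p0 (H y)) v = b (cdi0 r) y *: v.

(** Words in [e] and [f] are weight vectors, and their weights are nonzero since [x0] takes on them
    plus or minus the length of the word as value. *)
Lemma weight_span (W : M -> Prop) : lin_closed W ->
  (forall x, W (p0 (H x))) ->
  (forall b, root_lattice beta b -> b <> 0 -> forall v, weight_vector b v -> W v) ->
  forall v, W v.
Proof.
move=> [W0 Wc] Wh Ww v; have [x <-] := quot0_onto r_gt1 pq v.
have p_lin := quot0_linear r_gt1 pq.
have [p00 _] := quot0_lin_closed r_gt1 pq.
have p0Z c u : p0 (c *: u) = c *: p0 u.
  by have := p_lin c u 0; rewrite p00 !addr0.
have C := eta_chevalley beta_real gamma_real.
(* The exponent [e] is 0 for words in the [e j] and 1 for words in the [f j]. *)
have lat (s : seq 'I_n) e : exists b, root_lattice beta b /\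
    forall y, b (cdi0 r) y = (-1) ^+ e * \sum_(j <- s) real_root beta j y.
  elim: s => [|j s [b [[c ->] bE]]].
    exists 0; split; first by exists (fun=> 0); rewrite big1 // => j _; rewrite mulr0z.
    by move=> y; rewrite ffunE lfunE big_nil mulr0.
  exists (\sum_k beta k *~ (c k + (k == j)%:R * (-1) ^+ e)); split; first by eexists.
  move=> y; rewrite big_cons mulrDr -bE !lattice_coord addrC -[RHS]addrC.
  under eq_bigr do rewrite intrD mulrDl.
  rewrite big_split /= addrC; congr (_ + _).
  rewrite (bigD1 j) //= eqxx mul1r rmorphXn /= rmorphN1 big1 ?addr0 // => k /negPf ->.
  by rewrite mul0r mul0r.
have lat_neq0 i w e (b : cddual R h r) : (forall y, b (cdi0 r) y =
    (-1) ^+ e * \sum_(j <- i :: w) real_root beta j y) -> b <> 0.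
  move=> bE b0; have /eqP := bE x0; rewrite b0 ffunE lfunE.
  rewrite (eq_bigr (fun=> 1)) => [|j _]; last exact: x0_root.
  rewrite big_const_seq count_predT iter_addr_0 eq_sym mulf_eq0 signr_eq0 /=.
  by rewrite pnatr_eq0.
move: x; apply: (word_span brl brr brC brJ C (@eta_gen _ _ _ _ _ _)) => //.
- by split=> [|c x y Wx Wy]; rewrite ?p00 // p_lin; exact: Wc.
- move=> i w; have [b [bl bE]] := lat (i :: w) 0%N; apply: (Ww b) => // [|y].
    exact: lat_neq0 bE.
  rewrite -(quot0_br r_gt1 pq) (br_h_word brl brC brJ _ _ _ C) p0Z bE.
  by rewrite expr0 mul1r.
- move=> i w; have [b [bl bE]] := lat (i :: w) 1%N; apply: (Ww b) => // [|y].
    exact: lat_neq0 bE.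
  rewrite -(quot0_br r_gt1 pq) (br_h_word_f brl brC brJ _ _ _ C) -scaleNr p0Z bE.
  by rewrite mulN1r.
Qed.

End QuotientForm.

(** * Root spaces and their real parts *)

Section RootSpaces.
Variables (R : realType) (r n : nat) (h : vectType R).
Variables (beta : 'I_n -> cddual R h r) (gamma : 'I_n -> cdV h r).
Variables (tau : set (cdV (lie0 (eta beta gamma)) r)) (g : lieCD R r).
Variable p : cdV (lie0 (eta beta gamma)) r -> cdV (lie0 g) r.
Hypothesis r_gt1 : (1 < r)%N.
Hypothesis pq : lie_quotient tau p.
Hypothesis beta_pure : forall j, beta j = pure0 r (real_root beta j).

Notation L := (lie0 (eta beta gamma)).
Notation M := (lie0 g).
Notation H := (@eta_th R r n h beta gamma).
Notation p0 := (quot0 p).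
Notation brg := (@real_bracket R r g).
Notation wv := (weight_vector p).

Definition quot_h (x : cdV h r) : cdV M r := p (eta_h beta gamma x).

Lemma quot_h_coord x m : quot_h x m = p0 (H (x m)).
Proof. by rewrite /quot_h (quot_coord r_gt1 pq) eta_h_coord. Qed.

Lemma quot_h_pure0 x : quot_h (pure0 r x) = pure0 r (p0 (H x)).
Proof. by rewrite /quot_h eta_h_pure0 (quot0E r_gt1 pq). Qed.

Lemma real_bracket_leibniz x y z : brg x (brg y z) = brg (brg x y) z + brg y (brg x z).
Proof.
have onto := quot0_onto r_gt1 pq; have p_lin := quot0_linear r_gt1 pq.
have [x' <-] := onto x; have [y' <-] := onto y; have [z' <-] := onto z.
rewrite -!(quot0_br r_gt1 pq) (br_leibniz (@eta0_br_linearl _ _ _ _ beta gamma)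
  (@eta0_brC _ _ _ _ beta gamma) (@eta0_jacobi _ _ _ _ beta gamma)).
by rewrite -[X in p0 (X + _)]scale1r p_lin scale1r.
Qed.

Lemma real_bracketC x y : brg x y = - brg y x.
Proof.
have onto := quot0_onto r_gt1 pq; have p_lin := quot0_linear r_gt1 pq.
have [x' <-] := onto x; have [y' <-] := onto y.
have [p00 _] := quot0_lin_closed r_gt1 pq.
rewrite -!(quot0_br r_gt1 pq) eta0_brC -scaleN1r.
by have := p_lin (-1) (eta0_br y' x') 0; rewrite p00 !addr0 scaleN1r.
Qed.

Lemma real_bracket_linear x : linear (brg x).
Proof.
move=> c y z; rewrite /real_bracket pure0_is_linear.
by rewrite [bracket _ _](bracket_linearr _ c) !ffunE.
Qed.

Lemma real_bracket_pure0 x y :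
  bracket (pure0 r x) (pure0 r y : cdV M r) = pure0 r (brg x y).
Proof.
by rewrite /real_bracket; have [z ->] := bracket_pure0 x y; rewrite ffunE eqxx.
Qed.

Lemma bracket_pure0l u (x : cdV M r) m : bracket (pure0 r u) x m = brg u (x m).
Proof.
have b0 v : brg 0 v = 0.
  have := real_bracket_linear v (-1) 0 0; rewrite !scaleN1r addNr addNr => v0.
  by rewrite real_bracketC v0 oppr0.
rewrite (quot_bracket_coord r_gt1 pq) (bigD1 (cdi0 r)) //= ffunE eqxx.
rewrite [X in _ + X]big1 => [|s /negPf s0]; last first.
  by rewrite big1 // => t _; rewrite ffunE s0 b0 scaler0.
rewrite addr0 (bigD1 m) //= big1 => [|t /negPf tm]; rewrite cdmul1l mxE.
  by rewrite !eqxx scale1r addr0.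
by rewrite eq_sym tm andbF scale0r.
Qed.

Lemma bracket_pure0r (x : cdV M r) v m : bracket x (pure0 r v) m = brg (x m) v.
Proof.
have b0 u : brg u 0 = 0.
  by have := real_bracket_linear u (-1) 0 0; rewrite !scaleN1r addNr addNr.
rewrite (quot_bracket_coord r_gt1 pq) (bigD1 m) //= [X in _ + X]big1 => [|s /negPf sm].
  rewrite addr0 (bigD1 (cdi0 r)) //= big1 => [|t /negPf t0].
    by rewrite cdmul1r mxE !eqxx scale1r addr0 ffunE eqxx.
  by rewrite ffunE t0 b0 scaler0.
rewrite big1 // => t _; rewrite ffunE; case: eqP => [->|_]; last by rewrite b0 scaler0.
by rewrite cdmul1r mxE eq_sym sm andbF scale0r.
Qed.

Lemma lattice_pure0 b k : root_lattice beta b -> k != cdi0 r -> b k = 0.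
Proof.
case=> c -> k0; apply/lfunP=> y; rewrite lattice_coord big1 ?lfunE // => j _.
by rewrite beta_pure ffunE (negPf k0) lfunE mulr0.
Qed.

Lemma lattice_eq0 b : root_lattice beta b -> (forall y, b (cdi0 r) y = 0) -> b = 0.
Proof.
move=> bl b0; apply/ffunP=> k; rewrite ffunE; have [->|k0] := eqVneq k (cdi0 r).
  by apply/lfunP=> y; rewrite b0 lfunE.
exact: lattice_pure0.
Qed.

Lemma latticeD b c : root_lattice beta b -> root_lattice beta c ->
  root_lattice beta (b + c).
Proof.
case=> k -> [l ->]; exists (fun j => k j + l j); rewrite -big_split.
by apply: eq_bigr => j _; rewrite mulrzDr.
Qed.

Lemma latticeN b : root_lattice beta b -> root_lattice beta (- b).
Proof.
case=> k ->; exists (fun j => - k j); rewrite -sumrN.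
by apply: eq_bigr => j _; rewrite mulrNz.
Qed.

Lemma ev_lattice b y : root_lattice beta b -> ev b y = \row_m b (cdi0 r) (y m).
Proof.
move=> bl; rewrite [RHS]row_sum_delta; apply: eq_bigr => s _.
have -> : \row_k b k (y s) = b (cdi0 r) (y s) *: cdgen R (cdi0 r).
  apply/rowP=> k; rewrite !mxE eqxx /=; case: eqP => [->|/eqP k0]; rewrite ?mulr1 //.
  by rewrite (lattice_pure0 bl k0) lfunE mulr0.
by rewrite cdmulZr cdmul1r mxE.
Qed.

Lemma root_space_coord b x m : root_lattice beta b ->
  root_space quot_h b x -> wv b (x m).
Proof.
move=> bl xb y; have /ffunP/(_ m) := xb (pure0 r y).
rewrite quot_h_pure0 bracket_pure0l => ->.
have -> : ev b (pure0 r y) = b (cdi0 r) y *: cdgen R (cdi0 r).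
  rewrite ev_lattice //; apply/rowP=> k; rewrite !mxE ffunE eqxx /=.
  by case: eqP => _; rewrite ?mulr1 // mulr0 linear0.
by rewrite lact_real ffunE.
Qed.

Lemma root_space_pure0 b v : root_lattice beta b -> wv b v ->
  root_space quot_h b (pure0 r v).
Proof.
move=> bl vb y; apply/ffunP=> m; rewrite bracket_pure0r quot_h_coord vb.
by rewrite lact_pure0E ffunE ev_lattice // mxE.
Qed.

Lemma root_space0 b : root_space quot_h b 0.
Proof.
move=> y; rewrite lact0.
by have := bracket_linearr (quot_h y) (-1) 0 0; rewrite !scaleN1r !addNr.
Qed.

Lemma weight_vector0 x : wv 0 (p0 (H x)).
Proof.
move=> y; rewrite ffunE lfunE scale0r -(quot0_br r_gt1 pq).
have -> : eta0_br (H y) (H x) = 0.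
  rewrite /eta_th cls_br -[RHS]cls0; apply/clsP; exact: eta_HH.
by have [] := quot0_lin_closed r_gt1 pq.
Qed.

Lemma weight_vector_br b c u v : wv b u -> wv c v -> wv (b + c) (brg u v).
Proof.
move=> ub vc y; rewrite real_bracket_leibniz ub vc ffunE lfunE scalerDl.
have bZ k x z : brg x (k *: z) = k *: brg x z.
  have b0 : brg x 0 = 0.
    by have := real_bracket_linear x (-1) 0 0; rewrite !scaleN1r addNr addNr.
  by have := real_bracket_linear x k z 0; rewrite b0 !addr0.
by rewrite bZ real_bracketC bZ -scalerN -real_bracketC.
Qed.

Variable B : M -> M -> R.
Hypothesis Br : forall y, scalar (B y).
Hypothesis Bl : forall y, scalar (B^~ y).
Hypothesis BC : forall x y, B x y = B y x.
Hypothesis Binv : forall x y z, B (brg x y) z = B x (brg y z).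

(** If [B u v] is nonzero, invariance under each [H y] forces [b + c] to vanish at [y]; a lattice
    element is determined by these real values. *)
Lemma weight_orthogonal b c u v : root_lattice beta b -> root_lattice beta c ->
  b + c <> 0 -> wv b u -> wv c v -> B u v = 0.
Proof.
move=> bl cl bc0 ub vc; apply: contra_notP bc0 => /eqP uv0.
apply: lattice_eq0; first exact: latticeD.
move=> y; rewrite ffunE lfunE /=; apply: (mulIf uv0); rewrite mul0r mulrDl.
have -> : b (cdi0 r) y * B u v = B (brg (p0 (H y)) u) v.
  by rewrite ub (functionalZ _ _ (Bl v)).
have -> : c (cdi0 r) y * B u v = B u (brg (p0 (H y)) v).
  by rewrite vc (functionalZ _ _ (Br u)).
by rewrite real_bracketC (functionalN _ (Bl v)) /= Binv addNr.
Qed.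

End RootSpaces.

(** * The form on [g (A)] *)

Section DualMap.
Variables (R : realType) (r : nat) (h : vectType R) (S : h -> 'Hom(h, R^o)).
Hypothesis S_linear : linear S.

Definition dual_ext (x : cdV h r) : cddual R h r := [ffun m => S (x m)].

Let SZ c x : S (c *: x) = c *: S x.
Proof.
have S0 : S 0 = 0 by have := S_linear (-1) 0 0; rewrite !scaleN1r !addNr.
by have := S_linear c x 0; rewrite S0 !addr0.
Qed.

Lemma dual_ext_cd_linear : cd_linear dual_ext.
Proof.
have lin : linear dual_ext.
  by move=> c x y; apply/ffunP=> m; rewrite !ffunE S_linear.
have E z x : dual_ext (lact z (pure0 r x)) = lact z (dual_ext (pure0 r x)).
  have -> : dual_ext (pure0 r x) = pure0 r (S x).
    apply/ffunP=> m; rewrite !ffunE; case: eqP => // _.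
    by rewrite -[X in S X](scale0r 0) SZ scale0r.
  by rewrite !lact_pure0E; apply/ffunP=> m; rewrite !ffunE SZ.
split; split=> // z x; rewrite ract_pure0 E.
have -> : dual_ext (pure0 r x) = pure0 r (S x).
  apply/ffunP=> m; rewrite !ffunE; case: eqP => // _.
  by rewrite -[X in S X](scale0r 0) SZ scale0r.
by rewrite ract_pure0.
Qed.

(** The sign in [pairing] is the one produced by commuting the two generators, so the two cancel. *)
Lemma pairing_dual_ext x y : pairing (dual_ext x) y = extform (fun u v => S u v) x y.
Proof.
rewrite /pairing /extform exchange_big; apply: eq_bigr => k _; apply: eq_bigr => s _.
rewrite [pure s _]pureE ev_lact.
have -> : \row_k0 (pure k (dual_ext x k)) k0 (y s) = S (x k) (y s) *: cdgen R k.
  apply/rowP=> k'; rewrite !mxE !ffunE eqxx /=.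
  by case: eqP => [_|_]; rewrite ?mulr1 // mulr0 lfunE.
rewrite cdmulZr (cdmul_genC R s k) !scalerA mulrAC -expr2 sqrr_sign.
by rewrite mul1r.
Qed.

End DualMap.

Theorem theorem20 (R : realType) (r n : nat) (A B : 'M[cd R r]_n)
    (d : 'I_n -> R) (h : vectType R) (beta : 'I_n -> cddual R h r)
    (gamma : 'I_n -> cdV h r) (h2 : set (cdV h r))
    (tau : set (cdV (lie0 (eta beta gamma)) r)) (g : lieCD R r)
    (p : cdV (lie0 (eta beta gamma)) r -> cdV (lie0 g) r) :
  r = 2%N \/ r = 3%N ->
  symmetrizable_by A d B ->
  realization A beta gamma ->
  (* h is a subspace of eta (A), see eta_h_injP *)
  injective (eta_h beta gamma) ->
  maximal_trivial_ideal tau ->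
  lie_quotient tau p ->
  cdsubspace h2 ->
  complementary (cdspan (range gamma)) h2 ->
  let i (x : cdV h r) : cdV (lie0 g) r := p (eta_h beta gamma x) in
  exists form : cdV (lie0 g) r -> cdV (lie0 g) r -> cd R r,
    [/\ nondegenerate_on form setT, form_symmetric form & form_linear form] /\
    (forall j x, form (i (gamma j)) (i x) = d j *: pairing (beta j) x) /\
    (forall x y, h2 x -> h2 y -> form (i x) (i y) = 0) /\
    (forall x y : lie0 g, cdreal (form (pure0 r x) (pure0 r y))) /\
    (forall x y z : lie0 g,
       form (bracket (pure0 r x) (pure0 r y)) (pure0 r z) =
       form (pure0 r x) (bracket (pure0 r y) (pure0 r z))) /\
    (forall b c, root_lattice beta b -> root_lattice beta c -> b + c <> 0 ->
       forall x y, root_space i b x -> root_space i c y -> form x y = 0) /\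
    (forall b, root_lattice beta b -> b <> 0 ->
       nondegenerate_on form (root_sum i b (- b))) /\
    exists (nu : cdV h r -> cddual R h r) (nu' : cddual R h r -> cdV h r),
      [/\ cd_linear nu, cancel nu nu', cancel nu' nu,
          (forall x y, pairing (nu x) y = form (i x) (i y)) &
          forall b, root_set beta i b ->
          forall x y, root_space i b x -> root_space i (- b) y ->
            bracket x y = lact (form x y) (i (nu' b))].
Proof.
move=> r23 AdB Areal inj_h tau_max pq h2_sub h2_compl i.
have r_gt1 : (1 < r)%N by case: r23 => ->.
have b_real := beta_real Areal.
have b_pure := beta_pure0 Areal.
have g_pure := gamma_pure0 Areal inj_h.
have g_real := gamma_real Areal inj_h.
have [S [x0 [[S_lin S_sym S_g S_h2 S_inj] x01]]] :=
  cartan_data r23 AdB Areal inj_h h2_sub h2_compl.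
have d_sym := root_coroot_sym AdB Areal inj_h.
have [F [[Fr Fl] FC Finv FS F_nd]] :=
  quotient_form r_gt1 b_real g_real tau_max pq d_sym S_sym S_g S_inj x01.
have span := weight_span r_gt1 b_real g_real pq x01.
have orth := weight_orthogonal r_gt1 pq b_pure Fr Fl Finv.
have brg_pure := @real_bracket_pure0 R r g.
have i_coord := quot_h_coord r_gt1 pq : forall x m, i x m = _.
have i_pure0 := quot_h_pure0 r_gt1 pq : forall x, i (pure0 r x) = _.
have F0r u : lin_closed (fun v => F u v = 0).
  by split=> [|c v w vE wE]; rewrite ?(functional0 (Fr u)) // Fr vE wE mulr0 addr0.
exists (extform F); split; last split; last split; last split; last split;
  last split; last split.
- split; [|exact: extform_symmetric|exact: extform_form_linear].
  apply: (@extform_nondegenerate _ _ _ F Fr Fl _ (fun=> True)) => // x _ s xs.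
  by apply: F_nd => v; exact: xs.
- move=> j x; rewrite g_pure i_pure0 extform_pure0l //; apply/rowP=> m.
  by rewrite !mxE i_coord FS S_sym S_g (pairing_coord b_real).
- move=> x y xh yh; apply: extform0 => s t; rewrite !i_coord FS.
  by apply: S_h2; apply: cdsubspace_pure0.
- by move=> x y; exists (F x y); rewrite extform_pure // cdmul1l.
- by move=> x y z; rewrite !brg_pure !extform_pure // Finv.
- move=> b c bl cl bc x y xb yc; apply: extform0 => s t.
  by apply: (orth b c) => //; exact: (root_space_coord r_gt1 pq b_pure).
- move=> b bl b0; have nbl := latticeN bl.
  apply: (@extform_nondegenerate _ _ _ F Fr Fl _
    (fun v => weight_vector p b v \/ weight_vector p (- b) v)) => //.
    move=> _ [y [z [yb zb ->]]] s v0; apply: F_nd; rewrite ffunE.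
    have yw : weight_vector p b (y s) by exact: (root_space_coord r_gt1 pq b_pure).
    have zw : weight_vector p (- b) (z s) by exact: (root_space_coord r_gt1 pq b_pure).
    (* Weights other than [b] and [- b] pair to zero with both components; the weights [b] and [- b]
       are covered by the assumption [v0]. *)
    have rest c v : root_lattice beta c -> weight_vector p c v -> b + c <> 0 ->
        - b + c <> 0 -> F (y s + z s) v = 0.
      move=> cl vc bc nbc; rewrite (functionalD _ _ (Fl v)) /=.
      by rewrite (orth b c) // (orth (- b) c) // addr0.
    apply: span => [//|x|c cl _ v vc].
      apply: (rest 0); rewrite ?addr0 //; first by exists (fun=> 0); rewrite big1.
      - exact: (weight_vector0 r_gt1 pq).
      - by move/eqP; rewrite oppr_eq0 => /eqP.
    have [bc|bc] := pselect (b + c = 0).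
      have cE : c = - b by apply/eqP; rewrite -addr_eq0 addrC bc.
      by have := v0 v; rewrite ffunE; apply; right; rewrite -cE.
    have [nbc|nbc] := pselect (- b + c = 0).
      have cE : c = b by apply/eqP; rewrite -subr_eq0 addrC nbc.
      by have := v0 v; rewrite ffunE; apply; left; rewrite -cE.
    exact: (rest c).
  move=> v [vb|vb].
    exists (pure0 r v), 0; split; rewrite ?addr0 //.
      exact: (root_space_pure0 r_gt1 pq b_pure).
    exact: root_space0.
  exists 0, (pure0 r v); split; rewrite ?add0r //; first exact: root_space0.
  exact: (root_space_pure0 r_gt1 pq b_pure).
(* [T] is the inverse of [S]; applied to coordinates it gives the inverse of [nu]. *)
have /choice[T TK] := injective_dual_onto S_lin S_inj.
have S0 : S 0 = 0 by have := S_lin (-1) 0 0; rewrite !scaleN1r !addNr.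
have SK x : T (S x) = x.
  apply/eqP; rewrite -subr_eq0; apply/eqP/S_inj; rewrite addrC -scaleN1r S_lin TK.
  by rewrite scaleN1r addNr.
exists (dual_ext S), (fun b : cddual R h r => [ffun m => T (b m)]); split.
- exact: dual_ext_cd_linear.
- by move=> x; apply/ffunP=> m; rewrite !ffunE SK.
- by move=> b; apply/ffunP=> m; rewrite !ffunE TK.
- move=> x y; rewrite pairing_dual_ext; apply: eq_bigr => s _; apply: eq_bigr => t _.
  by rewrite !i_coord FS.
move=> b [bl b0 _] x y xb yb; have nbl := latticeN bl.
set hb := T (b (cdi0 r)).
have -> : [ffun m => T (b m)] = pure0 r hb.
  apply/ffunP=> m; rewrite !ffunE; case: eqP => [->|/eqP m0] //.
  by rewrite (lattice_pure0 b_pure bl m0) -S0 SK.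
(* Both sides expand over pairs of coordinates with the same structure constants, which reduces the
   formula to real weight vectors. *)
rewrite i_pure0 lact_pure0E; apply/ffunP=> m; rewrite ffunE.
rewrite (quot_bracket_coord r_gt1 pq) summxE scaler_suml; apply: eq_bigr => s _.
rewrite summxE scaler_suml; apply: eq_bigr => t _; rewrite mxE mulrC -scalerA.
congr (_ *: _).
have xw : weight_vector p b (x s) by exact: (root_space_coord r_gt1 pq b_pure).
have yw : weight_vector p (- b) (y t) by exact: (root_space_coord r_gt1 pq b_pure).
set u := x s in xw *; set v := y t in yw *.
set hv := quot0 p _.
apply/eqP; rewrite -subr_eq0; apply/eqP/F_nd => z; move: z.
have hv0 : weight_vector p 0 hv by exact: (weight_vector0 r_gt1 pq).
have uv0 : weight_vector p 0 (real_bracket u v).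
  by rewrite -(subrr b); exact: (weight_vector_br r_gt1 pq).
have lat0 : root_lattice beta 0 by exists (fun=> 0); rewrite big1.
(* By non-degeneracy both sides are tested on spanning vectors. On [H z] invariance gives [b(z)]
   times the value of [F] at [u], [v], as does the choice of [hb]; on a vector of nonzero weight
   both sides vanish, being of weight zero. *)
apply: span => [//|z|c cl c0 z zc].
  rewrite addrC -scaleNr (Fl _) /= FS TK Finv (real_bracketC r_gt1 pq).
  rewrite (functionalN _ (Fr u)) yw ffunE opp_lfunE scaleNr (functionalN _ (Fr u)) opprK.
  by rewrite (functionalZ _ _ (Fr u)); ring.
have zero w : weight_vector p 0 w -> F w z = 0.
  by move=> w0; apply: (orth 0 c) => //; rewrite add0r.
by rewrite addrC -scaleNr (Fl _) /= !zero // mulr0 addr0.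
Qed.
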